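(* Assume the consistency of KM and let $\kappa$ be any infinite cardinal. Then there is a model of $\mathrm{KMU}_{\mathrm{R}}$ + AC in which $\kappa$-DC holds and Collection fails.
   Context: Urelement class theory is two-sorted: first-order variables range over sets and urelements (predicate $\mathcal{A}$ for urelements, $\in$), second-order variables over classes. ZU: urelements have no members, Extensionality for sets, Foundation, Pairing, Union, Powerset, Infinity, and Separation (for every class $Y$ and set $x$, $Y\cap x$ is a set). $\mathrm{KMU}_{\mathrm{R}}$ = ZU + Class Extensionality + Replacement (the image of a set under a class function is a set) + Full Comprehension (for every formula $\varphi$, possibly with class parameters and class quantifiers, $\{x:\varphi(x)\}$ is a class); AC: every set is well-orderable. KM is Kelley–Morse class theory without urelements. Collection: if $R$ is a class relation and $w$ a set with $\forall x\in w\,\exists y\,R(x,y)$, then there is a set $v$ with $\forall x\in w\,\exists y\in v\,R(x,y)$. $\kappa$-DC: for every class relation $R$ without terminal nodes (every $x$ has $y$ with $R(x,y)$) there is a function $f$ on $\kappa$ with $R(f\restriction\alpha,f(\alpha))$ for all $\alpha<\kappa$. *)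

(* Defs.v *)
From Stdlib Require Import List.
Import ListNotations.

(** * The two-sorted language

    Terms of both sorts are variables, written as de Bruijn indices; the object
    variables (sets and urelements) and the class variables are numbered
    separately, so an object quantifier does not shift class indices and vice
    versa. *)

Inductive form : Type :=
| fBot : form
| fUr : nat -> form                 (* x is a urelement *)
| fEq : nat -> nat -> form          (* x = y *)
| fMem : nat -> nat -> form         (* x is a member of the object y *)
| fEqC : nat -> nat -> form         (* X = Y *)
| fMemC : nat -> nat -> form        (* x is a member of the class X *)
| fImp : form -> form -> form
| fAnd : form -> form -> form
| fOr : form -> form -> form
| fAll : form -> form
| fEx : form -> form
| fAllC : form -> form
| fExC : form -> form.

Definition fNot (a : form) : form := fImp a fBot.
Definition fIff (a b : form) : form := fAnd (fImp a b) (fImp b a).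

Declare Scope form_scope.
Delimit Scope form_scope with form.
Bind Scope form_scope with form.
Notation "a ⇒ b" := (fImp a b) (at level 90, right associativity) : form_scope.
Notation "a ⇔ b" := (fIff a b) (at level 95, no associativity) : form_scope.
Notation "a /\ b" := (fAnd a b) : form_scope.
Notation "a \/ b" := (fOr a b) : form_scope.
Notation "~ a" := (fNot a) : form_scope.

Definition up (r : nat -> nat) (n : nat) : nat :=
  match n with 0 => 0 | S m => S (r m) end.

(* As terms are variables, substitution is renaming: [r] acts on the object
   variables and [q] on the class variables. *)
Fixpoint ren (r q : nat -> nat) (a : form) : form :=
  match a with
  | fBot => fBot
  | fUr x => fUr (r x)
  | fEq x y => fEq (r x) (r y)
  | fMem x y => fMem (r x) (r y)
  | fEqC x y => fEqC (q x) (q y)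
  | fMemC x y => fMemC (r x) (q y)
  | fImp a b => fImp (ren r q a) (ren r q b)
  | fAnd a b => fAnd (ren r q a) (ren r q b)
  | fOr a b => fOr (ren r q a) (ren r q b)
  | fAll a => fAll (ren (up r) q a)
  | fEx a => fEx (ren (up r) q a)
  | fAllC a => fAllC (ren r (up q) a)
  | fExC a => fExC (ren r (up q) a)
  end.

Definition idv (n : nat) : nat := n.

(* Instantiation of variable 0 by the variable [x]. *)
Definition inst (x n : nat) : nat := match n with 0 => x | S m => m end.

(** * Provability and consistency *)

(* Classical natural deduction with equality.  The axioms of [T] are not part of
   the context and are not shifted under quantifiers, so their free variables
   (the parameters of a scheme) are read as universally quantified. *)
Inductive prv (T : form -> Prop) : list form -> form -> Prop :=
| prv_ax G a : T a -> prv T G a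
| prv_hyp G a : In a G -> prv T G a
| prv_impI G a b : prv T (a :: G) b -> prv T G (fImp a b)
| prv_impE G a b : prv T G (fImp a b) -> prv T G a -> prv T G b
| prv_raa G a : prv T (fNot a :: G) fBot -> prv T G a
| prv_andI G a b : prv T G a -> prv T G b -> prv T G (fAnd a b)
| prv_andE1 G a b : prv T G (fAnd a b) -> prv T G a
| prv_andE2 G a b : prv T G (fAnd a b) -> prv T G b
| prv_orI1 G a b : prv T G a -> prv T G (fOr a b)
| prv_orI2 G a b : prv T G b -> prv T G (fOr a b)
| prv_orE G a b c :
    prv T G (fOr a b) -> prv T (a :: G) c -> prv T (b :: G) c -> prv T G c
| prv_allI G a : prv T (map (ren S idv) G) a -> prv T G (fAll a)
| prv_allE G a x : prv T G (fAll a) -> prv T G (ren (inst x) idv a)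
| prv_exI G a x : prv T G (ren (inst x) idv a) -> prv T G (fEx a)
| prv_exE G a b :
    prv T G (fEx a) ->
    prv T (a :: map (ren S idv) G) (ren S idv b) -> prv T G b
| prv_allCI G a : prv T (map (ren idv S) G) a -> prv T G (fAllC a)
| prv_allCE G a x : prv T G (fAllC a) -> prv T G (ren idv (inst x) a)
| prv_exCI G a x : prv T G (ren idv (inst x) a) -> prv T G (fExC a)
| prv_exCE G a b :
    prv T G (fExC a) ->
    prv T (a :: map (ren idv S) G) (ren idv S b) -> prv T G b
| prv_eqI G x : prv T G (fEq x x)
| prv_eqE G a x y :
    prv T G (fEq x y) ->
    prv T G (ren (inst x) idv a) -> prv T G (ren (inst y) idv a)
| prv_eqCI G x : prv T G (fEqC x x)
| prv_eqCE G a x y :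
    prv T G (fEqC x y) ->
    prv T G (ren idv (inst x) a) -> prv T G (ren idv (inst y) a).

Definition consistent (T : form -> Prop) : Prop := ~ prv T [] fBot.

(** * Models *)

(* Henkin-style structures: the class sort is an arbitrary type.  Equality of
   both sorts is interpreted by equality. *)
Record structure : Type := Structure {
  obj : Type;
  cls : Type;
  ur : obj -> Prop;
  mem : obj -> obj -> Prop;
  memC : obj -> cls -> Prop;
  obj_inhabited : inhabited obj;
  cls_inhabited : inhabited cls
}.
Arguments ur {_} _.
Arguments mem {_} _ _.
Arguments memC {_} _ _.

Definition scons {X : Type} (x : X) (s : nat -> X) (n : nat) : X :=
  match n with 0 => x | S m => s m end.

Fixpoint sat (M : structure) (s : nat -> obj M) (t : nat -> cls M) (a : form)
  : Prop :=
  match a with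
  | fBot => False
  | fUr x => ur (s x)
  | fEq x y => s x = s y
  | fMem x y => mem (s x) (s y)
  | fEqC x y => t x = t y
  | fMemC x y => memC (s x) (t y)
  | fImp a b => sat M s t a -> sat M s t b
  | fAnd a b => sat M s t a /\ sat M s t b
  | fOr a b => sat M s t a \/ sat M s t b
  | fAll a => forall x, sat M (scons x s) t a
  | fEx a => exists x, sat M (scons x s) t a
  | fAllC a => forall x, sat M s (scons x t) a
  | fExC a => exists x, sat M s (scons x t) a
  end.

(* Truth of the universal closure. *)
Definition holds (M : structure) (a : form) : Prop := forall s t, sat M s t a.

(* Truth at [k] of a formula whose only free variable is the object variable 0. *)
Definition holds_at (M : structure) (a : form) (k : obj M) : Prop :=
  forall s t, sat M (scons k s) t a.

Definition models (M : structure) (T : form -> Prop) : Prop :=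
  forall a, T a -> holds M a.

(** * Set-theoretic notions as formulas

    Numerical arguments are variables; [S x] is the variable [x] seen from under
    one more quantifier of its sort. *)

Local Open Scope form_scope.

Definition fSet (x : nat) : form := ~ fUr x.

Definition fSubset (x y : nat) : form := fAll (fMem 0 (S x) ⇒ fMem 0 (S y)).

Definition fEmpty (x : nat) : form := fAll (~ fMem 0 (S x)).

(* y = x ∪ {x} *)
Definition fSucc (y x : nat) : form :=
  fAll (fMem 0 (S y) ⇔ fMem 0 (S x) \/ fEq 0 (S x)).

(* z = {x, y} *)
Definition fUPair (z x y : nat) : form :=
  fAll (fMem 0 (S z) ⇔ fEq 0 (S x) \/ fEq 0 (S y)).

(* p = (x, y) := {{x}, {x, y}} *)
Definition fOPair (p x y : nat) : form :=
  fAll (fMem 0 (S p) ⇔ fUPair 0 (S x) (S x) \/ fUPair 0 (S x) (S y)).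

(* (x, y) ∈ R, for a class R *)
Definition fRelC (R x y : nat) : form :=
  fEx (fOPair 0 (S x) (S y) /\ fMemC 0 R).

(* (x, y) ∈ r, for a set r *)
Definition fRel (r x y : nat) : form :=
  fEx (fOPair 0 (S x) (S y) /\ fMem 0 (S r)).

Definition fIsRelC (R : nat) : form :=
  fAll (fMemC 0 R ⇒ fEx (fEx (fOPair 2 1 0))).

Definition fIsFunC (F : nat) : form :=
  fIsRelC F /\
  fAll (fAll (fAll (fRelC F 2 1 ⇒ fRelC F 2 0 ⇒ fEq 1 0))).

(* f is a function with domain d *)
Definition fIsFunOn (f d : nat) : form :=
  fSet f /\
  fAll (fMem 0 (S f) ⇒ fEx (fEx (fOPair 2 1 0))) /\
  fAll (fAll (fAll (fRel (3 + f) 2 1 ⇒ fRel (3 + f) 2 0 ⇒ fEq 1 0))) /\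
  fAll (fMem 0 (S d) ⇔ fEx (fRel (2 + f) 1 0)).

(* f is a bijection from d onto e *)
Definition fIsBij (f d e : nat) : form :=
  fIsFunOn f d /\
  fAll (fAll (fAll (fRel (3 + f) 2 0 ⇒ fRel (3 + f) 1 0 ⇒ fEq 2 1))) /\
  fAll (fMem 0 (S e) ⇔ fEx (fRel (2 + f) 0 1)).

(* g = f ↾ a *)
Definition fIsRestr (g f a : nat) : form :=
  fSet g /\
  fAll (fMem 0 (S g) ⇔
        fMem 0 (S f) /\
        fEx (fEx (fMem 1 (3 + a) /\ fOPair 2 1 0))).

(* von Neumann ordinals: transitive sets of sets, linearly ordered by ∈ (hence
   well-ordered, by Foundation) *)
Definition fOrdinal (x : nat) : form :=
  fSet x /\
  fAll (fMem 0 (S x) ⇒ fSet 0 /\ fSubset 0 (S x)) /\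
  fAll (fAll (fMem 1 (2 + x) ⇒ fMem 0 (2 + x) ⇒
              fMem 1 0 \/ fEq 1 0 \/ fMem 0 1)).

(* for an ordinal x: x and all its elements are zero or successors *)
Definition fFiniteOrd (x : nat) : form :=
  fAll (fEq 0 (S x) \/ fMem 0 (S x) ⇒
        fEmpty 0 \/ fEx (fMem 0 1 /\ fSucc 1 0)).

Definition fInfCardinal (k : nat) : form :=
  fOrdinal k /\
  ~ fFiniteOrd k /\
  fAll (fMem 0 (S k) ⇒ ~ fEx (fIsBij 0 1 (2 + k))).

(* r is a strict well-order of x *)
Definition fWellOrders (r x : nat) : form :=
  fAll (fMem 0 (S x) ⇒ ~ fRel (S r) 0 0) /\
  fAll (fAll (fAll (
    fMem 2 (3 + x) ⇒ fMem 1 (3 + x) ⇒ fMem 0 (3 + x) ⇒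
    fRel (3 + r) 2 1 ⇒ fRel (3 + r) 1 0 ⇒ fRel (3 + r) 2 0))) /\
  fAll (fAll (
    fMem 1 (2 + x) ⇒ fMem 0 (2 + x) ⇒
    fRel (2 + r) 1 0 \/ fEq 1 0 \/ fRel (2 + r) 0 1)) /\
  fAll (fSubset 0 (S x) ⇒ fEx (fMem 0 1) ⇒
        fEx (fMem 0 1 /\ fAll (fMem 0 2 ⇒ fEq 1 0 \/ fRel (3 + r) 1 0))).

(** * Axioms *)

Definition ax_urelements : form := fAll (fAll (fUr 1 ⇒ ~ fMem 0 1)).

Definition ax_extensionality : form :=
  fAll (fAll (fSet 1 ⇒ fSet 0 ⇒ fAll (fMem 0 2 ⇔ fMem 0 1) ⇒ fEq 1 0)).

Definition ax_foundation : form :=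
  fAll (fEx (fMem 0 1) ⇒ fEx (fMem 0 1 /\ fAll (fMem 0 2 ⇒ ~ fMem 0 1))).

Definition ax_pairing : form := fAll (fAll (fEx (fUPair 0 2 1))).

Definition ax_union : form :=
  fAll (fSet 0 ⇒
    fEx (fSet 0 /\ fAll (fMem 0 1 ⇔ fEx (fMem 0 3 /\ fMem 1 0)))).

Definition ax_powerset : form :=
  fAll (fSet 0 ⇒
    fEx (fSet 0 /\ fAll (fMem 0 1 ⇔ fSet 0 /\ fSubset 0 2))).

Definition ax_infinity : form :=
  fEx (fEx (fMem 0 1 /\ fSet 0 /\ fEmpty 0) /\
       fAll (fMem 0 1 ⇒ fEx (fMem 0 2 /\ fSucc 0 1))).

Definition ax_separation : form :=
  fAllC (fAll (fSet 0 ⇒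
    fEx (fSet 0 /\ fAll (fMem 0 1 ⇔ fMemC 0 0 /\ fMem 0 2)))).

Definition ax_class_ext : form :=
  fAllC (fAllC (fAll (fMemC 0 1 ⇔ fMemC 0 0) ⇒ fEqC 1 0)).

Definition ax_replacement : form :=
  fAllC (fIsFunC 0 ⇒ fAll (fSet 0 ⇒
    fEx (fSet 0 /\ fAll (fMem 0 1 ⇔ fEx (fMem 0 3 /\ fRelC 0 0 1))))).

(* The class of all x (object variable 0) such that a; the other free variables
   of a are parameters. *)
Definition ax_comprehension (a : form) : form :=
  fExC (fAll (fMemC 0 0 ⇔ ren idv S a)).

Definition ax_choice : form :=
  fAll (fSet 0 ⇒ fEx (fSet 0 /\ fWellOrders 0 1)).

Definition ax_no_urelements : form := fAll (~ fUr 0).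

Definition ax_collection : form :=
  fAllC (fIsRelC 0 ⇒ fAll (fSet 0 ⇒
    fAll (fMem 0 1 ⇒ fEx (fRelC 0 1 0)) ⇒
    fEx (fSet 0 /\
         fAll (fMem 0 2 ⇒ fEx (fMem 0 2 /\ fRelC 0 1 0))))).

(* k-DC; for α ∈ k the witnesses g and y are f ↾ α and f(α) *)
Definition ax_DC (k : nat) : form :=
  fAllC (fIsRelC 0 ⇒ fAll (fEx (fRelC 0 1 0)) ⇒
    fEx (fIsFunOn 0 (S k) /\
         fAll (fMem 0 (2 + k) ⇒
               fEx (fEx (fIsRestr 1 3 2 /\ fRel 3 2 0 /\ fRelC 0 1 0))))).

Local Close Scope form_scope.

(** * Theories *)

Inductive ZU : form -> Prop :=
| ZU_urelements : ZU ax_urelements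
| ZU_extensionality : ZU ax_extensionality
| ZU_foundation : ZU ax_foundation
| ZU_pairing : ZU ax_pairing
| ZU_union : ZU ax_union
| ZU_powerset : ZU ax_powerset
| ZU_infinity : ZU ax_infinity
| ZU_separation : ZU ax_separation.

Inductive KMU_R : form -> Prop :=
| KMU_R_ZU a : ZU a -> KMU_R a
| KMU_R_class_ext : KMU_R ax_class_ext
| KMU_R_replacement : KMU_R ax_replacement
| KMU_R_comprehension a : KMU_R (ax_comprehension a).

Definition extend (T : form -> Prop) (a : form) : form -> Prop :=
  fun b => T b \/ b = a.

Definition KM : form -> Prop := extend KMU_R ax_no_urelements.

(* [j] identifies [M] with a transitive part of [N]: every object of [M], and in
   particular every cardinal of [M], becomes an object of [N] with the same
   members. *)
Record transitive_embedding (M N : structure) (j : obj M -> obj N) : Prop := {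
  temb_ur : forall x, ur (j x) <-> ur x;
  temb_mem : forall x y, mem (j x) (j y) <-> mem x y;
  temb_trans : forall z y, mem z (j y) -> exists x, z = j x
}.

(** * Readings of the formulas in a structure *)

Definition is_subset {M : structure} (x y : obj M) : Prop :=
  forall z, mem z x -> mem z y.
Definition is_succ {M : structure} (y x : obj M) : Prop :=
  forall z, mem z y <-> mem z x \/ z = x.
Definition is_upair {M : structure} (z x y : obj M) : Prop :=
  forall w, mem w z <-> w = x \/ w = y.
Definition is_opair {M : structure} (p x y : obj M) : Prop :=
  forall z, mem z p <-> is_upair z x x \/ is_upair z x y.
Definition relC {M : structure} (R : cls M) (x y : obj M) : Prop :=
  exists p, is_opair p x y /\ memC p R.
Definition rel {M : structure} (r x y : obj M) : Prop :=
  exists p, is_opair p x y /\ mem p r.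
Definition is_relC {M : structure} (R : cls M) : Prop :=
  forall p, memC p R -> exists x y, is_opair p x y.
Definition is_fun_on {M : structure} (f d : obj M) : Prop :=
  ~ ur f /\
  (forall p, mem p f -> exists x y, is_opair p x y) /\
  (forall x y z, rel f x y -> rel f x z -> y = z) /\
  (forall x, mem x d <-> exists y, rel f x y).
Definition is_bij {M : structure} (f d e : obj M) : Prop :=
  is_fun_on f d /\
  (forall x y z, rel f x z -> rel f y z -> x = y) /\
  (forall y, mem y e <-> exists x, rel f x y).
Definition is_restr {M : structure} (g f a : obj M) : Prop :=
  ~ ur g /\
  (forall p, mem p g <-> mem p f /\ exists b y, mem b a /\ is_opair p b y).
Definition is_ordinal {M : structure} (x : obj M) : Prop :=
  ~ ur x /\
  (forall y, mem y x -> ~ ur y /\ is_subset y x) /\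
  (forall y z, mem y x -> mem z x -> mem y z \/ y = z \/ mem z y).
Definition is_finite_ord {M : structure} (x : obj M) : Prop :=
  forall y, y = x \/ mem y x ->
    (forall z, ~ mem z y) \/ exists z, mem z y /\ is_succ y z.
Definition well_orders {M : structure} (r x : obj M) : Prop :=
  (forall a, mem a x -> ~ rel r a a) /\
  (forall a b c, mem a x -> mem b x -> mem c x ->
     rel r a b -> rel r b c -> rel r a c) /\
  (forall a b, mem a x -> mem b x -> rel r a b \/ a = b \/ rel r b a) /\
  (forall s, is_subset s x -> (exists a, mem a s) ->
     exists a, mem a s /\ forall b, mem b s -> a = b \/ rel r a b).

Lemma sat_ordinal M s t x : sat M s t (fOrdinal x) <-> is_ordinal (s x).
Proof. reflexivity. Qed.

Lemma sat_inf_cardinal M s t k :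
  sat M s t (fInfCardinal k) <->
  is_ordinal (s k) /\ ~ is_finite_ord (s k) /\
  forall a, mem a (s k) -> ~ exists f, is_bij f a (s k).
Proof. reflexivity. Qed.

Lemma sat_replacement M s t :
  sat M s t ax_replacement <->
  forall F : cls M,
    is_relC F /\ (forall x y z, relC F x y -> relC F x z -> y = z) ->
  forall w : obj M, ~ ur w ->
  exists v, ~ ur v /\
    forall y, mem y v <-> exists x, mem x w /\ relC F x y.
Proof. reflexivity. Qed.

Lemma sat_choice M s t :
  sat M s t ax_choice <->
  forall x : obj M, ~ ur x -> exists r, ~ ur r /\ well_orders r x.
Proof. reflexivity. Qed.

Lemma sat_collection M s t :
  sat M s t ax_collection <->
  forall R : cls M, is_relC R ->
  forall w : obj M, ~ ur w ->
  (forall x, mem x w -> exists y, relC R x y) ->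
  exists v, ~ ur v /\ forall x, mem x w -> exists y, mem y v /\ relC R x y.
Proof. reflexivity. Qed.

Lemma sat_DC M s t k :
  sat M s t (ax_DC k) <->
  forall R : cls M, is_relC R ->
  (forall x, exists y, relC R x y) ->
  exists f, is_fun_on f (s k) /\
    forall a, mem a (s k) ->
    exists g y, is_restr g f a /\ rel f a y /\ relC R g y.
Proof. reflexivity. Qed.

Lemma sat_env M a : forall s s' t t',
  (forall n, s n = s' n) -> (forall n, t n = t' n) ->
  sat M s t a <-> sat M s' t' a.
Proof.
assert (ex_iff : forall (X : Type) (P Q : X -> Prop),
  (forall x, P x <-> Q x) -> (exists x, P x) <-> (exists x, Q x)).
{ intros X P Q H; split; intros [x Hx]; exists x; apply H; exact Hx. }
assert (all_iff : forall (X : Type) (P Q : X -> Prop),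
  (forall x, P x <-> Q x) -> (forall x, P x) <-> (forall x, Q x)).
{ intros X P Q H; split; intros Hx x; apply H; apply Hx. }
induction a; intros s s' t t' Hs Ht; simpl; rewrite ?(Hs n), ?(Hs n0), ?(Ht n),
    ?(Ht n0); try tauto;
  try (rewrite (IHa1 s s' t t' Hs Ht), (IHa2 s s' t t' Hs Ht); tauto);
  first [apply all_iff | apply ex_iff]; intro x; apply IHa; try assumption;
  intros [|m]; simpl; auto.
Qed.

Lemma sat_ren M a : forall r q s t,
  sat M s t (ren r q a) <-> sat M (fun n => s (r n)) (fun n => t (q n)) a.
Proof.
assert (ex_iff : forall (X : Type) (P Q : X -> Prop),
  (forall x, P x <-> Q x) -> (exists x, P x) <-> (exists x, Q x)).
{ intros X P Q H; split; intros [x Hx]; exists x; apply H; exact Hx. }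
assert (all_iff : forall (X : Type) (P Q : X -> Prop),
  (forall x, P x <-> Q x) -> (forall x, P x) <-> (forall x, Q x)).
{ intros X P Q H; split; intros Hx x; apply H; apply Hx. }
induction a; intros r q s t; simpl; try tauto;
  try (rewrite IHa1, IHa2; tauto);
  first [apply all_iff | apply ex_iff]; intro x; rewrite IHa; apply sat_env;
  intros [|m]; reflexivity.
Qed.

Lemma sat_comprehension M s t a :
  sat M s t (ax_comprehension a) <->
  exists X : cls M, forall x, memC x X <-> sat M (scons x s) t a.
Proof.
unfold ax_comprehension; simpl; split; intros [X H]; exists X; intro x;
  specialize (H x); revert H; rewrite sat_ren; unfold idv; simpl; tauto.
Qed.

(* Main.v *)
(** The existence of a model of KM with choice needs no hypothesis: the
    well-founded trees over a universe of types, up to bisimulation, with all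
    predicates on them as classes, form one.

    Now work inside a model of KM with choice, with an infinite cardinal κ.  Fix
    a set K closed under pairing that contains a copy of κ, and add a proper
    class of urelements, partitioned into blocks indexed by the power set of K,
    each block being a proper class.  A set of urelements is small when at most
    K-many blocks meet it.  The new objects are those built from a small set of
    urelements; the new classes are those fixed, for some small E, by all
    transpositions of two urelements of the same block outside E.

    Truth of a formula is preserved by transpositions, whence Full
    Comprehension.  For Replacement, a value of a class function with support E
    at an argument built from E is built from E: a urelement of it outside E
    could be exchanged with a fresh one of its block.  Unions of κ-many small
    sets are small because K × K injects into K, and this gives κ-DC.
    By Cantor's theorem no small set meets every block, so Collection fails for
    the relation between an index and the urelements of its block. *)

From Stdlib Require Import Classical ClassicalEpsilon.
From Stdlib Require Import PropExtensionality FunctionalExtensionality Arith Lia.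
From mathcomp Require ssreflect ssrbool eqtype boolp wochoice.
Require Import Defs.

(** Restricting the classes is forced. With all classes kept, the function sending an index i to the
    urelement built from (i, [empty]) would have a set as domain and a range that meets every block,
    so Replacement would fail. Symmetry removes such selectors: a small support misses whole blocks,
    and a block, being a proper class, always offers a partner for an exchange. New objects are
    coded by sets of the ground model with their literal membership, so Foundation and Separation
    are largely inherited; the price is that the inner elements of a coded urelement or of the coded
    empty set must not be codes themselves. Transpositions are class relations defined by recursion
    on membership. They are obtained as least fixed points, by quantifying over classes, and
    Comprehension is applied to Rocq predicates through a notion of definability. Choice is given
    for sets only, so no global well-order can select successors in dependent choice; proper classes
    of candidates are first cut down to their elements of least rank. *)

Definition choose {A : Type} {P : A -> Prop} (H : exists x, P x) : A :=
  proj1_sig (constructive_indefinite_description P H).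

Lemma choose_spec {A : Type} {P : A -> Prop} (H : exists x, P x) : P (choose H).
Proof. unfold choose. apply proj2_sig. Qed.

(** * Kuratowski pairs *)

Section OrderedPairs.
Variable M : structure.
Hypothesis ext : forall x y : obj M, (forall z, mem z x <-> mem z y) -> x = y.
Hypothesis pairing : forall x y : obj M, exists z, is_upair z x y.

Lemma upair_unique (p q x y : obj M) : is_upair p x y -> is_upair q x y -> p = q.
Proof. intros H K. apply ext. intro z. rewrite (H z), (K z). tauto. Qed.

Lemma opair_exists (x y : obj M) : exists p, is_opair p x y.
Proof.
destruct (pairing x x) as [s Hs], (pairing x y) as [u Hu], (pairing s u) as [p Hp].
exists p. intro z. rewrite (Hp z).
split; (intros [H|H]; [left|right]);
  try (subst z; assumption); eapply upair_unique; eauto.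
Qed.

Lemma opair_inj (p x y x' y' : obj M) :
  is_opair p x y -> is_opair p x' y' -> x = x' /\ y = y'.
Proof.
intros H H'.
destruct (pairing x x) as [s Hs], (pairing x y) as [u Hu].
destruct (pairing x' x') as [s' Hs'], (pairing x' y') as [u' Hu'].
assert (Ex : x = x').
{ assert (K : mem s p) by (apply H; auto).
  apply H' in K. destruct K as [K|K]; symmetry; [cut (x' = x \/ x' = x)|cut (x' = x \/ x' = x)];
  try tauto; apply (Hs x'), K; auto. }
subst x'. split; [reflexivity|].
assert (K : mem u p) by (apply H; auto).
assert (K' : mem u' p) by (apply H'; auto).
apply H' in K. apply H in K'.
assert (A : y = x \/ y = y').
{ destruct K as [K|K]; [cut (y = x \/ y = x); [tauto|]|]; apply K, Hu; auto. }
assert (B : y' = x \/ y' = y).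
{ destruct K' as [K'|K']; [cut (y' = x \/ y' = x); [tauto|]|]; apply K', Hu'; auto. }
destruct A as [A|A]; [|exact A]. destruct B as [B|B]; congruence.
Qed.
End OrderedPairs.

(** * Definability with parameters *)

(* The environment is read through [c], which redirects every variable either to a
   variable or to a parameter. *)
Definition value {X : Type} (c : nat + X) (s : nat -> X) : X :=
  match c with inl n => s n | inr x => x end.

(** Comprehension is stated for deep formulas, while the arguments below use Rocq predicates; this
    notion is the bridge. Parameters sit in the redirections [c] and [d], so elements of the model
    may occur in a predicate without being variables. *)
Definition definable {M : structure} (P : (nat -> obj M) -> (nat -> cls M) -> Prop) : Prop :=
  exists (a : form) (c : nat -> nat + obj M) (d : nat -> nat + cls M),
    forall s t, P s t <-> sat M (fun n => value (c n) s) (fun n => value (d n) t) a.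

Definition term {X : Type} (u : (nat -> X) -> X) : Prop :=
  exists c, forall s, u s = value c s.

Lemma term_var {X : Type} n : term (fun s : nat -> X => s n).
Proof. exists (inl n). reflexivity. Qed.

Lemma term_const {X : Type} (x : X) : term (fun _ => x).
Proof. exists (inr x). reflexivity. Qed.

Section Definable.
Variable M : structure.
Implicit Types P Q : (nat -> obj M) -> (nat -> cls M) -> Prop.
Implicit Types u v : (nat -> obj M) -> obj M.
Implicit Types U W : (nat -> cls M) -> cls M.

Lemma definable_iff P Q : (forall s t, P s t <-> Q s t) -> definable P -> definable Q.
Proof.
intros H [a [c [d E]]]. exists a, c, d. intros s t. rewrite <- H. apply E.
Qed.

Lemma definable_const (A : Prop) : @definable M (fun _ _ => A).
Proof.
destruct (obj_inhabited M) as [x], (cls_inhabited M) as [X].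
destruct (classic A) as [H|H];
  [exists (fImp fBot fBot)|exists fBot]; exists (fun _ => inr x), (fun _ => inr X); simpl; tauto.
Qed.

Lemma definable_mem u v : term u -> term v -> definable (fun s _ => mem (u s) (v s)).
Proof.
intros [c Hc] [d Hd]. destruct (cls_inhabited M) as [X].
exists (fMem 0 1), (fun n => match n with 0 => c | _ => d end), (fun _ => inr X).
intros s t. simpl. rewrite Hc, Hd. tauto.
Qed.

Lemma definable_eq u v : term u -> term v -> @definable M (fun s _ => u s = v s).
Proof.
intros [c Hc] [d Hd]. destruct (cls_inhabited M) as [X].
exists (fEq 0 1), (fun n => match n with 0 => c | _ => d end), (fun _ => inr X).
intros s t. simpl. rewrite Hc, Hd. tauto.
Qed.

Lemma definable_eqC U W : term U -> term W -> @definable M (fun _ t => U t = W t).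
Proof.
intros [c Hc] [d Hd]. destruct (obj_inhabited M) as [x].
exists (fEqC 0 1), (fun _ => inr x), (fun n => match n with 0 => c | _ => d end).
intros s t. simpl. rewrite Hc, Hd. tauto.
Qed.

Lemma definable_memC u U : term u -> term U -> definable (fun s t => memC (u s) (U t)).
Proof.
intros [c Hc] [d Hd].
exists (fMemC 0 0), (fun _ => c), (fun _ => d).
intros s t. simpl. rewrite Hc, Hd. tauto.
Qed.

Definition interleave {X : Type} (f g : nat -> X) (n : nat) : X :=
  if Nat.even n then f (Nat.div2 n) else g (Nat.div2 n).

Lemma interleave_even {X : Type} (f g : nat -> X) n : interleave f g (2 * n) = f n.
Proof. unfold interleave. rewrite Nat.div2_double, Nat.even_mul. reflexivity. Qed.

Lemma interleave_odd {X : Type} (f g : nat -> X) n : interleave f g (S (2 * n)) = g n.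
Proof.
unfold interleave. rewrite Nat.div2_succ_double, Nat.even_succ, Nat.odd_mul. reflexivity.
Qed.

(** The two formulas come with separate redirections. Moving one to the even and the other to the
    odd variables lets a single interleaved redirection serve both, as a binary connective
    requires. *)
Lemma definable_common P Q :
  definable P -> definable Q ->
  exists a b c d,
    (forall s t, P s t <-> sat M (fun n => value (c n) s) (fun n => value (d n) t) a) /\
    (forall s t, Q s t <-> sat M (fun n => value (c n) s) (fun n => value (d n) t) b).
Proof.
intros [a [c [d H]]] [a' [c' [d' H']]].
exists (ren (fun n => 2 * n) (fun n => 2 * n) a),
  (ren (fun n => S (2 * n)) (fun n => S (2 * n)) a'), (interleave c c'), (interleave d d').
split; intros s t; rewrite sat_ren; [rewrite H|rewrite H']; apply sat_env; intro n;
  rewrite ?interleave_even, ?interleave_odd; reflexivity.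
Qed.

Lemma definable_imp P Q :
  definable P -> definable Q -> definable (fun s t => P s t -> Q s t).
Proof.
intros HP HQ. destruct (definable_common P Q HP HQ) as [a [b [c [d [H K]]]]].
exists (fImp a b), c, d. intros s t. simpl. rewrite H, K. tauto.
Qed.

Lemma definable_and P Q :
  definable P -> definable Q -> definable (fun s t => P s t /\ Q s t).
Proof.
intros HP HQ. destruct (definable_common P Q HP HQ) as [a [b [c [d [H K]]]]].
exists (fAnd a b), c, d. intros s t. simpl. rewrite H, K. tauto.
Qed.

Lemma definable_or P Q :
  definable P -> definable Q -> definable (fun s t => P s t \/ Q s t).
Proof.
intros HP HQ. destruct (definable_common P Q HP HQ) as [a [b [c [d [H K]]]]].
exists (fOr a b), c, d. intros s t. simpl. rewrite H, K. tauto.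
Qed.

Lemma definable_not P : definable P -> definable (fun s t => ~ P s t).
Proof. intro H. apply definable_imp; [exact H|apply definable_const]. Qed.

Lemma definable_iff_intro P Q :
  definable P -> definable Q -> definable (fun s t => P s t <-> Q s t).
Proof. intros H K. apply definable_and; apply definable_imp; assumption. Qed.

Definition bound {X : Type} (c : nat + X) : bool :=
  match c with inl 0 => true | _ => false end.

Definition lower {X : Type} (z : X) (c : nat + X) : nat + X :=
  match c with inl 0 => inr z | inl (S n) => inl n | inr x => inr x end.

(** Several variables of a formula may be redirected to the variable about to be bound. They are all
    renamed to 0 and the others are shifted; [lower] fills the vacated positions with an arbitrary
    [z]. *)
Definition slot {X : Type} (c : nat -> nat + X) (n : nat) : nat :=
  if bound (c n) then 0 else S n.

Lemma value_slot {X : Type} (z x : X) (c : nat -> nat + X) s n :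
  value (c n) (scons x s) = scons x (fun n => value (lower z (c n)) s) (slot c n).
Proof. unfold slot. destruct (c n) as [[|m]|y] eqn:E; simpl; rewrite ?E; reflexivity. Qed.

(** The bound element is read from position 0 of the environment, so the premise of a quantifier
    rule is again a predicate on environments. *)
Lemma definable_scons (Q : (nat -> obj M) -> (nat -> cls M) -> obj M -> Prop) :
  definable (fun s t => Q (fun n => s (S n)) t (s 0)) ->
  exists a c d, forall s t x,
    Q s t x <-> sat M (scons x (fun n => value (c n) s)) (fun n => value (d n) t) a.
Proof.
intros [a [c [d H]]]. destruct (obj_inhabited M) as [z].
exists (ren (slot c) idv a), (fun n => lower z (c n)), d.
intros s t x. rewrite sat_ren. rewrite (H (scons x s) t). apply sat_env; intro n.
- apply value_slot.
- reflexivity.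
Qed.

Lemma definable_sconsC (Q : (nat -> obj M) -> (nat -> cls M) -> cls M -> Prop) :
  definable (fun s t => Q s (fun n => t (S n)) (t 0)) ->
  exists a c d, forall s t x,
    Q s t x <-> sat M (fun n => value (c n) s) (scons x (fun n => value (d n) t)) a.
Proof.
intros [a [c [d H]]]. destruct (cls_inhabited M) as [z].
exists (ren idv (slot d) a), c, (fun n => lower z (d n)).
intros s t x. rewrite sat_ren. rewrite (H s (scons x t)). apply sat_env; intro n.
- reflexivity.
- apply value_slot.
Qed.

Lemma definable_all (Q : (nat -> obj M) -> (nat -> cls M) -> obj M -> Prop) :
  definable (fun s t => Q (fun n => s (S n)) t (s 0)) ->
  definable (fun s t => forall x, Q s t x).
Proof.
intro H. destruct (definable_scons Q H) as [a [c [d E]]].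
exists (fAll a), c, d. intros s t. simpl. split; intros K x; apply E, K.
Qed.

Lemma definable_ex (Q : (nat -> obj M) -> (nat -> cls M) -> obj M -> Prop) :
  definable (fun s t => Q (fun n => s (S n)) t (s 0)) ->
  definable (fun s t => exists x, Q s t x).
Proof.
intro H. destruct (definable_scons Q H) as [a [c [d E]]].
exists (fEx a), c, d. intros s t. simpl. split; intros [x K]; exists x; apply E, K.
Qed.

Lemma definable_allC (Q : (nat -> obj M) -> (nat -> cls M) -> cls M -> Prop) :
  definable (fun s t => Q s (fun n => t (S n)) (t 0)) ->
  definable (fun s t => forall x, Q s t x).
Proof.
intro H. destruct (definable_sconsC Q H) as [a [c [d E]]].
exists (fAllC a), c, d. intros s t. simpl. split; intros K x; apply E, K.
Qed.

Lemma definable_exC (Q : (nat -> obj M) -> (nat -> cls M) -> cls M -> Prop) :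
  definable (fun s t => Q s (fun n => t (S n)) (t 0)) ->
  definable (fun s t => exists x, Q s t x).
Proof.
intro H. destruct (definable_sconsC Q H) as [a [c [d E]]].
exists (fExC a), c, d. intros s t. simpl. split; intros [x K]; exists x; apply E, K.
Qed.

Lemma class_of (P : obj M -> Prop) :
  (forall a, holds M (ax_comprehension a)) ->
  definable (fun s _ => P (s 0)) -> exists X : cls M, forall x, memC x X <-> P x.
Proof.
intros HC H. destruct (definable_scons (fun _ _ x => P x) H) as [a [c [d E]]].
destruct (obj_inhabited M) as [z], (cls_inhabited M) as [Z].
destruct (proj1 (sat_comprehension M (fun n => value (c n) (fun _ => z))
                   (fun n => value (d n) (fun _ => Z)) a) (HC a _ _)) as [X HX].
exists X. intro x. rewrite HX. symmetry. apply (E (fun _ => z) (fun _ => Z)).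
Qed.

Lemma definable_subst P (f : nat -> (nat -> obj M) -> obj M) (g : nat -> (nat -> cls M) -> cls M) :
  definable P -> (forall n, term (f n)) -> (forall n, term (g n)) ->
  definable (fun s t => P (fun n => f n s) (fun n => g n t)).
Proof.
intros [a [c [d H]]] Hf Hg.
set (cf := fun n => choose (Hf n)). set (cg := fun n => choose (Hg n)).
exists a, (fun n => match c n with inl m => cf m | inr x => inr x end),
  (fun n => match d n with inl m => cg m | inr x => inr x end).
intros s t. rewrite H. apply sat_env; intro n.
- destruct (c n); simpl; [apply (choose_spec (Hf _))|reflexivity].
- destruct (d n); simpl; [apply (choose_spec (Hg _))|reflexivity].
Qed.

Lemma definable_app (P : obj M -> Prop) u :
  definable (fun s _ => P (s 0)) -> term u -> definable (fun s _ => P (u s)).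
Proof.
intros H Hu. apply (definable_subst (fun s _ => P (s 0)) (fun _ => u) (fun n t => t n) H);
  intro n; [exact Hu|apply term_var].
Qed.

Lemma definable_app2 (P : obj M -> obj M -> Prop) u v :
  definable (fun s _ => P (s 1) (s 0)) -> term u -> term v ->
  definable (fun s _ => P (u s) (v s)).
Proof.
intros H Hu Hv.
apply (definable_subst (fun s _ => P (s 1) (s 0))
         (fun n => match n with 0 => v | _ => u end) (fun n t => t n) H);
  intro n; [destruct n; assumption|apply term_var].
Qed.

Lemma definable_app3 (P : obj M -> obj M -> obj M -> Prop) u v w :
  definable (fun s _ => P (s 2) (s 1) (s 0)) -> term u -> term v -> term w ->
  definable (fun s _ => P (u s) (v s) (w s)).
Proof.
intros H Hu Hv Hw.
apply (definable_subst (fun s _ => P (s 2) (s 1) (s 0))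
         (fun n => match n with 0 => w | 1 => v | _ => u end) (fun n t => t n) H);
  intro n; [destruct n as [|[|n]]; assumption|apply term_var].
Qed.
End Definable.

Ltac term_tac := first [apply term_var | apply term_const].

Ltac def_step :=
  first
  [ apply definable_const
  | assumption
  | apply definable_mem; term_tac
  | apply definable_eq; term_tac
  | apply definable_memC; term_tac
  | apply definable_eqC; term_tac
  | apply definable_and
  | apply definable_or
  | apply definable_iff_intro
  | apply definable_not
  | apply definable_imp
  | apply definable_all
  | apply definable_ex
  | apply definable_allC
  | apply definable_exC ]; cbv beta.
Ltac def_tac := cbv beta; repeat def_step.

(** This transfers the well-ordering principle from boolean to propositional predicates. Uniqueness
    of the least element is kept because antisymmetry is derived from it. *)
Lemma least_element_order (T : Type) :
  exists R : T -> T -> Prop, forall P : T -> Prop, (exists x, P x) ->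
    exists x, P x /\ (forall y, P y -> R x y) /\
      (forall z, P z -> (forall y, P y -> R z y) -> z = x).
Proof.
destruct (wochoice.well_ordering_principle (boolp.boolp_classicType__canonical__eqtype_Equality T)) as [R HR].
exists (fun x y => is_true (R x y)). intros P [x0 HP].
set (A := (fun x : T => boolp.asbool (P x)) : ssrbool.pred_sort (ssrbool.predPredType T)).
assert (E : forall x, is_true (ssrbool.in_mem x (ssrbool.mem A)) <-> P x).
{ intro x. change (is_true (boolp.asbool (P x)) <-> P x). split; intro H.
  - apply (ssrbool.elimT (boolp.asboolP _)); exact H.
  - apply (ssrbool.introT (boolp.asboolP _)); exact H. }
destruct (HR A) as [x [[H1 H2] H3]].
{ exists x0. apply E, HP. }
exists x. split; [apply E, H1|]. split.
- intros y Hy. apply H2. apply E, Hy.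
- intros z Hz Hy. symmetry. apply H3. split; [apply E, Hz|]. intros y Hy'. apply Hy, E, Hy'.
Qed.

(** * The model of trees *)

Module Trees.

Inductive tree : Type := node (I : Type) (f : I -> tree).

Fixpoint equ (s t : tree) : Prop :=
  match s, t with
  | node _ f, node _ g =>
      (forall i, exists j, equ (f i) (g j)) /\ (forall j, exists i, equ (f i) (g j))
  end.

Lemma equ_refl t : equ t t.
Proof. induction t as [I f IH]; simpl; split; intro i; exists i; apply IH. Qed.

Lemma equ_sym s : forall t, equ s t -> equ t s.
Proof.
induction s as [I f IH]; intros [J g] [H1 H2]; split.
- intro j. destruct (H2 j) as [i Hi]. exists i. apply IH, Hi.
- intro i. destruct (H1 i) as [j Hj]. exists j. apply IH, Hj.
Qed.

Lemma equ_trans s : forall t u, equ s t -> equ t u -> equ s u.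
Proof.
induction s as [I f IH]; intros [J g] [K h] [H1 H2] [H3 H4]; split.
- intro i. destruct (H1 i) as [j Hj], (H3 j) as [k Hk]. exists k. eapply IH; eauto.
- intro k. destruct (H4 k) as [j Hj], (H2 j) as [i Hi]. exists i. eapply IH; eauto.
Qed.

(* Canonical representatives make equality of sets Leibniz equality. *)
Definition repr (t : tree) : tree := epsilon (inhabits t) (equ t).

Lemma repr_equ t : equ t (repr t).
Proof. unfold repr. apply epsilon_spec. exists t. apply equ_refl. Qed.

Lemma repr_eq s t : equ s t -> repr s = repr t.
Proof.
intro H. unfold repr.
assert (E : equ s = equ t).
(* Bisimilar trees define the same predicate, so [epsilon] picks the same representative; the
   inhabitance witnesses agree by proof irrelevance. *)
{ apply functional_extensionality. intro u. apply propositional_extensionality.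
  split; intro K; [apply (equ_trans _ s _ (equ_sym _ _ H) K)|apply (equ_trans _ _ _ H K)]. }
rewrite E. rewrite (proof_irrelevance _ (inhabits s) (inhabits t)). reflexivity.
Qed.

Definition V : Type := {t : tree | repr t = t}.

Lemma repr_repr t : repr (repr t) = repr t.
Proof. symmetry. apply repr_eq, repr_equ. Qed.

Definition quo (t : tree) : V := exist _ (repr t) (repr_repr t).

Lemma quo_val (x : V) : quo (proj1_sig x) = x.
Proof.
destruct x as [t Ht]. unfold quo. simpl. apply eq_sig_hprop; [intros; apply proof_irrelevance|exact Ht].
Qed.

Lemma quo_eq s t : quo s = quo t <-> equ s t.
Proof.
split; intro H.
- apply (f_equal (@proj1_sig _ _)) in H. simpl in H.
  eapply equ_trans; [apply repr_equ|]. rewrite H. apply equ_sym, repr_equ.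
- apply eq_sig_hprop; [intros; apply proof_irrelevance|]. apply repr_eq, H.
Qed.

Definition sup {I : Type} (f : I -> V) : V := quo (node I (fun i => proj1_sig (f i))).

Definition idx (x : V) : Type := match proj1_sig x with node A _ => A end.

Definition fam (x : V) : idx x -> V :=
  match proj1_sig x as t return match t with node A _ => A end -> V with
  | node A f => fun i => quo (f i)
  end.

Definition In_ (x y : V) : Prop := exists i, fam y i = x.

(** The chosen representative may be indexed by another type; its bisimulation with the given tree
    translates indices both ways. *)
Lemma In_sup I (f : I -> V) x : In_ x (sup f) <-> exists i, f i = x.
Proof.
unfold In_, fam, idx. simpl.
pose proof (repr_equ (node I (fun i => proj1_sig (f i)))) as H. revert H.
generalize (repr (node I (fun i => proj1_sig (f i)))). intros [J g] [H1 H2]. split.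
- intros [j <-]. destruct (H2 j) as [i Hi]. exists i. rewrite <- (quo_val (f i)). apply quo_eq, Hi.
- intros [i <-]. destruct (H1 i) as [j Hj]. exists j. rewrite <- (quo_val (f i)). symmetry. apply quo_eq, Hj.
Qed.

Lemma V_ext x y : (forall z, In_ z x <-> In_ z y) -> x = y.
Proof.
rewrite <- (quo_val x), <- (quo_val y). intro H. apply quo_eq.
assert (E : forall t z, In_ z (quo t) <-> match t with node A f => exists i, quo (f i) = z end).
{ intros [I f] z.
  assert (K : quo (node I f) = sup (fun i => quo (f i))).
  { apply quo_eq. split; intro i; exists i; apply repr_equ. }
  rewrite K. apply In_sup. }
destruct (proj1_sig x) as [I f], (proj1_sig y) as [J g].
split.
- intro i. destruct (proj1 (E _ _) (proj1 (H _) (proj2 (E (node I f) _) (ex_intro _ i eq_refl)))) as [j Hj].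
  exists j. apply equ_sym. apply quo_eq, Hj.
- intro j. destruct (proj1 (E _ _) (proj2 (H _) (proj2 (E (node J g) _) (ex_intro _ j eq_refl)))) as [i Hi].
  exists i. apply quo_eq, Hi.
Qed.

Lemma V_ind (P : V -> Prop) : (forall x, (forall y, In_ y x -> P y) -> P x) -> forall x, P x.
Proof.
intros HP x. rewrite <- (quo_val x). induction (proj1_sig x) as [I f IH].
assert (K : quo (node I f) = sup (fun i => quo (f i))).
{ apply quo_eq. split; intro i; exists i; apply repr_equ. }
rewrite K. apply HP. intros y Hy. rewrite In_sup in Hy. destruct Hy as [i <-]. apply IH.
Qed.

Definition empty : V := sup (fun i : Empty_set => match i with end).
Definition sep (P : V -> Prop) (x : V) : V := sup (fun i : {i : idx x | P (fam x i)} => fam x (proj1_sig i)).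
Definition pair (x y : V) : V := sup (fun b : bool => if b then x else y).
Definition image (F : V -> V) (x : V) : V := sup (fun i => F (fam x i)).
Definition union (x : V) : V := sup (fun p : {i : idx x & idx (fam x i)} => fam (fam x (projT1 p)) (projT2 p)).
Definition power (x : V) : V := sup (fun P : idx x -> Prop => sup (fun i : {i | P i} => fam x (proj1_sig i))).

Lemma In_empty x : ~ In_ x empty.
Proof. unfold empty. rewrite In_sup. intros [[] _]. Qed.

Lemma In_sep P x z : In_ z (sep P x) <-> P z /\ In_ z x.
Proof.
unfold sep. rewrite In_sup. split.
- intros [[i Hi] <-]. split; [exact Hi|exists i; reflexivity].
- intros [H [i <-]]. exists (exist _ i H). reflexivity.
Qed.

Lemma In_pair x y z : In_ z (pair x y) <-> z = x \/ z = y.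
Proof.
unfold pair. rewrite In_sup. split.
- intros [[|] <-]; auto.
- intros [-> | ->]; [exists true|exists false]; reflexivity.
Qed.

Lemma In_image F x z : In_ z (image F x) <-> exists y, In_ y x /\ F y = z.
Proof.
unfold image. rewrite In_sup. split.
- intros [i <-]. exists (fam x i). split; [exists i|]; reflexivity.
- intros [y [[i <-] <-]]. exists i. reflexivity.
Qed.

Lemma In_union x z : In_ z (union x) <-> exists y, In_ y x /\ In_ z y.
Proof.
unfold union. rewrite In_sup. split.
- intros [[i j] <-]. exists (fam x i). split; [exists i|exists j]; reflexivity.
- intros [y [[i <-] [j <-]]]. exists (existT _ i j). reflexivity.
Qed.

Lemma In_power x z : In_ z (power x) <-> forall y, In_ y z -> In_ y x.
Proof.
unfold power. rewrite In_sup. split.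
- intros [P <-] y Hy. rewrite In_sup in Hy. destruct Hy as [[i Hi] <-]. exists i. reflexivity.
- intro H. exists (fun i => In_ (fam x i) z). apply V_ext. intro y. rewrite In_sup. split.
  + intros [[i Hi] <-]. exact Hi.
  + intro Hy. destruct (H y Hy) as [i <-]. exists (exist _ i Hy). reflexivity.
Qed.

Definition universe : structure :=
  Structure V (V -> Prop) (fun _ => False) In_ (fun x X => X x) (inhabits empty) (inhabits (fun _ => False)).

Lemma class_ext (X Y : V -> Prop) : (forall x, X x <-> Y x) -> X = Y.
Proof.
intro H. apply functional_extensionality. intro x. apply propositional_extensionality, H.
Qed.

Lemma universe_ext (x y : obj universe) : (forall z, mem z x <-> mem z y) -> x = y.
Proof. exact (V_ext x y). Qed.

Lemma universe_pairing (x y : obj universe) : exists z, is_upair z x y.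
Proof. exists (pair x y). intro z. apply In_pair. Qed.

Lemma universe_separation (P : obj universe -> Prop) (x : obj universe) :
  exists y, ~ ur y /\ forall z : obj universe, mem z y <-> P z /\ mem z x.
Proof. exists (sep P x). split; [intros []|]. intro z. apply In_sep. Qed.

Lemma universe_foundation (x : obj universe) :
  (exists y, mem y x) -> exists y, mem y x /\ forall z, mem z x -> ~ mem z y.
Proof.
intros [y Hy]. apply NNPP. intro H. revert y Hy.
apply (V_ind (fun y => ~ In_ y x)). intros y IH Hy. apply H. exists y. split; [exact Hy|].
intros z Hz Hzy. exact (IH z Hzy Hz).
Qed.

Lemma universe_infinity : exists x : obj universe,
  (exists y, mem y x /\ ~ ur y /\ forall z, ~ mem z y) /\
  forall y, mem y x -> exists z, mem z x /\ is_succ z y.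
Proof.
set (N := fix N (n : nat) : V := match n with 0 => empty | S n => union (pair (N n) (pair (N n) (N n))) end).
exists (sup N). split.
- exists empty. split; [apply In_sup; exists 0; reflexivity|]. split; [intros []|exact In_empty].
- intros y Hy. rewrite In_sup in Hy. destruct Hy as [n <-].
  exists (N (S n)). split; [apply In_sup; exists (S n); reflexivity|].
  intro z. change (In_ z (union (pair (N n) (pair (N n) (N n)))) <-> In_ z (N n) \/ z = N n).
  rewrite In_union. split.
  + intros [u [Hu Hz]]. apply In_pair in Hu as [->| ->]; [left; exact Hz|].
    apply In_pair in Hz. right; tauto.
  + intros [Hz| ->]; [exists (N n)|exists (pair (N n) (N n))]; rewrite ?In_pair; tauto.
Qed.

Lemma universe_replacement (F : V -> V -> Prop) (w : obj universe) :
  (forall x y z, F x y -> F x z -> y = z) ->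
  exists v, ~ ur v /\ forall y : obj universe, mem y v <-> exists x, mem x w /\ F x y.
Proof.
intro HF.
set (G := fun x => epsilon (inhabits empty) (F x)).
exists (image G (sep (fun x => exists y, F x y) w)). split; [intros []|].
intro y. change (In_ y (image G (sep (fun x => exists y, F x y) w)) <-> exists x, In_ x w /\ F x y).
assert (HG : forall x y, F x y -> G x = y).
{ intros x z Hz. apply (HF x); [|exact Hz]. apply epsilon_spec. exists z. exact Hz. }
rewrite In_image. split.
- intros [x [Hx <-]]. apply In_sep in Hx as [[z Hz] Hx].
  exists x. rewrite (HG x z Hz). auto.
- intros [x [Hx Hy]]. exists x. split; [|apply HG, Hy].
  apply In_sep. split; [exists y; exact Hy|exact Hx].
Qed.

Lemma universe_choice (x : obj universe) : exists r, ~ ur r /\ well_orders r x.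
Proof.
destruct (least_element_order V) as [R HR].
set (P := fun p : obj universe => exists a b, is_opair p a b /\ R a b /\ a <> b).
(* A Kuratowski pair of elements of [x] is a set of subsets of [x], so the double power set bounds
   the part of the class order that concerns [x]. *)
destruct (universe_separation P (power (power x))) as [r [_ Hr]].
exists r. split; [intros []|].
assert (Er : forall a b, mem a x -> mem b x -> rel r a b <-> R a b /\ a <> b).
{ intros a b Ha Hb. split.
  - intros [p [Hp Hpr]]. apply Hr in Hpr as [[a' [b' [Hp' HR']]] _].
    destruct (opair_inj universe universe_pairing p a b a' b' Hp Hp') as [-> ->].
    exact HR'.
  - intros Hab. destruct (opair_exists universe universe_ext universe_pairing a b) as [p Hp].
    exists p. split; [exact Hp|]. apply Hr. split; [exists a, b; auto|].
    apply In_power. intros z Hz. apply In_power. intros u Hu.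
    change (@mem universe z p) in Hz. apply Hp in Hz. destruct Hz as [Hz|Hz]; apply Hz in Hu;
    destruct Hu as [-> | ->]; assumption. }
(* The order laws of [R] are read off from the least elements of classes of two or three points. *)
assert (Rtotal : forall a b, R a b \/ R b a).
{ intros a b. destruct (HR (fun z => z = a \/ z = b)) as [z [[->| ->] [Hz _]]]; eauto. }
assert (Ranti : forall a b, R a b -> R b a -> a = b).
{ intros a b Hab Hba. 
  assert (Haa : forall c, R c c) by (intro c; destruct (Rtotal c c); assumption).
  destruct (HR (fun z => z = a \/ z = b)) as [z [_ [_ Hz]]]; eauto.
  rewrite (Hz a), (Hz b); auto; intros y [->| ->]; auto. }
assert (Rtrans : forall a b c, R a b -> R b c -> R a c).
{ intros a b c Hab Hbc.
  destruct (HR (fun z => z = a \/ z = b \/ z = c)) as [z [[->|[->| ->]] [Hz _]]]; eauto.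
  - pose proof (Hz a (or_introl eq_refl)). rewrite (Ranti a b); auto.
  - assert (c = b) by (apply Ranti; auto). subst c. exact Hab. }
repeat split.
- intros a Ha H. apply Er in H; tauto.
- intros a b c Ha Hb Hc Hab Hbc. apply Er in Hab, Hbc; auto. apply Er; auto.
  destruct Hab as [Hab Nab], Hbc as [Hbc Nbc]. split; [eauto|].
  intros ->. apply Nab, Ranti; auto.
- intros a b Ha Hb. destruct (classic (a = b)) as [E|E]; [auto|].
  destruct (Rtotal a b) as [H|H]; [left|right; right]; apply Er; auto.
- intros s Hs Hne. destruct (HR (fun a => In_ a s) Hne) as [a [Ha [Hmin _]]].
  exists a. split; [exact Ha|]. intros b Hb. destruct (classic (a = b)) as [E|E]; [auto|].
  right. apply Er; auto.
Qed.

Lemma universe_models : models universe (extend KM ax_choice).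
Proof.
intros a [[H| ->]| ->]; [destruct H as [a H| | |a]; [destruct H|..]|..]; intros s t.
- intros x y H. destruct H.
- intros x y _ _ H. apply universe_ext, H.
- exact universe_foundation.
- exact universe_pairing.
- intros x _. exists (union x). split; [intros []|]. intro z. apply In_union.
- intros x _. exists (power x). split; [intros []|]. intro z.
  change (In_ z (power x) <-> (False -> False) /\ forall y, In_ y z -> In_ y x).
  rewrite In_power. tauto.
- exact universe_infinity.
- intros X x _. exact (universe_separation X x).
- intros X Y H. exact (class_ext X Y H).
- intros F [_ HF] w _. exact (universe_replacement (fun x y => @relC universe F x y) w HF).
- apply (proj2 (sat_comprehension universe s t a)).
  exists (fun x => sat universe (scons x s) t a). intro x. reflexivity.
- intros x [].
- intros x _. exact (universe_choice x).
Qed.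

End Trees.

(** * Set theory in a model of KM with choice *)

Class ground (M : structure) : Prop := ground_models : models M (extend KM ax_choice).

Section Universe.
Context {M : structure} {HM : ground M}.
Notation V := (obj M).
Notation "x ∈ y" := (@mem M x y) (at level 70).

Lemma M_KMU a : KMU_R a -> holds M a.
Proof. intro H. apply ground_models. left. left. exact H. Qed.

Lemma M_ZU a : ZU a -> holds M a.
Proof. intro H. apply M_KMU. constructor. exact H. Qed.

(** The axioms are closed, but [sat] needs environments. Once some environment is supplied, an axiom
    unfolds by conversion to its reading in the model. *)
Lemma ground_eval (a : form) : holds M a -> exists s t, sat M s t a.
Proof.
intro H. destruct (obj_inhabited M) as [x], (cls_inhabited M) as [X].
exists (fun _ => x), (fun _ => X). apply H.
Qed.

Ltac axiom_of H := destruct (ground_eval _ H) as [s [t E]].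

Lemma no_ur (x : V) : ~ ur x.
Proof.
assert (H : holds M ax_no_urelements) by (apply ground_models; left; right; reflexivity).
axiom_of H. apply (E x).
Qed.

Lemma ext (x y : V) : (forall z, z ∈ x <-> z ∈ y) -> x = y.
Proof.
axiom_of (M_ZU _ ZU_extensionality). intro H. exact (E x y (no_ur x) (no_ur y) H).
Qed.

Lemma foundation (x : V) : (exists y, y ∈ x) -> exists y, y ∈ x /\ forall z, z ∈ x -> ~ z ∈ y.
Proof. axiom_of (M_ZU _ ZU_foundation). exact (E x). Qed.

Lemma pairing (x y : V) : exists z, is_upair z x y.
Proof. axiom_of (M_ZU _ ZU_pairing). exact (E x y). Qed.

Lemma union_ax (x : V) : exists u, forall z, z ∈ u <-> exists y, y ∈ x /\ z ∈ y.
Proof.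
axiom_of (M_ZU _ ZU_union). destruct (E x (no_ur x)) as [u [_ H]]. exists u. exact H.
Qed.

Lemma power_ax (x : V) : exists u, forall z, z ∈ u <-> forall y, y ∈ z -> y ∈ x.
Proof.
axiom_of (M_ZU _ ZU_powerset). destruct (E x (no_ur x)) as [u [_ H]]. exists u.
intro z. split; intro K; [apply (H z), K|apply (H z)]. split; [exact (no_ur z)|exact K].
Qed.

Lemma infinity_ax : exists x : V, (exists y, y ∈ x /\ forall z, ~ z ∈ y) /\
  forall y, y ∈ x -> exists z, z ∈ x /\ is_succ z y.
Proof.
axiom_of (M_ZU _ ZU_infinity). destruct E as [x [[y [H1 [_ H2]]] H3]].
exists x. split; [exists y; split; [exact H1|exact H2]|exact H3].
Qed.

Lemma class_ext (X Y : cls M) : (forall x, memC x X <-> memC x Y) -> X = Y.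
Proof. axiom_of (M_KMU _ KMU_R_class_ext). exact (E X Y). Qed.

Lemma classes (P : V -> Prop) :
  definable (fun s _ => P (s 0)) -> exists X : cls M, forall x, memC x X <-> P x.
Proof. intro H. apply class_of; [|exact H]. intro a. apply M_KMU, KMU_R_comprehension. Qed.

Lemma separation (P : V -> Prop) (x : V) :
  definable (fun s _ => P (s 0)) -> exists y, forall z, z ∈ y <-> P z /\ z ∈ x.
Proof.
intro H. destruct (classes P H) as [X HX].
axiom_of (M_ZU _ ZU_separation). destruct (E X x (no_ur x)) as [y [_ Hy]].
exists y. intro z. rewrite <- HX. exact (Hy z).
Qed.

Lemma empty_ax : exists x : V, forall z, ~ z ∈ x.
Proof. destruct infinity_ax as [x [[y [_ H]] _]]. exists y. exact H. Qed.

Definition empty : V := choose empty_ax.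
Definition upair (x y : V) : V := choose (pairing x y).
Definition bigcup (x : V) : V := choose (union_ax x).
Definition power (x : V) : V := choose (power_ax x).
Definition opair (x y : V) : V := upair (upair x x) (upair x y).

Lemma mem_empty z : ~ z ∈ empty.
Proof. apply (choose_spec empty_ax). Qed.
Lemma mem_upair x y z : z ∈ upair x y <-> z = x \/ z = y.
Proof. apply (choose_spec (pairing x y)). Qed.
Lemma mem_bigcup x z : z ∈ bigcup x <-> exists y, y ∈ x /\ z ∈ y.
Proof. apply (choose_spec (union_ax x)). Qed.
Lemma mem_power x z : z ∈ power x <-> forall y, y ∈ z -> y ∈ x.
Proof. apply (choose_spec (power_ax x)). Qed.

Lemma eq_empty x : (forall z, ~ z ∈ x) -> x = empty.
Proof.
intro H. apply ext. intro z. split; intro K; [destruct (H z K)|destruct (mem_empty z K)].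
Qed.

Lemma nonempty x : x <> empty -> exists z, z ∈ x.
Proof.
intro H. apply NNPP. intro K. apply H, eq_empty. intros z Hz. apply K. exists z. exact Hz.
Qed.

Lemma is_upairE z x y : is_upair z x y <-> z = upair x y.
Proof.
split.
- intro H. apply ext. intro w. rewrite (H w), mem_upair. tauto.
- intros -> w. apply mem_upair.
Qed.

Lemma mem_opair x y z : z ∈ opair x y <-> z = upair x x \/ z = upair x y.
Proof. apply mem_upair. Qed.

Lemma is_opairE p x y : is_opair p x y <-> p = opair x y.
Proof.
split.
- intro H. apply ext. intro z. rewrite (H z), mem_opair, !is_upairE. tauto.
- intros -> z. rewrite mem_opair, !is_upairE. tauto.
Qed.

Lemma opair_injective x y x' y' : opair x y = opair x' y' -> x = x' /\ y = y'.
Proof.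
intro H. apply (opair_inj M pairing (opair x y)); apply is_opairE; [reflexivity|exact H].
Qed.

Lemma relE r x y : rel r x y <-> opair x y ∈ r.
Proof.
split.
- intros [p [Hp H]]. apply is_opairE in Hp. subst p. exact H.
- intro H. exists (opair x y). split; [apply is_opairE; reflexivity|exact H].
Qed.

Lemma relCE (R : cls M) x y : relC R x y <-> memC (opair x y) R.
Proof.
split.
- intros [p [Hp H]]. apply is_opairE in Hp. subst p. exact H.
- intro H. exists (opair x y). split; [apply is_opairE; reflexivity|exact H].
Qed.

Lemma definable_opair (u v w : (nat -> V) -> V) :
  term u -> term v -> term w -> definable (fun s _ => u s = opair (v s) (w s)).
Proof.
intros [c Hc] [d Hd] [e He]. destruct (cls_inhabited M) as [X].
exists (fOPair 0 1 2), (fun n => match n with 0 => c | 1 => d | _ => e end), (fun _ => inr X).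
intros s t. rewrite <- is_opairE, Hc, Hd, He. reflexivity.
Qed.

Lemma definable_upair (u v w : (nat -> V) -> V) :
  term u -> term v -> term w -> definable (fun s _ => u s = upair (v s) (w s)).
Proof.
intros [c Hc] [d Hd] [e He]. destruct (cls_inhabited M) as [X].
exists (fUPair 0 1 2), (fun n => match n with 0 => c | 1 => d | _ => e end), (fun _ => inr X).
intros s t. rewrite <- is_upairE, Hc, Hd, He. reflexivity.
Qed.

Lemma rclasses (P : V -> V -> Prop) :
  definable (fun s _ => P (s 1) (s 0)) ->
  exists R : cls M, is_relC R /\ forall x y, relC R x y <-> P x y.
Proof.
intro H. destruct (classes (fun p => exists x y, is_opair p x y /\ P x y)) as [R HR].
{ unfold is_opair, is_upair. def_tac.
 }
exists R. split.
- intros p Hp. apply HR in Hp. destruct Hp as [x [y [Hp _]]]. eauto.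
- intros x y. rewrite relCE, HR. split.
  + intros [x' [y' [Hp HP]]]. apply is_opairE, opair_injective in Hp. destruct Hp as [-> ->]. exact HP.
  + intro HP. exists x, y. split; [apply is_opairE; reflexivity|exact HP].
Qed.

Lemma well_order_set (x : V) : exists r, well_orders r x.
Proof.
assert (H : holds M ax_choice) by (apply ground_models; right; reflexivity).
axiom_of H. destruct (E x (no_ur x)) as [r [_ Hr]]. exists r. exact Hr.
Qed.

Lemma replacement (F : V -> V -> Prop) (w : V) :
  definable (fun s _ => F (s 1) (s 0)) ->
  (forall x y z, x ∈ w -> F x y -> F x z -> y = z) ->
  exists v, forall y, y ∈ v <-> exists x, x ∈ w /\ F x y.
Proof.
intros HF Hfun. destruct (rclasses (fun x y => x ∈ w /\ F x y)) as [R [HR ER]]; [def_tac|].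
axiom_of (M_KMU _ KMU_R_replacement).
destruct (proj1 (sat_replacement M s t) E R) with (w := w) as [v [_ Hv]].
- split; [exact HR|]. intros x y z Hy Hz. apply ER in Hy, Hz.
  apply (Hfun x); tauto.
- apply no_ur.
- exists v. intro y. rewrite Hv. split; intros [x [Hx H]]; exists x; [apply ER in H; tauto|].
  split; [exact Hx|]. apply ER. auto.
Qed.

Lemma definable_rel u v w :
  term u -> term v -> term w -> @definable M (fun s _ => rel (u s) (v s) (w s)).
Proof.
intros [c Hc] [d Hd] [e He]. destruct (cls_inhabited M) as [X].
exists (fRel 0 1 2), (fun n => match n with 0 => c | 1 => d | _ => e end), (fun _ => inr X).
intros s t. rewrite Hc, Hd, He. reflexivity.
Qed.

Lemma definable_relC U v w :
  term U -> term v -> term w -> @definable M (fun s t => relC (U t) (v s) (w s)).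
Proof.
intros [c Hc] [d Hd] [e He].
exists (fRelC 0 0 1), (fun n => match n with 0 => d | _ => e end), (fun _ => c).
intros s t. rewrite Hc, Hd, He. reflexivity.
Qed.
End Universe.

(** A hook for [def_tac], refilled once [embed] is available. *)
Ltac def_hint := fail.
Ltac def_tac ::= cbv beta; repeat first
  [ apply definable_const
  | match goal with
    | H : definable (fun s _ => ?P (s 0)) |- _ => apply (definable_app _ P _ H); term_tac
    | H : definable (fun s _ => ?P (s 1) (s 0)) |- _ =>
        apply (definable_app2 _ P _ _ H); term_tac
    | H : definable (fun s _ => ?P (s 2) (s 1) (s 0)) |- _ =>
        apply (definable_app3 _ P _ _ _ H); term_tac
    end
  | apply definable_upair; term_tac
  | apply definable_opair; term_tac
  | apply definable_rel; term_tac
  | apply definable_relC; term_tac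
  | def_step
  | def_hint; cbv beta ].

(** * Least fixed points of definable operators, and induction on membership *)

Section Induction.
Context {M : structure} {HM : ground M}.
Notation V := (obj M).
Notation "x ∈ y" := (@mem M x y) (at level 70).

(** Full Comprehension accepts the class quantifier, so for definable [Phi] this least fixed point
    is itself a class. It takes the place of recursion along ordinals. *)
Definition lfp (Phi : (V -> Prop) -> V -> Prop) (x : V) : Prop :=
  forall X : cls M, (forall y, Phi (fun z => memC z X) y -> memC y X) -> memC x X.

Definition lfp2 (Phi : (V -> V -> Prop) -> V -> V -> Prop) (x y : V) : Prop :=
  forall R : cls M, (forall u v, Phi (relC R) u v -> relC R u v) -> relC R x y.

Section Fixpoint1.
Variable Phi : (V -> Prop) -> V -> Prop.
Hypothesis mono : forall P Q : V -> Prop, (forall x, P x -> Q x) -> forall x, Phi P x -> Phi Q x.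
Hypothesis def : definable (fun s t => Phi (fun z => memC z (t 0)) (s 0)).

Lemma lfp_definable : definable (fun s _ => lfp Phi (s 0)).
Proof.
unfold lfp. def_tac.
Qed.

Lemma lfp_fold x : Phi (lfp Phi) x -> lfp Phi x.
Proof. intros H X HX. apply HX. revert H. apply mono. intros y Hy. apply Hy, HX. Qed.

Lemma lfp_ind (P : V -> Prop) :
  definable (fun s _ => P (s 0)) ->
  (forall y, Phi (fun z => lfp Phi z /\ P z) y -> P y) -> forall x, lfp Phi x -> P x.
Proof.
intros HP H x Hx.
destruct (classes (fun z => lfp Phi z /\ P z)) as [X HX].
{ def_tac. }
apply HX. apply Hx. intros y Hy. apply HX. split.
- apply lfp_fold. revert Hy. apply mono. intros z Hz. apply HX, Hz.
- apply H. revert Hy. apply mono. intros z Hz. apply HX, Hz.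
Qed.

Lemma lfp_unfold x : lfp Phi x -> Phi (lfp Phi) x.
Proof.
(* [Phi] is known to be definable only at arguments that are classes, so the fixed point is first
   turned into a class [X]. *)
destruct (classes (lfp Phi) lfp_definable) as [X HX].
apply lfp_ind.
- apply (definable_iff M (fun s _ => Phi (fun z => memC z X) (s 0))).
  + intros s t. split; apply mono; intros y Hy; apply HX, Hy.
  + apply (definable_subst M (fun s t => Phi (fun z => memC z (t 0)) (s 0))
      (fun n s => s n) (fun n t => X) def); intro; [apply term_var|apply term_const].
- intro y. apply mono. tauto.
Qed.
End Fixpoint1.

Section Fixpoint2.
Variable Phi : (V -> V -> Prop) -> V -> V -> Prop.
Hypothesis mono : forall P Q : V -> V -> Prop,
  (forall x y, P x y -> Q x y) -> forall x y, Phi P x y -> Phi Q x y.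
Hypothesis def : definable (fun s t => Phi (relC (t 0)) (s 1) (s 0)).

Lemma lfp2_definable : definable (fun s _ => lfp2 Phi (s 1) (s 0)).
Proof.
unfold lfp2. def_tac.
Qed.

Lemma lfp2_fold x y : Phi (lfp2 Phi) x y -> lfp2 Phi x y.
Proof. intros H R HR. apply HR. revert H. apply mono. intros u v Hu. apply Hu, HR. Qed.

Lemma lfp2_ind (P : V -> V -> Prop) :
  definable (fun s _ => P (s 1) (s 0)) ->
  (forall x y, Phi (fun u v => lfp2 Phi u v /\ P u v) x y -> P x y) ->
  forall x y, lfp2 Phi x y -> P x y.
Proof.
intros HP H x y Hx.
destruct (rclasses (fun u v => lfp2 Phi u v /\ P u v)) as [R [_ HR]].
{ def_tac. }
apply HR. apply Hx. intros u v Hu. apply HR. split.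
- apply lfp2_fold. revert Hu. apply mono. intros a b Hz. apply HR, Hz.
- apply H. revert Hu. apply mono. intros a b Hz. apply HR, Hz.
Qed.

Lemma lfp2_unfold x y : lfp2 Phi x y -> Phi (lfp2 Phi) x y.
Proof.
destruct (rclasses (lfp2 Phi) lfp2_definable) as [R [_ HR]].
revert x y. apply lfp2_ind.
- apply (definable_iff M (fun s _ => Phi (relC R) (s 1) (s 0))).
  + intros s t. split; apply mono; intros u v Hu; apply HR, Hu.
  + apply (definable_subst M (fun s t => Phi (relC (t 0)) (s 1) (s 0))
      (fun n s => s n) (fun n t => R) def); intro; [apply term_var|apply term_const].
- intros u v. apply mono. tauto.
Qed.
End Fixpoint2.

Lemma not_mem_self (x : V) : ~ x ∈ x.
Proof.
intro H. destruct (foundation (upair x x)) as [y [Hy K]].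
- exists x. apply mem_upair. auto.
- apply mem_upair in Hy. assert (y = x) by tauto. subst y.
  apply (K x); [apply mem_upair; auto|exact H].
Qed.

Lemma mem_asym (x y : V) : x ∈ y -> ~ y ∈ x.
Proof.
intros H H'. destruct (foundation (upair x y)) as [z [Hz K]].
- exists x. apply mem_upair. auto.
- apply mem_upair in Hz. destruct Hz as [-> | ->]; [apply (K y)|apply (K x)];
  try assumption; apply mem_upair; auto.
Qed.

Lemma succ_inj (n m k : V) : is_succ k n -> is_succ k m -> n = m.
Proof.
intros Hn Hm. assert (H1 : n ∈ k) by (apply Hn; auto). assert (H2 : m ∈ k) by (apply Hm; auto).
apply Hm in H1. apply Hn in H2. destruct H1 as [H1|H1]; [|exact H1].
destruct H2 as [H2|H2]; [|auto]. destruct (mem_asym _ _ H1 H2).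
Qed.

Definition iter_step (F : V -> V) (x : V) (S : V -> V -> Prop) (n u : V) : Prop :=
  ((forall z, ~ z ∈ n) /\ u = x) \/
  (exists m v, S m v /\ is_succ n m /\ u = F v).

(** The graph of n ↦ F^n(x) is a least fixed point; it is functional because zero is no successor
    and successors are injective. The set given by Infinity may contain more than the natural
    numbers, but Replacement asks only for functionality, not for a value at every element. *)
Lemma iterates (F : V -> V) (x : V) :
  definable (fun s _ => s 0 = F (s 1)) ->
  exists T, x ∈ T /\ forall u, u ∈ T -> F u ∈ T.
Proof.
intro HF.
assert (mono : forall P Q : V -> V -> Prop,
  (forall x y, P x y -> Q x y) -> forall a b, iter_step F x P a b -> iter_step F x Q a b).
{ intros P Q H n u [K|[m [v K]]]; [left; exact K|right]. exists m, v. firstorder. }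
assert (def : definable (fun s t => iter_step F x (relC (t 0)) (s 1) (s 0))).
{ unfold iter_step, is_succ. def_tac.
  apply (definable_app2 M (fun x y => y = F x)); [exact HF|term_tac|term_tac]. }
set (S := lfp2 (iter_step F x)).
assert (Sdef : definable (fun s _ => S (s 1) (s 0))) by (apply lfp2_definable, def).
assert (Sfun : forall n u, S n u -> forall v, S n v -> u = v).
{ apply (lfp2_ind _ mono def (fun n u => forall v, S n v -> u = v)).
  - def_tac. 
  - intros n u Hu v Hv. apply (lfp2_unfold _ mono def) in Hv.
    destruct Hu as [[Hn ->]|[m [w [[Hw IH] [Hs ->]]]]], Hv as [[Hn' ->]|[m' [w' [Hw' [Hs' ->]]]]].
    + reflexivity.
    + destruct (Hn m'). apply Hs'. auto.
    + destruct (Hn' m). apply Hs. auto.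
    + assert (m = m') by (eapply succ_inj; eauto). subst m'. f_equal. apply IH, Hw'. }
destruct infinity_ax as [I [[e [He1 He2]] HI]].
destruct (replacement S I Sdef) as [T HT]; [eauto|].
exists T. split.
- apply HT. exists e. split; [exact He1|]. apply lfp2_fold; [exact mono|]. left. auto.
- intros u Hu. apply HT in Hu. destruct Hu as [n [Hn Hu]].
  destruct (HI n Hn) as [n' [Hn' Hs]]. apply HT. exists n'. split; [exact Hn'|].
  apply lfp2_fold; [exact mono|]. right. exists n, u. auto.
Qed.

Lemma bigcup_definable : @definable M (fun s _ => s 0 = bigcup (s 1)).
Proof.
apply (definable_iff M (fun s _ => forall z, z ∈ s 0 <-> exists y, y ∈ s 1 /\ z ∈ y)); [|def_tac].
intros s t. split.
- intro H. apply ext. intro z. rewrite (H z), mem_bigcup. reflexivity.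
- intros -> z. apply mem_bigcup.
Qed.

Lemma power_definable : @definable M (fun s _ => s 0 = power (s 1)).
Proof.
apply (definable_iff M (fun s _ => forall z, z ∈ s 0 <-> forall y, y ∈ z -> y ∈ s 1)); [|def_tac].
intros s t. split.
- intro H. apply ext. intro z. rewrite (H z), mem_power. reflexivity.
- intros -> z. apply mem_power.
Qed.

Lemma transitive_superset (x : V) :
  exists C, (forall z, z ∈ x -> z ∈ C) /\ forall y z, y ∈ C -> z ∈ y -> z ∈ C.
Proof.
destruct (iterates bigcup x bigcup_definable) as [T [Hx HT]].
exists (bigcup T). split.
- intros z Hz. apply mem_bigcup. eauto.
- intros y z Hy Hz. apply mem_bigcup in Hy. destruct Hy as [u [Hu Hy]].
  apply mem_bigcup. exists (bigcup u). split; [apply HT, Hu|]. apply mem_bigcup. eauto.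
Qed.

(** Foundation speaks of sets only. The counterexamples are intersected with a transitive set
    containing [x], where a minimal one is minimal outright. *)
Lemma mem_ind (P : V -> Prop) :
  definable (fun s _ => P (s 0)) ->
  (forall x, (forall y, y ∈ x -> P y) -> P x) -> forall x, P x.
Proof.
intros HP H x. apply NNPP. intro Hx.
destruct (transitive_superset (upair x x)) as [C [HC HT]].
destruct (separation (fun z => ~ P z) C) as [B HB]; [def_tac|].
destruct (foundation B) as [m [Hm K]].
- exists x. apply HB. split; [exact Hx|]. apply HC, mem_upair. auto.
- apply HB in Hm. destruct Hm as [Hm HmC]. apply Hm, H. intros y Hy.
  apply NNPP. intro Hy'. apply (K y); [|exact Hy]. apply HB. split; [exact Hy'|]. eauto.
Qed.
End Induction.

(** * Levels of the cumulative hierarchy *)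

Section Levels.
Context {M : structure} {HM : ground M}.
Notation V := (obj M).
Notation "x ∈ y" := (@mem M x y) (at level 70).
Notation "x ⊆ y" := (@is_subset M x y) (at level 70).

(** The cumulative hierarchy without ordinals: V_α is the union of the power sets of the earlier
    V_β, and [u] stands for a set of these. *)
Definition level_step (P : V -> Prop) (w : V) : Prop :=
  exists u, (forall v, v ∈ u -> P v) /\ forall z, z ∈ w <-> exists v, v ∈ u /\ z ⊆ v.

Definition level : V -> Prop := lfp level_step.

Lemma level_mono (P Q : V -> Prop) :
  (forall x, P x -> Q x) -> forall x, level_step P x -> level_step Q x.
Proof. intros H x [u [Hu K]]. exists u. split; auto. Qed.

Lemma level_step_definable :
  definable (fun s t => level_step (fun z => memC z (t 0)) (s 0)).
Proof. unfold level_step, is_subset. def_tac. Qed.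

Lemma level_definable : definable (fun s _ => level (s 0)).
Proof. apply lfp_definable, level_step_definable. Qed.

Lemma level_intro u w :
  (forall v, v ∈ u -> level v) -> (forall z, z ∈ w <-> exists v, v ∈ u /\ z ⊆ v) -> level w.
Proof. intros H K. apply lfp_fold; [exact level_mono|]. exists u. split; assumption. Qed.

Lemma level_ind (P : V -> Prop) :
  definable (fun s _ => P (s 0)) ->
  (forall u w, (forall v, v ∈ u -> level v /\ P v) ->
     (forall z, z ∈ w <-> exists v, v ∈ u /\ z ⊆ v) -> P w) ->
  forall w, level w -> P w.
Proof.
intros HP H. apply (lfp_ind _ level_mono level_step_definable P HP).
intros w [u [Hu Hw]]. apply (H u w Hu Hw).
Qed.

Ltac level_induction :=
  match goal with |- forall w, level w -> @?P w => apply (level_ind P); cbv beta end.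

Lemma level_transitive w : level w -> forall y z, z ∈ w -> y ∈ z -> y ∈ w.
Proof.
intro Hw. cut (forall z, z ∈ w -> forall y, y ∈ z -> y ∈ w); [eauto|].
revert w Hw. level_induction; [def_tac|].
intros u w Hu Hw z Hz y Hy. apply Hw in Hz. destruct Hz as [v [Hv Hz]].
apply Hw. exists v. split; [exact Hv|]. intros x Hx. apply (proj2 (Hu v Hv) y); auto.
Qed.

(** The left alternative places [v] strictly below [w]. If [w] is not included in [v], some [w'] in
    [uw] has a subset outside [v]; the induction hypothesis then puts each member of [uv] strictly
    below [w'], so [v] is included in [w'] and all its subsets are in [w]. *)
Lemma level_compare v : level v -> forall w, level w -> (forall z, z ⊆ v -> z ∈ w) \/ w ⊆ v.
Proof.
pose proof level_definable as D.
revert v. level_induction; [def_tac|]. intros uv v Huv Hv.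
level_induction; [def_tac|]. intros uw w Huw Hw.
destruct (classic (w ⊆ v)) as [H|H]; [auto|left].
assert (K : exists w', w' ∈ uw /\ ~ forall z, z ⊆ w' -> z ∈ v).
{ apply NNPP. intro K. apply H. intros z Hz. apply Hw in Hz. destruct Hz as [w' [Hw' Hz]].
  apply NNPP. intro Hz'. apply K. exists w'. split; [exact Hw'|]. intro K'. apply Hz', K', Hz. }
destruct K as [w' [Hw' K]].
assert (E : forall v', v' ∈ uv -> forall z, z ⊆ v' -> z ∈ w').
{ intros v' Hv'. destruct (Huv v' Hv') as [_ IH]. destruct (IH w' (proj1 (Huw w' Hw'))) as [L|L]; [exact L|].
  destruct K. intros z Hz. apply Hv. exists v'. split; [exact Hv'|]. intros x Hx. apply L, Hz, Hx. }
assert (Evw : v ⊆ w').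
{ intros z Hz. apply Hv in Hz. destruct Hz as [v' [Hv' Hz]]. apply (E v' Hv' z Hz). }
intros z Hz. apply Hw. exists w'. split; [exact Hw'|]. intros x Hx. apply Evw, Hz, Hx.
Qed.

Lemma least_level (Q : V -> Prop) :
  definable (fun s _ => Q (s 0)) -> (exists w y, level w /\ y ∈ w /\ Q y) ->
  exists m, level m /\ (exists y, y ∈ m /\ Q y) /\
    forall v y, level v -> y ∈ v -> Q y -> m ⊆ v.
Proof.
pose proof level_definable as D.
intros HQ [w [y [Hw [Hy HQy]]]].
destruct (classic (exists v y, v ∈ w /\ level v /\ y ∈ v /\ Q y)) as [H|H].
- destruct (separation (fun v => level v /\ exists y, y ∈ v /\ Q y) w) as [B HB]; [def_tac|].
  destruct (foundation B) as [m [Hm K]].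
  + destruct H as [v [z [H1 [H2 [H3 H4]]]]]. exists v. apply HB. eauto.
  + apply HB in Hm. destruct Hm as [[Hm He] Hmw]. exists m. split; [exact Hm|]. split; [exact He|].
    intros v z Hv Hz HQz. destruct (level_compare v Hv m Hm) as [L|L]; [|exact L].
    assert (Hvm : v ∈ m) by (apply L; intros x Hx; exact Hx).
    destruct (K v); [|exact Hvm]. apply HB. split; [eauto|]. eapply level_transitive; eauto.
- exists w. split; [exact Hw|]. split; [eauto|]. intros v z Hv Hz HQz.
  destruct (level_compare v Hv w Hw) as [L|L]; [|exact L].
  destruct H. exists v, z. split; [apply L; intros x Hx; exact Hx|auto].
Qed.

Lemma level_power w p : level w -> (forall z, z ∈ p <-> z ⊆ w) -> level p.
Proof.
intros Hw Hp. apply (level_intro (upair w w)).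
- intros v Hv. apply mem_upair in Hv. destruct Hv as [-> | ->]; exact Hw.
- intro z. rewrite Hp. split.
  + intro Hz. exists w. split; [apply mem_upair; auto|exact Hz].
  + intros [v [Hv Hz]]. apply mem_upair in Hv. destruct Hv as [-> | ->]; exact Hz.
Qed.

(** Inductively every element of [x] lies in a level. The least such level is a function of the
    element, so Replacement collects these levels into [u] without any choice; [x] is then a subset
    of the level built from [u]. *)
Lemma mem_level x : exists w, level w /\ x ∈ w.
Proof.
pose proof level_definable as D.
revert x. apply mem_ind; [def_tac|]. intros x IH.
destruct (replacement (fun z m => level m /\ z ∈ m /\ forall v, level v -> z ∈ v -> m ⊆ v) x)
  as [u Hu]; [unfold is_subset; def_tac|..].
{ intros z m m' _ [H1 [H2 H3]] [H1' [H2' H3']]. apply ext. intro y. split; [apply H3|apply H3']; auto. }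
destruct (union_ax u) as [W HW].
assert (Hul : forall v, v ∈ u -> level v) by (intros v Hv; apply Hu in Hv; firstorder).
destruct (separation (fun z => exists v, v ∈ u /\ z ⊆ v) (power W)) as [w Hw];
  [unfold is_subset; def_tac|].
assert (Hwl : level w).
{ apply (level_intro u); [exact Hul|]. intro z. rewrite Hw. split; [tauto|].
  intros [v [Hv Hz]]. split; [eauto|]. apply mem_power. intros y Hy. apply HW. exists v. auto. }
exists (power w). split; [apply (level_power w); [exact Hwl|apply mem_power]|].
apply mem_power. intros z Hz.
destruct (IH z Hz) as [w0 [Hw0 Hzw0]].
destruct (least_level (fun y => y = z)) as [m [Hm [[y [Hy ->]] Hmin]]]; [def_tac|eauto 6|].
assert (Hmu : m ∈ u) by (apply Hu; exists z; eauto 10).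
apply Hw. split.
- exists m. split; [exact Hmu|]. intros y Hyz. eapply level_transitive; eauto.
- apply mem_power. intros y Hyz. apply HW. exists m. split; [exact Hmu|]. eapply level_transitive; eauto.
Qed.

(* Scott's trick: the elements of least rank of a class form a set. *)
Definition minrank (Q : V -> Prop) (y : V) : Prop :=
  Q y /\ exists m, level m /\ y ∈ m /\ forall v z, level v -> z ∈ v -> Q z -> m ⊆ v.

Lemma minrank_exists (Q : V -> Prop) :
  definable (fun s _ => Q (s 0)) -> (exists y, Q y) -> exists y, minrank Q y.
Proof.
intros HQ [y Hy]. destruct (mem_level y) as [w [Hw Hyw]].
destruct (least_level Q HQ) as [m [Hm [[z [Hz HQz]] Hmin]]]; [eauto 6|].
exists z. split; [exact HQz|]. exists m. auto.
Qed.

Lemma minrank_set (Q : V -> Prop) :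
  definable (fun s _ => Q (s 0)) -> exists Y, forall y, y ∈ Y <-> minrank Q y.
Proof.
intro HQ. destruct (classic (exists y, Q y)) as [[y Hy]|H].
- destruct (minrank_exists Q HQ) as [z [Hz [m [Hm [Hzm Hmin]]]]]; [eauto|].
  destruct (separation (minrank Q) m) as [Y HY].
  { pose proof level_definable as D. unfold minrank, is_subset. def_tac. }
  exists Y. intro x. rewrite HY. split; [tauto|]. intro Hx. split; [exact Hx|].
  destruct Hx as [_ [m' [Hm' [Hx Hmin']]]]. apply (Hmin' m z Hm Hzm Hz), Hx.
- exists empty. intro x. split; intro K; [destruct (mem_empty _ K)|]. destruct H. exists x. apply K.
Qed.

Definition least (r : V) (Q : V -> Prop) (y : V) : Prop :=
  Q y /\ forall z, Q z -> y = z \/ rel r y z.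

Lemma least_exists (r U : V) (Q : V -> Prop) :
  definable (fun s _ => Q (s 0)) -> well_orders r U -> (forall y, Q y -> y ∈ U) ->
  (exists y, Q y) -> exists y, least r Q y.
Proof.
intros HQ [_ [_ [_ W]]] HU [y Hy]. destruct (separation Q U HQ) as [s Hs].
destruct (W s) as [a [Ha Hmin]].
- intros z Hz. apply Hs in Hz. apply Hz.
- exists y. apply Hs. auto.
- exists a. apply Hs in Ha. split; [apply Ha|]. intros z Hz. apply Hmin, Hs. auto.
Qed.

Lemma least_unique (r U : V) (Q : V -> Prop) y z :
  well_orders r U -> (forall y, Q y -> y ∈ U) -> least r Q y -> least r Q z -> y = z.
Proof.
intros [W1 [W2 _]] HU [Hy Hy'] [Hz Hz'].
destruct (Hy' z Hz) as [E|E]; [exact E|]. destruct (Hz' y Hy) as [E'|E']; [auto|].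
destruct (W1 y (HU y Hy)). apply (W2 y z y); auto.
Qed.

(** The values of [Q] at a point may form a proper class, which cannot be well-ordered. Those of
    least rank form a set, and one well-order of the union of these sets picks an element from
    each. *)
Lemma set_choice (d : V) (Q : V -> V -> Prop) :
  definable (fun s _ => Q (s 1) (s 0)) -> (forall z, z ∈ d -> exists y, Q z y) ->
  exists h, (forall z, z ∈ d -> exists y, rel h z y) /\
    (forall z y, rel h z y -> z ∈ d /\ Q z y) /\
    (forall z y y', rel h z y -> rel h z y' -> y = y').
Proof.
intros HQ Hex. pose proof level_definable as D.
assert (HQz : forall z, definable (fun s _ => Q z (s 0))) by (intro z; def_tac).
destruct (replacement (fun z Y => forall y, y ∈ Y <-> minrank (Q z) y) d) as [u Hu].
{ unfold minrank, is_subset. def_tac. }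
{ intros z Y Y' _ H H'. apply ext. intro y. rewrite H, H'. reflexivity. }
destruct (union_ax u) as [U HU]. destruct (well_order_set U) as [r Hr].
assert (HminU : forall z y, z ∈ d -> minrank (Q z) y -> y ∈ U).
{ intros z y Hz Hy. destruct (minrank_set (Q z) (HQz z)) as [Y HY].
  apply HU. exists Y. split; [apply Hu; eauto|apply HY, Hy]. }
assert (Hdef : forall z, definable (fun s _ => minrank (Q z) (s 0))).
{ intro z. unfold minrank, is_subset. def_tac. }
destruct (replacement (fun z p => exists y, p = opair z y /\ least r (minrank (Q z)) y) d) as [h Hh].
{ unfold least, minrank, is_subset. def_tac. }
{ intros z p p' Hz [y [-> Hy]] [y' [-> Hy']]. f_equal.
  exact (least_unique r U (minrank (Q z)) y y' Hr (fun x => HminU z x Hz) Hy Hy'). }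
assert (Eh : forall z y, rel h z y <-> z ∈ d /\ least r (minrank (Q z)) y).
{ intros z y. rewrite relE, Hh. split.
  - intros [z' [Hz [y' [E Hy]]]]. apply opair_injective in E. destruct E as [-> ->]. auto.
  - intros [Hz Hy]. exists z. split; [exact Hz|]. exists y. auto. }
exists h. split; [|split].
- intros z Hz. destruct (least_exists r U (minrank (Q z)) (Hdef z) Hr) as [y Hy].
  + intros x Hx. apply (HminU z); auto.
  + apply minrank_exists; auto.
  + exists y. apply Eh. auto.
- intros z y H. apply Eh in H. destruct H as [Hz [[Hy _] _]]. auto.
- intros z y y' H H'. apply Eh in H, H'. destruct H as [Hz H], H' as [_ H'].
  exact (least_unique r U (minrank (Q z)) y y' Hr (fun x => HminU z x Hz) H H').
Qed.

(** A pair of elements of a level appears two power sets higher, so iterating the power set ω times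
    from a level containing [x] suffices. *)
Lemma pair_closed_superset (x : V) :
  exists K, x ⊆ K /\ forall a b, a ∈ K -> b ∈ K -> opair a b ∈ K.
Proof.
destruct (mem_level x) as [w [Hw Hx]].
destruct (iterates power w power_definable) as [T [HwT HT]].
(* [iterates] gives only a superset of the iterates. Its members that are levels are kept: they are
   comparable, so two elements lie in a common one. *)
destruct (separation level T) as [T' HT']; [exact level_definable|].
exists (bigcup T'). split.
- intros y Hy. apply mem_bigcup. exists w. split; [apply HT'; auto|]. eapply level_transitive; eauto.
- assert (key : forall v a b, v ∈ T' -> a ∈ v -> b ∈ v -> opair a b ∈ bigcup T').
  { intros v a b Hv Ha Hb. apply HT' in Hv. destruct Hv as [Hv HvT].
    assert (Hp : level (power v)) by (apply (level_power v); [exact Hv|apply mem_power]).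
    assert (Hpp : level (power (power v))) by (apply (level_power (power v)); [exact Hp|apply mem_power]).
    apply mem_bigcup. exists (power (power v)). split; [apply HT'; auto|].
    apply mem_power. intros y Hy. apply mem_power. intros z Hz.
    apply mem_opair in Hy. destruct Hy as [-> | ->]; apply mem_upair in Hz; destruct Hz as [-> | ->]; auto. }
  intros a b Ha Hb. apply mem_bigcup in Ha, Hb. destruct Ha as [v [Hv Ha]], Hb as [v' [Hv' Hb]].
  destruct (level_compare v (proj1 (proj1 (HT' v) Hv)) v' (proj1 (proj1 (HT' v') Hv'))) as [L|L].
  + apply (key v'); auto. apply level_transitive with v; [apply HT', Hv'| |exact Ha].
    apply L. intros z Hz. exact Hz.
  + apply (key v); auto.
Qed.
End Levels.

(** * Relations lifted along membership *)

Section Lift.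
Context {M : structure} {HM : ground M}.
Notation V := (obj M).
Notation "x ∈ y" := (@mem M x y) (at level 70).
Notation "x ⊆ y" := (@is_subset M x y) (at level 70).

(** Nonemptiness on both sides stops the empty set from being related to itself vacuously: only [B]
    decides where the recursion ends. *)
Definition bisim_step (B R : V -> V -> Prop) (x y : V) : Prop :=
  B x y \/
  ((exists z, z ∈ x) /\ (exists z, z ∈ y) /\
   (forall u, u ∈ x -> exists v, v ∈ y /\ R u v) /\
   (forall v, v ∈ y -> exists u, u ∈ x /\ R u v)).

Definition lift (B : V -> V -> Prop) : V -> V -> Prop := lfp2 (bisim_step B).

Lemma bisim_mono (B P Q : V -> V -> Prop) :
  (forall x y, P x y -> Q x y) -> forall x y, bisim_step B P x y -> bisim_step B Q x y.
Proof.
intros H x y [K|[Hx [Hy [K L]]]]; [left; exact K|right]. repeat split; try assumption.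
- intros u Hu. destruct (K u Hu) as [v [Hv Huv]]. eauto.
- intros v Hv. destruct (L v Hv) as [u [Hu Huv]]. eauto.
Qed.

Lemma lift_base (B : V -> V -> Prop) x y : B x y -> lift B x y.
Proof. intro H. apply lfp2_fold; [apply bisim_mono|]. left. exact H. Qed.

Lemma lift_set (B : V -> V -> Prop) x y :
  (exists z, z ∈ x) -> (exists z, z ∈ y) ->
  (forall u, u ∈ x -> exists v, v ∈ y /\ lift B u v) ->
  (forall v, v ∈ y -> exists u, u ∈ x /\ lift B u v) -> lift B x y.
Proof. intros. apply lfp2_fold; [apply bisim_mono|]. right. auto. Qed.

Section Relation.
Variable B : V -> V -> Prop.
Hypothesis HB : definable (fun s _ => B (s 1) (s 0)).

Lemma bisim_definable : definable (fun s t => bisim_step B (relC (t 0)) (s 1) (s 0)).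
Proof. unfold bisim_step. def_tac. Qed.

Lemma lift_definable : definable (fun s _ => lift B (s 1) (s 0)).
Proof. apply lfp2_definable, bisim_definable. Qed.

Lemma lift_inv x y : lift B x y -> bisim_step B (lift B) x y.
Proof. apply lfp2_unfold; [apply bisim_mono|apply bisim_definable]. Qed.

Lemma lift_ind (P : V -> V -> Prop) :
  definable (fun s _ => P (s 1) (s 0)) ->
  (forall x y, B x y -> P x y) ->
  (forall x y, (exists z, z ∈ x) -> (exists z, z ∈ y) ->
    (forall u, u ∈ x -> exists v, v ∈ y /\ lift B u v /\ P u v) ->
    (forall v, v ∈ y -> exists u, u ∈ x /\ lift B u v /\ P u v) -> P x y) ->
  forall x y, lift B x y -> P x y.
Proof.
intros HP H K. apply (lfp2_ind _ (bisim_mono B) bisim_definable P HP).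
intros x y [L|[Hx [Hy [L L']]]]; [apply H, L|apply K; auto].
Qed.

Lemma lift_flip (C : V -> V -> Prop) :
  (forall x y, B x y -> C y x) -> definable (fun s _ => C (s 1) (s 0)) ->
  forall x y, lift B x y -> lift C y x.
Proof.
intros H HC. pose proof (lfp2_definable _ bisim_definable) as D.
assert (DC : definable (fun s _ => lift C (s 1) (s 0))).
{ apply lfp2_definable. unfold bisim_step. def_tac. }
apply (lift_ind (fun x y => lift C y x)); [def_tac|..].
- intros x y Hxy. apply lift_base, H, Hxy.
- intros x y Hx Hy K L. apply lift_set; try assumption.
  + intros v Hv. destruct (L v Hv) as [u [Hu [_ Huv]]]. eauto.
  + intros u Hu. destruct (K u Hu) as [v [Hv [_ Huv]]]. eauto.
Qed.

(** The second hypothesis separates the two clauses of [bisim_step]: a point in the domain of [B]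
    cannot also be matched elementwise, because none of its elements is related to anything. *)
Lemma lift_functional :
  (forall x y y', B x y -> B x y' -> y = y') ->
  (forall x y z v, B x y -> z ∈ x -> ~ lift B z v) ->
  forall x y y', lift B x y -> lift B x y' -> y = y'.
Proof.
intros HF HZ. pose proof lift_definable as D.
cut (forall x y, lift B x y -> forall y', lift B x y' -> y = y'); [eauto|].
apply (lift_ind (fun x y => forall y', lift B x y' -> y = y')); [def_tac|..].
- intros x y Hxy y' H. apply lift_inv in H. destruct H as [H|[[z Hz] [_ [H _]]]].
  + eauto.
  + destruct (H z Hz) as [v [_ Hv]]. destruct (HZ x y z v Hxy Hz Hv).
- intros x y [z Hz] _ K L y' H. apply lift_inv in H. destruct H as [H|[_ [_ [H H']]]].
  + destruct (K z Hz) as [v [_ [Hv _]]]. destruct (HZ x y' z v H Hz Hv).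
  + apply ext. intro v. split; intro Hv.
    * destruct (L v Hv) as [u [Hu [_ IH]]]. destruct (H u Hu) as [v' [Hv' Huv']].
      rewrite (IH v' Huv'). exact Hv'.
    * destruct (H' v Hv) as [u [Hu Huv]]. destruct (K u Hu) as [v' [Hv' [_ IH]]].
      rewrite <- (IH v Huv). exact Hv'.
Qed.

Lemma lift_total_step :
  (forall x y y', lift B x y -> lift B x y' -> y = y') ->
  forall x, (exists z, z ∈ x) -> (forall z, z ∈ x -> exists v, lift B z v) -> exists y, lift B x y.
Proof.
intros HF x [z Hz] H. destruct (replacement (lift B) x lift_definable) as [y Hy]; [eauto|].
exists y. apply lift_set.
- eauto.
- destruct (H z Hz) as [v Hv]. exists v. apply Hy. eauto.
- intros u Hu. destruct (H u Hu) as [v Hv]. exists v. split; [apply Hy; eauto|exact Hv].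
- intros v Hv. apply Hy. exact Hv.
Qed.
End Relation.

(** * The pure sets of the new universe *)

(* [zero] codes the empty set of the new universe.  The empty set of [M] is not a
   code, so that a set with an element [empty] cannot be confused with a set of
   codes. *)
Definition zero : V := upair empty empty.

Lemma mem_zero z : z ∈ zero <-> z = empty.
Proof. unfold zero. rewrite mem_upair. tauto. Qed.

(** Its lift replaces the empty set by [zero] hereditarily, which turns a set of the ground model
    into the code of the same pure set. *)
Definition pure_base (x y : V) : Prop := x = empty /\ y = zero.

Lemma pure_base_definable : definable (fun s _ => pure_base (s 1) (s 0)).
Proof. unfold pure_base. def_tac. Qed.

Definition pure : V -> V -> Prop := lift pure_base.

Lemma pure_definable : definable (fun s _ => pure (s 1) (s 0)).
Proof. apply lift_definable, pure_base_definable. Qed.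

Lemma pure_functional x y y' : pure x y -> pure x y' -> y = y'.
Proof.
apply lift_functional; [exact pure_base_definable|..].
- intros a b b' [_ ->] [_ ->]. reflexivity.
- intros a b z v [-> _] Hz. destruct (mem_empty z Hz).
Qed.

Lemma pure_nonempty x y : pure x y -> exists z, z ∈ y.
Proof.
intro H. apply lift_inv in H; [|exact pure_base_definable].
destruct H as [[_ ->]|[_ [H _]]]; [|exact H]. exists empty. apply mem_zero. reflexivity.
Qed.

(** The inverse relation is a lift too. It is functional because its only base point, [zero], has
    the single element [empty], which is no value of [pure]. *)
Lemma pure_injective x x' y : pure x y -> pure x' y -> x = x'.
Proof.
set (C := fun a b => pure_base b a).
assert (HC : definable (fun s _ => C (s 1) (s 0))).
{ unfold C, pure_base. def_tac. }
intros H H'.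
assert (F : forall z, pure z y -> lift C y z).
{ intro z. apply (lift_flip _ pure_base_definable C); [|exact HC]. intros a b K. exact K. }
apply (lift_functional C HC) with y; [..|exact (F x H)|exact (F x' H')].
- intros a b b' [-> _] [-> _]. reflexivity.
- intros a b z v [_ ->] Hz K. apply mem_zero in Hz. subst z.
  apply lift_inv in K; [|exact HC]. destruct K as [[_ K]|[[z Hz] _]].
  + apply (mem_empty empty). rewrite K at 2. apply mem_zero. reflexivity.
  + destruct (mem_empty z Hz).
Qed.

Lemma pure_total x : exists y, pure x y.
Proof.
pose proof pure_definable as D. revert x. apply mem_ind; [def_tac|].
intros x IH. destruct (classic (x = empty)) as [E|E].
- exists zero. apply lift_base. split; [exact E|reflexivity].
- apply lift_total_step; [exact pure_base_definable|exact pure_functional|apply nonempty, E|exact IH].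
Qed.

Definition embed (x : V) : V := choose (pure_total x).

Lemma pureE x y : pure x y <-> y = embed x.
Proof.
split.
- intro H. apply (pure_functional x); [exact H|apply (choose_spec (pure_total x))].
- intros ->. apply (choose_spec (pure_total x)).
Qed.

Lemma embed_injective x y : embed x = embed y -> x = y.
Proof. intro H. apply (pure_injective x y (embed x)); apply pureE; auto. Qed.

Lemma embed_nonempty x : embed x <> empty.
Proof.
intro H. destruct (pure_nonempty x (embed x)) as [z Hz]; [apply pureE; reflexivity|].
rewrite H in Hz. destruct (mem_empty z Hz).
Qed.

Lemma embed_empty : embed empty = zero.
Proof. symmetry. apply pureE, lift_base. split; reflexivity. Qed.

Lemma embed_definable u v :
  term u -> term v -> @definable M (fun s _ => u s = embed (v s)).
Proof.
pose proof pure_definable as D. intros Hu Hv.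
apply (definable_iff M (fun s _ => pure (v s) (u s))).
- intros s t. apply pureE.
- apply (definable_app2 M pure v u D Hv Hu).
Qed.

Lemma mem_embed y z : y <> empty -> z ∈ embed y <-> exists x, x ∈ y /\ z = embed x.
Proof.
intro Hy. assert (H : pure y (embed y)) by (apply pureE; reflexivity).
apply lift_inv in H; [|exact pure_base_definable].
destruct H as [[H _]|[_ [_ [H H']]]]; [contradiction|]. split.
- intro Hz. destruct (H' z Hz) as [x [Hx K]]. exists x. split; [exact Hx|]. apply pureE, K.
- intros [x [Hx ->]]. destruct (H x Hx) as [v [Hv K]]. apply pureE in K. subst v. exact Hv.
Qed.

Lemma mem_embed_embed x y : embed x ∈ embed y <-> x ∈ y.
Proof.
destruct (classic (y = empty)) as [->|Hy].
- rewrite embed_empty, mem_zero. split; intro H.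
  + destruct (embed_nonempty x H).
  + destruct (mem_empty x H).
- rewrite (mem_embed y _ Hy). split.
  + intros [x' [Hx' E]]. apply embed_injective in E. subst x'. exact Hx'.
  + intro H. exists x. auto.
Qed.

(** * Codes *)

Definition gen_step (D P : V -> Prop) (x : V) : Prop :=
  x = zero \/ D x \/ ((exists z, z ∈ x) /\ forall z, z ∈ x -> P z).

(* The codes of sets whose urelements are in [D]. *)
Definition gen (D : V -> Prop) : V -> Prop := lfp (gen_step D).

Lemma gen_mono_step (D P Q : V -> Prop) :
  (forall x, P x -> Q x) -> forall x, gen_step D P x -> gen_step D Q x.
Proof. unfold gen_step. firstorder. Qed.

Lemma gen_zero D : gen D zero.
Proof. apply lfp_fold; [apply gen_mono_step|]. left. reflexivity. Qed.

Lemma gen_base (D : V -> Prop) x : D x -> gen D x.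
Proof. intro H. apply lfp_fold; [apply gen_mono_step|]. right. left. exact H. Qed.

Lemma gen_set (D : V -> Prop) x : (exists z, z ∈ x) -> (forall z, z ∈ x -> gen D z) -> gen D x.
Proof. intros H K. apply lfp_fold; [apply gen_mono_step|]. right. right. auto. Qed.

Section Generators.
Variable D : V -> Prop.
Hypothesis HD : definable (fun s _ => D (s 0)).

Lemma gen_step_definable : definable (fun s t => gen_step D (fun z => memC z (t 0)) (s 0)).
Proof. unfold gen_step. def_tac. Qed.

Lemma gen_definable : definable (fun s _ => gen D (s 0)).
Proof. apply lfp_definable, gen_step_definable. Qed.

Lemma gen_inv x :
  gen D x -> x = zero \/ D x \/ ((exists z, z ∈ x) /\ forall z, z ∈ x -> gen D z).
Proof. exact (lfp_unfold _ (gen_mono_step D) gen_step_definable x). Qed.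

Lemma gen_ind (P : V -> Prop) :
  definable (fun s _ => P (s 0)) -> P zero -> (forall x, D x -> P x) ->
  (forall x, (exists z, z ∈ x) -> (forall z, z ∈ x -> gen D z /\ P z) -> P x) ->
  forall x, gen D x -> P x.
Proof.
intros HP H0 H1 H2. apply (lfp_ind _ (gen_mono_step D) gen_step_definable P HP).
intros x [->|[H|[H H']]]; auto.
Qed.

Lemma gen_mono (E : V -> Prop) :
  definable (fun s _ => E (s 0)) -> (forall x, D x -> E x) -> forall x, gen D x -> gen E x.
Proof.
intros HE H.
assert (K : definable (fun s _ => gen E (s 0))).
{ apply lfp_definable. unfold gen_step. def_tac. }
apply gen_ind; [exact K|apply gen_zero|intros x Hx; apply gen_base, H, Hx|].
intros x Hx Hz. apply gen_set; [exact Hx|]. intros z Hzx. apply Hz, Hzx.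
Qed.

Lemma gen_embed x : gen D (embed x).
Proof.
pose proof gen_definable as K. revert x. apply mem_ind.
- apply (definable_iff M (fun s _ => forall y, y = embed (s 0) -> gen D y)).
  + intros s t. split; [auto|]. intros H y ->. exact H.
  + def_tac. apply embed_definable; term_tac.
- intros x IH. destruct (classic (x = empty)) as [->|Hx].
  + rewrite embed_empty. apply gen_zero.
  + apply gen_set.
    * apply nonempty, embed_nonempty.
    * intros z Hz. apply (mem_embed x z Hx) in Hz. destruct Hz as [y [Hy ->]]. auto.
Qed.
End Generators.
End Lift.

Ltac def_hint ::= apply embed_definable; term_tac.

(** * Urelements *)

(* Pairing makes unions of [bulk]-many small sets small. *)
Class setting (M : structure) {HM : ground M} := {
  bulk : obj M;
  bulk_pair : forall a b, mem a bulk -> mem b bulk -> mem (opair a b) bulk;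
  bulk_two : exists a b, mem a bulk /\ mem b bulk /\ a <> b
}.

Section Atoms.
Context {M : structure} {HM : ground M} {HS : setting M}.
Notation V := (obj M).
Notation "x ∈ y" := (@mem M x y) (at level 70).
Notation "x ⊆ y" := (@is_subset M x y) (at level 70).

(** Passing through [embed] makes each index a pure object of the extension, fixed by every
    transposition. *)
Definition index : V := embed (power bulk).

(* The urelements of block [i] are the sets [{{empty, (i, b)}}].  Their elements
   contain [empty] and are not urelements, hence are not codes. *)
Definition block (i a : V) : Prop :=
  i ∈ index /\ exists b p q, p = opair i b /\ q = upair empty p /\ a = upair q q.

Definition atom (a : V) : Prop := exists i, block i a.

Lemma block_definable : definable (fun s _ => block (s 1) (s 0)).
Proof. unfold block. def_tac. Qed.

Lemma atom_definable : definable (fun s _ => atom (s 0)).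
Proof. pose proof block_definable. unfold atom. def_tac. Qed.

Lemma upair_same x y : upair x x = upair y y -> x = y.
Proof.
intro H. assert (K : x ∈ upair y y) by (rewrite <- H; apply mem_upair; auto).
apply mem_upair in K. tauto.
Qed.

Lemma upair_left x y z : upair x y = upair x z -> y = z.
Proof.
intro H. assert (K : y ∈ upair x z) by (rewrite <- H; apply mem_upair; auto).
assert (L : z ∈ upair x y) by (rewrite H; apply mem_upair; auto).
apply mem_upair in K, L. destruct K as [->|K]; [|exact K]. destruct L as [->|L]; congruence.
Qed.

Lemma block_unique i i' a : block i a -> block i' a -> i = i'.
Proof.
intros [_ [b [p [q [-> [-> ->]]]]]] [_ [b' [p' [q' [-> [-> E]]]]]].
apply upair_same, upair_left, opair_injective in E. apply E.
Qed.

Definition code : V -> Prop := gen atom.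

Lemma code_definable : definable (fun s _ => code (s 0)).
Proof. apply gen_definable, atom_definable. Qed.

Lemma atom_nonempty a : atom a -> exists z, z ∈ a.
Proof.
intros [i [_ [b [p [q [-> [-> ->]]]]]]]. eexists. apply mem_upair. left. reflexivity.
Qed.

Lemma code_nonempty x : code x -> exists z, z ∈ x.
Proof.
intro H. apply gen_inv in H; [|exact atom_definable]. destruct H as [->|[H|[H _]]].
- exists empty. apply mem_zero. reflexivity.
- apply atom_nonempty, H.
- exact H.
Qed.

Lemma not_code_empty : ~ code empty.
Proof. intro H. destruct (code_nonempty _ H) as [z Hz]. destruct (mem_empty z Hz). Qed.

Lemma not_code_zero z : z ∈ zero -> ~ code z.
Proof. intro H. apply mem_zero in H. subst z. apply not_code_empty. Qed.

Lemma not_code_atom a z : atom a -> z ∈ a -> ~ code z.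
Proof.
intros [i [_ [b [p [q [Ep [-> ->]]]]]]] Hz H.
assert (E : z = upair empty p) by (apply mem_upair in Hz; tauto). subst z. clear Hz.
assert (Hp : p ∈ upair empty p) by (apply mem_upair; auto).
assert (He : empty ∈ upair empty p) by (apply mem_upair; auto).
assert (Np : p <> empty).
{ intros ->. apply (mem_empty (upair i i)). rewrite Ep. apply mem_opair. auto. }
apply gen_inv in H; [|exact atom_definable]. destruct H as [E|[[j [_ [b' [p' [q' [_ [-> E]]]]]]]|[_ H]]].
- rewrite E in Hp. apply mem_zero in Hp. contradiction.
- rewrite E in He. apply mem_upair in He.
  assert (K : empty = upair empty p') by tauto.
  apply (mem_empty empty). rewrite K at 2. apply mem_upair. auto.
- apply not_code_empty, H, He.
Qed.

Lemma zero_not_atom : ~ atom zero.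
Proof.
intros [i [_ [b [p [q [_ [Eq E]]]]]]].
assert (K : q ∈ zero) by (rewrite E; apply mem_upair; auto). apply mem_zero in K.
apply (mem_empty empty). rewrite <- K at 2. rewrite Eq. apply mem_upair. auto.
Qed.

Section Sub.
Variable D : V -> Prop.
Hypothesis HD : definable (fun s _ => D (s 0)).
Hypothesis DA : forall a, D a -> atom a.

Lemma gen_code x : gen D x -> code x.
Proof. apply gen_mono; [exact HD|exact atom_definable|exact DA]. Qed.

Lemma gen_atom a : gen D a -> atom a -> D a.
Proof.
intros H Ha. apply gen_inv in H; [|exact HD]. destruct H as [->|[H|[[z Hz] H]]].
- destruct (zero_not_atom Ha).
- exact H.
- destruct (not_code_atom a z Ha Hz (gen_code z (H z Hz))).
Qed.

(** One element that is a code rules out that [x] is [zero] or a urelement, whose elements are never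
    codes; so [x] is a genuine set of codes. *)
Lemma gen_mem x z : gen D x -> z ∈ x -> code z -> forall y, y ∈ x -> gen D y.
Proof.
intros H Hz Cz. apply gen_inv in H; [|exact HD]. destruct H as [->|[H|[_ H]]].
- destruct (not_code_zero z Hz Cz).
- destruct (not_code_atom x z (DA _ H) Hz Cz).
- exact H.
Qed.
End Sub.

Definition avoids (a : V) : V -> Prop := gen (fun b => atom b /\ b <> a).

Lemma avoid_definable a : definable (fun s _ => atom (s 0) /\ s 0 <> a).
Proof. pose proof atom_definable. def_tac. Qed.

(* The sets of urelements generating a code are closed under intersection. *)
Lemma gen_of_avoids (E : V -> Prop) (y : V) :
  definable (fun s _ => E (s 0)) ->
  code y -> (forall a, atom a -> ~ E a -> avoids a y) -> gen E y.
Proof.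
intros HE. pose proof atom_definable as DA. pose proof (gen_definable E HE) as DG.
revert y. apply (gen_ind atom DA (fun y => (forall a, atom a -> ~ E a -> avoids a y) -> gen E y)).
- unfold avoids, gen, gen_step. def_tac.
- intros _. apply gen_zero.
- intros a Ha H. apply gen_base. apply NNPP. intro Na.
  apply (gen_atom (fun b => atom b /\ b <> a) (avoid_definable a)) in Ha as K.
  + destruct K as [_ K]. apply K. reflexivity.
  + tauto.
  + apply H; assumption.
- intros x Hx IH H. apply gen_set; [exact Hx|]. intros z Hz. apply IH; [exact Hz|].
  intros a Ha Na. specialize (H a Ha Na).
  apply (gen_mem _ (avoid_definable a) (fun b K => proj1 K) x z H Hz); [|exact Hz].
  apply IH, Hz.
Qed.

(** The urelement is labelled with a level [w] that contains [S]. If it belonged to [S],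
    transitivity of [w] would lead down to w ∈ w. *)
Lemma fresh_atom i S : i ∈ index -> exists b, block i b /\ ~ b ∈ S.
Proof.
intro Hi. destruct (mem_level S) as [w [Hw HSw]].
pose proof (level_transitive w Hw) as T.
set (p := opair i w). set (q := upair empty p).
exists (upair q q). split; [split; [exact Hi|]; exists w, p, q; auto|].
intro H. apply (not_mem_self w).
assert (H1 : upair q q ∈ w) by eauto.
assert (H2 : q ∈ w) by (apply (T q (upair q q)); [exact H1|apply mem_upair; auto]).
assert (H3 : p ∈ w) by (apply (T p q); [exact H2|apply mem_upair; auto]).
assert (H4 : upair i w ∈ w) by (apply (T _ p); [exact H3|apply mem_opair; auto]).
apply (T w (upair i w)); [exact H4|apply mem_upair; auto].
Qed.

(** * Transpositions of urelements *)

Definition swap_base (a b x y : V) : Prop :=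
  (x = zero /\ y = zero) \/ (x = a /\ y = b) \/ (x = b /\ y = a) \/
  (atom x /\ x <> a /\ x <> b /\ y = x).

Definition swap (a b : V) : V -> V -> Prop := lift (swap_base a b).

Lemma swap_base_definable a b : definable (fun s _ => swap_base a b (s 1) (s 0)).
Proof. pose proof atom_definable. unfold swap_base. def_tac. Qed.

Lemma swap_definable a b : definable (fun s _ => swap a b (s 1) (s 0)).
Proof. apply lift_definable, swap_base_definable. Qed.

Lemma swap_base_sym a b x y : swap_base a b x y -> swap_base a b y x.
Proof.
intros [H|[H|[H|[H [H1 [H2 ->]]]]]].
- left. tauto.
- right. right. left. tauto.
- right. left. tauto.
- right. right. right. auto.
Qed.

Lemma swap_sym a b x y : swap a b x y -> swap a b y x.
Proof.
apply lift_flip; [apply swap_base_definable| |apply swap_base_definable].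
exact (swap_base_sym a b).
Qed.

Section Swap.
Variables a b : V.
Hypothesis Ha : atom a.
Hypothesis Hb : atom b.

Lemma swap_base_cases x y : swap_base a b x y -> (x = zero /\ y = zero) \/ (atom x /\ atom y).
Proof. intros [H|[[-> ->]|[[-> ->]|[H [H1 [H2 ->]]]]]]; auto. Qed.

Lemma swap_code x y : swap a b x y -> code x.
Proof.
pose proof code_definable as DC. revert x y.
apply (lift_ind _ (swap_base_definable a b) (fun x y => code x)); [def_tac|..].
- intros x y H. destruct (swap_base_cases x y H) as [[-> _]|[H' _]]; [apply gen_zero|apply gen_base, H'].
- intros x y Hx _ H _. apply gen_set; [exact Hx|]. intros z Hz. destruct (H z Hz) as [v Hv]. apply Hv.
Qed.

Lemma swap_base_no_code x y z : swap_base a b x y -> z ∈ x -> ~ code z.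
Proof.
intro H. destruct (swap_base_cases x y H) as [[-> _]|[H' _]];
  [apply not_code_zero|apply not_code_atom, H'].
Qed.

Lemma swap_functional x y y' : swap a b x y -> swap a b x y' -> y = y'.
Proof.
apply lift_functional; [apply swap_base_definable|..].
- intros u v v' H H'.
  assert (Na := zero_not_atom).
  destruct H as [[-> ->]|[[-> ->]|[[-> ->]|[H [H1 [H2 ->]]]]]],
    H' as [[E ->]|[[E ->]|[[E ->]|[E [E1 [E2 ->]]]]]]; congruence.
- intros u v z v' H Hz K. apply (swap_base_no_code u v z H Hz). apply (swap_code z v'), K.
Qed.

Lemma swap_total x : code x -> exists y, swap a b x y.
Proof.
pose proof (swap_definable a b) as DS. revert x.
apply (gen_ind atom atom_definable (fun x => exists y, swap a b x y)); [def_tac|..].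
- exists zero. apply lift_base. left. auto.
- intros x Hx. destruct (classic (x = a)) as [->|N]; [|destruct (classic (x = b)) as [->|N']].
  + exists b. apply lift_base. right. left. auto.
  + exists a. apply lift_base. right. right. left. auto.
  + exists x. apply lift_base. right. right. right. auto.
- intros x Hx H. apply lift_total_step; [apply swap_base_definable|exact swap_functional|exact Hx|].
  intros z Hz. apply H, Hz.
Qed.

Lemma swap_mem_imp x y u v : swap a b x y -> swap a b u v -> u ∈ x -> v ∈ y.
Proof.
intros H H' Hu. apply lift_inv in H; [|apply swap_base_definable]. destruct H as [H|[_ [_ [H _]]]].
- destruct (swap_base_no_code x y u H Hu). apply (swap_code u v H').
- destruct (H u Hu) as [v' [Hv' K]]. rewrite (swap_functional u v v' H' K). exact Hv'.
Qed.

Lemma swap_mem x y u v : swap a b x y -> swap a b u v -> u ∈ x <-> v ∈ y.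
Proof.
intros H H'. split; [apply swap_mem_imp; assumption|].
apply swap_mem_imp; apply swap_sym; assumption.
Qed.

Lemma swap_atom_base x y : swap a b x y -> atom x -> swap_base a b x y.
Proof.
intros H Hx. apply lift_inv in H; [|apply swap_base_definable]. destruct H as [H|[[z Hz] [_ [H _]]]].
- exact H.
- destruct (H z Hz) as [v [_ K]]. destruct (not_code_atom x z Hx Hz). apply (swap_code z v K).
Qed.

Lemma swap_atom x y : swap a b x y -> atom x -> atom y.
Proof.
intros H Hx. apply swap_atom_base in H; [|exact Hx].
destruct (swap_base_cases x y H) as [[-> _]|[_ K]]; [destruct (zero_not_atom Hx)|exact K].
Qed.

Lemma swap_block i x y : (forall j, block j a <-> block j b) -> swap a b x y -> block i x -> block i y.
Proof.
intros E H Hx. assert (Ax : atom x) by (exists i; exact Hx).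
apply swap_atom_base in H; [|exact Ax].
destruct H as [[-> ->]|[[-> ->]|[[-> ->]|[_ [_ [_ ->]]]]]]; try apply E; assumption.
Qed.

Lemma swap_fix (D : V -> Prop) x :
  definable (fun s _ => D (s 0)) -> (forall c, D c -> atom c) -> ~ D a -> ~ D b ->
  gen D x -> swap a b x x.
Proof.
intros HD DA Na Nb. pose proof (swap_definable a b) as DS. revert x.
apply (gen_ind D HD (fun x => swap a b x x)); [def_tac|..].
- apply lift_base. left. auto.
- intros x Hx. apply lift_base. right. right. right.
  split; [auto|]. split; [intros ->; auto|]. split; [intros ->; auto|reflexivity].
- intros x Hx H. apply lift_set; try exact Hx; intros z Hz; exists z; split; try exact Hz; apply H, Hz.
Qed.

Lemma swap_gen (D : V -> Prop) x y :
  definable (fun s _ => D (s 0)) -> (forall c, D c -> atom c) ->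
  gen D x -> swap a b x y -> gen (fun d => exists c, D c /\ swap_base a b c d) y.
Proof.
intros HD DA Hx. revert x Hx y. pose proof (swap_definable a b) as DS.
pose proof (swap_base_definable a b) as DB.
set (D' := fun d => exists c, D c /\ swap_base a b c d).
assert (HD' : definable (fun s _ => D' (s 0))) by (unfold D'; def_tac).
pose proof (gen_definable D' HD') as DG.
apply (gen_ind D HD (fun x => forall y, swap a b x y -> gen D' y)); [def_tac|..].
- intros y H. apply lift_inv in H; [|exact DB]. destruct H as [H|[_ [_ [H _]]]].
  + destruct (swap_base_cases _ _ H) as [[_ ->]|[K _]]; [apply gen_zero|destruct (zero_not_atom K)].
  + destruct (H empty) as [v [_ K]]; [apply mem_zero; reflexivity|].
    destruct not_code_empty. apply (swap_code _ v K).
- intros x Hx y H. apply gen_base. exists x. split; [exact Hx|]. apply swap_atom_base; auto.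
- intros x [z Hz] IH y H. apply lift_inv in H; [|exact DB]. destruct H as [H|[_ [Hy [_ H]]]].
  + destruct (swap_base_no_code x y z H Hz). apply (gen_code D HD DA), IH, Hz.
  + apply gen_set; [exact Hy|]. intros v Hv. destruct (H v Hv) as [u [Hu K]].
    apply (IH u Hu), K.
Qed.
End Swap.

(** * Small sets of urelements *)

(* [f] maps a part of [bulk] onto a set of indices of blocks. *)
Definition small (E : V) : Prop :=
  (forall a, a ∈ E -> atom a) /\
  exists f, (forall k i i', rel f k i -> rel f k i' -> i = i') /\
    forall a, a ∈ E -> exists k i, k ∈ bulk /\ rel f k i /\ block i a.

Lemma small_definable : definable (fun s _ => small (s 0)).
Proof. pose proof atom_definable. pose proof block_definable. unfold small. def_tac. Qed.

(* Cantor's diagonal argument. *)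
Lemma small_misses_block E : small E -> exists i, i ∈ index /\ forall a, a ∈ E -> ~ block i a.
Proof.
intros [_ [f [Ff Hf]]]. pose proof pure_definable as DP. pose proof block_definable as DB.
assert (Hp : power bulk <> empty).
{ intro H. apply (mem_empty bulk). rewrite <- H. apply mem_power. auto. }
destruct (separation (fun k => forall s i, i = embed s -> rel f k i -> ~ k ∈ s) bulk) as [d Hd]; [def_tac|].
exists (embed d). split.
- apply mem_embed; [exact Hp|]. exists d. split; [|reflexivity].
  apply mem_power. intros y Hy. apply Hd, Hy.
- intros a HaE Ha. destruct (Hf a HaE) as [k [i [Hk [Hki Hi]]]].
  rewrite (block_unique _ _ _ Hi Ha) in Hki.
  assert (N : ~ k ∈ d).
  { intro H. pose proof H as H'. apply Hd in H'. destruct H' as [H' _].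
    apply (H' d (embed d)); auto. }
  apply N, Hd. split; [|exact Hk]. intros s i' Es Hks Hkd. apply N.
  assert (E2 : embed s = embed d) by (rewrite <- Es; apply (Ff k); assumption).
  apply embed_injective in E2. subst s. exact Hkd.
Qed.

Lemma small_single a : atom a -> small (upair a a).
Proof.
intros [i Hi]. destruct bulk_two as [k [_ [Hk _]]]. split.
- intros c Hc. apply mem_upair in Hc. exists i. destruct Hc as [-> | ->]; exact Hi.
- exists (upair (opair k i) (opair k i)). split.
  + intros l j j' H H'. apply relE, mem_upair in H, H'.
    assert (E : opair l j = opair l j') by (destruct H as [-> | ->], H' as [-> | ->]; reflexivity).
    apply opair_injective in E. apply E.
  + intros c Hc. exists k, i. split; [exact Hk|]. split; [apply relE, mem_upair; auto|].
    apply mem_upair in Hc. destruct Hc as [-> | ->]; exact Hi.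
Qed.

Lemma small_empty : small empty.
Proof.
split; [intros a Ha; destruct (mem_empty a Ha)|]. exists empty.
split; [intros k i i' H; apply relE in H; destruct (mem_empty _ H)|].
intros a Ha. destruct (mem_empty a Ha).
Qed.

(** Each small set is chosen together with its enumeration [f]. The enumeration of the union sends
    the pair (z, k) to the value at [k] of the enumeration chosen for [z], and [bulk_pair] keeps
    this pair inside [bulk]. *)
Lemma small_union (d : V) (Q : V -> V -> Prop) :
  definable (fun s _ => Q (s 1) (s 0)) -> d ⊆ bulk ->
  (forall z, z ∈ d -> exists E, small E /\ Q z E) ->
  exists E, small E /\ forall z, z ∈ d -> exists E', (forall a, a ∈ E' -> a ∈ E) /\ Q z E'.
Proof.
intros HQ Hd Hex. pose proof atom_definable as DA. pose proof block_definable as DB.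
destruct (set_choice d (fun z p => exists E f, p = opair E f /\ Q z E /\
    (forall a, a ∈ E -> atom a) /\
    (forall k i i', rel f k i -> rel f k i' -> i = i') /\
    forall a, a ∈ E -> exists k i, k ∈ bulk /\ rel f k i /\ block i a)) as [h [H1 [H2 H3]]].
{ def_tac. }
{ intros z Hz. destruct (Hex z Hz) as [E [[HA [f [Hf Hf']]] HE]]. exists (opair E f), E, f. auto. }
destruct (replacement (fun z E => exists p f, p = opair E f /\ rel h z p) d) as [u Hu]; [def_tac|..].
{ intros z E E' _ [p [f [-> Hp]]] [p' [f' [-> Hp']]].
  pose proof (H3 _ _ _ Hp Hp') as K. apply opair_injective in K. apply K. }
assert (HF : exists F, forall r i, rel F r i <->
  exists z k E f p, r = opair z k /\ p = opair E f /\ k ∈ bulk /\ rel h z p /\ rel f k i).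
{ destruct (replacement (fun r q => exists z k E f p i, r = opair z k /\ p = opair E f /\ k ∈ bulk /\ rel h z p /\ rel f k i /\ q = opair r i) bulk)
    as [F HF]; [def_tac|..].
  - intros r q q' _ [z [k [E [f [p [i [-> [-> [_ [Hp [Hki ->]]]]]]]]]]] [z' [k' [E' [f' [p' [i' [Er [-> [_ [Hp' [Hki' ->]]]]]]]]]]].
    apply opair_injective in Er. destruct Er as [-> ->].
    pose proof (H3 _ _ _ Hp Hp') as K. apply opair_injective in K. destruct K as [-> ->].
    f_equal. apply H2 in Hp. destruct Hp as [_ [E2 [f2 [Ep [_ [_ [Ff _]]]]]]].
    apply opair_injective in Ep. destruct Ep as [-> ->]. apply (Ff k'); assumption.
  - exists F. intros r i. rewrite relE, HF. split.
    + intros [r' [_ [z [k [E [f [p [i' [-> [-> [Hk [Hp [Hki Eq]]]]]]]]]]]]].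
      apply opair_injective in Eq. destruct Eq as [-> ->]. exists z, k, E, f. eauto 10.
    + intros [z [k [E [f [p [-> [-> [Hk [Hp Hki]]]]]]]]]. exists (opair z k). split.
      * apply bulk_pair; [apply Hd; apply (H2 z (opair E f) Hp)|exact Hk].
      * exists z, k, E, f. eauto 10. }
destruct HF as [F HF].
assert (Hspec : forall z E f, rel h z (opair E f) -> Q z E /\
    (forall a, a ∈ E -> atom a) /\
    (forall k i i', rel f k i -> rel f k i' -> i = i') /\
    forall a, a ∈ E -> exists k i, k ∈ bulk /\ rel f k i /\ block i a).
{ intros z E f Hp. apply H2 in Hp. destruct Hp as [_ [E2 [f2 [Ep K]]]].
  apply opair_injective in Ep. destruct Ep as [-> ->]. exact K. }
exists (bigcup u). split; [split|].
- intros a Ha. apply mem_bigcup in Ha. destruct Ha as [E [HE Ha]]. apply Hu in HE.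
  destruct HE as [z [_ [p [f [-> Hp]]]]]. apply Hspec in Hp. apply Hp, Ha.
- exists F. split.
  + intros r i i' H H'. apply HF in H, H'.
    destruct H as [z [k [E [f [p [-> [-> [_ [Hp Hki]]]]]]]]], H' as [z' [k' [E' [f' [p' [Er [-> [_ [Hp' Hki']]]]]]]]].
    apply opair_injective in Er. destruct Er as [-> ->].
    pose proof (H3 _ _ _ Hp Hp') as K. apply opair_injective in K. destruct K as [-> ->].
    apply Hspec in Hp. destruct Hp as [_ [_ [Ff _]]]. apply (Ff k'); assumption.
  + intros a Ha. apply mem_bigcup in Ha. destruct Ha as [E [HE Ha]]. apply Hu in HE.
    destruct HE as [z [Hz [p [f [-> Hp]]]]]. destruct (Hspec _ _ _ Hp) as [_ [_ [_ K]]].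
    destruct (K a Ha) as [k [i [Hk [Hki Hi]]]]. exists (opair z k), i. split; [apply bulk_pair; auto|].
    split; [|exact Hi]. apply HF. exists z, k, E, f. eauto 10.
- intros z Hz. destruct (H1 z Hz) as [p Hp]. pose proof Hp as Hp'. apply H2 in Hp'.
  destruct Hp' as [_ [E [f [-> [HQE _]]]]]. exists E. split; [|exact HQE].
  intros a Ha. apply mem_bigcup. exists E. split; [|exact Ha]. apply Hu. eauto 6.
Qed.

(** Two distinct elements of [bulk] serve as names for the two sets. *)
Lemma small_union2 E1 E2 : small E1 -> small E2 ->
  exists E, small E /\ (forall a, a ∈ E1 -> a ∈ E) /\ (forall a, a ∈ E2 -> a ∈ E).
Proof.
intros H1 H2. destruct bulk_two as [k1 [k2 [Hk1 [Hk2 N]]]].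
destruct (small_union (upair k1 k2) (fun z E => (z = k1 /\ E = E1) \/ (z = k2 /\ E = E2))) as [E [HE K]].
- def_tac.
- intros z Hz. apply mem_upair in Hz. destruct Hz as [-> | ->]; assumption.
- intros z Hz. apply mem_upair in Hz. destruct Hz as [-> | ->]; eauto.
- exists E. split; [exact HE|]. split.
  + destruct (K k1) as [E' [L [[_ ->]|[E0 _]]]]; [apply mem_upair; auto|exact L|contradiction].
  + destruct (K k2) as [E' [L [[E0 _]|[_ ->]]]]; [apply mem_upair; auto|congruence|exact L].
Qed.

(** Exchanging two urelements of one block moves no urelement out of its block, so the enumeration
    [f] of the blocks is reused unchanged. *)
Lemma small_swap a b E : atom a -> atom b -> (forall j, block j a <-> block j b) -> small E ->
  exists E', small E' /\ forall d, d ∈ E' <-> exists c, c ∈ E /\ swap a b c d.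
Proof.
intros Ha Hb Eab [HA [f [Ff Hf]]]. pose proof (swap_definable a b) as DS.
destruct (replacement (swap a b) E DS) as [E' HE'].
{ intros x y z _. apply swap_functional; assumption. }
exists E'. split; [|exact HE']. split.
- intros d Hd. apply HE' in Hd. destruct Hd as [c [Hc K]]. apply (swap_atom a b Ha Hb c d K), HA, Hc.
- exists f. split; [exact Ff|]. intros d Hd. apply HE' in Hd. destruct Hd as [c [Hc K]].
  destruct (Hf c Hc) as [k [i [Hk [Hki Hi]]]]. exists k, i. split; [exact Hk|]. split; [exact Hki|].
  apply (swap_block a b Ha Hb i c d); assumption.
Qed.
End Atoms.

(** * Finitely many free variables *)

(** An environment supplies infinitely many parameters, whose supports need not have a small union;
    for a given formula only those below [B] matter. *)
Lemma sat_free_bound (M : structure) (a : form) : exists B, forall s s' t t',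
  (forall n, n < B -> s n = s' n) -> (forall n, n < B -> t n = t' n) ->
  sat M s t a <-> sat M s' t' a.
Proof.
assert (ex_iff : forall (X : Type) (P Q : X -> Prop),
  (forall x, P x <-> Q x) -> (exists x, P x) <-> (exists x, Q x)).
{ intros X P Q H; split; intros [x Hx]; exists x; apply H; exact Hx. }
assert (all_iff : forall (X : Type) (P Q : X -> Prop),
  (forall x, P x <-> Q x) -> (forall x, P x) <-> (forall x, Q x)).
{ intros X P Q H; split; intros Hx x; apply H; apply Hx. }
assert (bin : forall a b : form,
  (exists B, forall s s' t t', (forall n, n < B -> s n = s' n) -> (forall n, n < B -> t n = t' n) ->
    sat M s t a <-> sat M s' t' a) ->
  (exists B, forall s s' t t', (forall n, n < B -> s n = s' n) -> (forall n, n < B -> t n = t' n) ->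
    sat M s t b <-> sat M s' t' b) ->
  exists B, forall s s' t t', (forall n, n < B -> s n = s' n) -> (forall n, n < B -> t n = t' n) ->
    (sat M s t a <-> sat M s' t' a) /\ (sat M s t b <-> sat M s' t' b)).
{ intros a1 a2 [B1 H1] [B2 H2]. exists (B1 + B2). intros s s' t t' Hs Ht.
  split; [apply H1|apply H2]; intros n Hn; first [apply Hs|apply Ht]; lia. }
induction a.
- exists 0. reflexivity.
- exists (S n). intros s s' t t' Hs Ht. simpl. rewrite (Hs n) by lia. reflexivity.
- exists (S (n + n0)). intros s s' t t' Hs Ht. simpl. rewrite (Hs n), (Hs n0) by lia. reflexivity.
- exists (S (n + n0)). intros s s' t t' Hs Ht. simpl. rewrite (Hs n), (Hs n0) by lia. reflexivity.
- exists (S (n + n0)). intros s s' t t' Hs Ht. simpl. rewrite (Ht n), (Ht n0) by lia. reflexivity.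
- exists (S (n + n0)). intros s s' t t' Hs Ht. simpl. rewrite (Hs n), (Ht n0) by lia. reflexivity.
- destruct (bin _ _ IHa1 IHa2) as [B H]. exists B. intros s s' t t' Hs Ht.
  destruct (H s s' t t' Hs Ht). simpl. tauto.
- destruct (bin _ _ IHa1 IHa2) as [B H]. exists B. intros s s' t t' Hs Ht.
  destruct (H s s' t t' Hs Ht). simpl. tauto.
- destruct (bin _ _ IHa1 IHa2) as [B H]. exists B. intros s s' t t' Hs Ht.
  destruct (H s s' t t' Hs Ht). simpl. tauto.
- destruct IHa as [B H]. exists B. intros s s' t t' Hs Ht. apply all_iff. intro x.
  apply H; [|exact Ht]. intros [|n] Hn; [reflexivity|]. apply Hs. lia.
- destruct IHa as [B H]. exists B. intros s s' t t' Hs Ht. apply ex_iff. intro x.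
  apply H; [|exact Ht]. intros [|n] Hn; [reflexivity|]. apply Hs. lia.
- destruct IHa as [B H]. exists B. intros s s' t t' Hs Ht. apply all_iff. intro x.
  apply H; [exact Hs|]. intros [|n] Hn; [reflexivity|]. apply Ht. lia.
- destruct IHa as [B H]. exists B. intros s s' t t' Hs Ht. apply ex_iff. intro x.
  apply H; [exact Hs|]. intros [|n] Hn; [reflexivity|]. apply Ht. lia.
Qed.

(** * The extension *)

Section Extension.
Context {M : structure} {HM : ground M} {HS : setting M}.
Notation V := (obj M).
Notation "x ∈ y" := (@mem M x y) (at level 70).

Definition gens (E : V) : V -> Prop := gen (fun a => a ∈ E).

Definition new_set (x : V) : Prop := exists E, small E /\ gens E x.

Definition mates (a b : V) : Prop := atom a /\ atom b /\ forall j, block j a <-> block j b.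

(** One implication amounts to invariance, since [swap] is symmetric. *)
Definition supports (E : V) (X : cls M) : Prop :=
  forall a b, mates a b -> ~ a ∈ E -> ~ b ∈ E ->
  forall x y, swap a b x y -> memC x X -> memC y X.

Definition new_class (X : cls M) : Prop :=
  (forall x, memC x X -> new_set x) /\ exists E, small E /\ supports E X.

Lemma mem_definable E : @definable M (fun s _ => s 0 ∈ E).
Proof. def_tac. Qed.

Lemma gens_definable : definable (fun s _ => gens (s 1) (s 0)).
Proof. unfold gens, gen, lfp, gen_step. def_tac. Qed.

Lemma new_set_definable : definable (fun s _ => new_set (s 0)).
Proof. pose proof small_definable. pose proof gens_definable. unfold new_set. def_tac. Qed.

Lemma mates_definable : definable (fun s _ => mates (s 1) (s 0)).
Proof. pose proof atom_definable. pose proof block_definable. unfold mates. def_tac. Qed.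

Lemma new_class_definable : @definable M (fun _ t => new_class (t 0)).
Proof.
pose proof small_definable. pose proof new_set_definable. pose proof mates_definable.
pose proof atom_definable.
unfold new_class, supports, swap, lift, lfp2, bisim_step, swap_base. def_tac.
Qed.

Lemma small_atoms E : small E -> forall a, a ∈ E -> atom a.
Proof. intros [H _]. exact H. Qed.

Lemma gens_mono E F x : (forall a, a ∈ E -> a ∈ F) -> gens E x -> gens F x.
Proof. intros H. apply gen_mono; [apply mem_definable|apply mem_definable|exact H]. Qed.

Lemma supports_mono E F X : (forall a, a ∈ E -> a ∈ F) -> supports E X -> supports F X.
Proof. intros H K a b Hab Ha Hb. apply K; auto. Qed.

Lemma gens_code E x : small E -> gens E x -> code x.
Proof. intro H. apply gen_code; [apply mem_definable|apply small_atoms, H]. Qed.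

Lemma new_code x : new_set x -> code x.
Proof. intros [E [HE H]]. apply (gens_code E); assumption. Qed.

Lemma gens_elements E x z : small E -> gens E x -> z ∈ x -> code z -> forall y, y ∈ x -> gens E y.
Proof.
intros HE. apply gen_mem; [apply mem_definable|apply small_atoms, HE].
Qed.

Lemma new_zero : new_set zero.
Proof. exists empty. split; [apply small_empty|apply gen_zero]. Qed.

Lemma new_embed x : new_set (embed x).
Proof. exists empty. split; [apply small_empty|apply gen_embed, mem_definable]. Qed.

Lemma new_atom a : atom a -> new_set a.
Proof.
intro H. exists (upair a a). split; [apply small_single, H|]. apply gen_base, mem_upair. auto.
Qed.

Lemma empty_class : exists X : cls M, forall x, ~ memC x X.
Proof.
destruct (classes (fun _ : V => False)) as [X HX]; [def_tac|]. exists X. intros x H. apply HX in H. exact H.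
Qed.

Lemma new_class_inhabited : inhabited {X | new_class X}.
Proof.
destruct empty_class as [X HX]. constructor. exists X. split.
- intros x H. destruct (HX x H).
- exists empty. split; [apply small_empty|]. intros a b _ _ _ x y _ H. destruct (HX x H).
Qed.

(** Membership is that of [M]. The elements that [zero] and the urelements have in [M] are not
    codes, so within the extension these objects have no members. *)
Definition extension : structure :=
  Structure {x | new_set x} {X | new_class X}
    (fun x => atom (proj1_sig x))
    (fun x y => proj1_sig x ∈ proj1_sig y)
    (fun x X => memC (proj1_sig x) (proj1_sig X))
    (inhabits (exist _ zero new_zero)) new_class_inhabited.

Notation N := extension.
Definition val (x : obj N) : V := proj1_sig x.
Definition valC (X : cls N) : cls M := proj1_sig X.
Definition mk (x : V) (H : new_set x) : obj N := exist _ x H.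

Lemma val_new x : new_set (val x).
Proof. apply (proj2_sig x). Qed.

Lemma val_injective x y : val x = val y -> x = y.
Proof. intro H. apply eq_sig_hprop; [intros; apply proof_irrelevance|exact H]. Qed.

Lemma valC_new X : new_class (valC X).
Proof. apply (proj2_sig X). Qed.

Lemma valC_injective X Y : valC X = valC Y -> X = Y.
Proof. intro H. apply eq_sig_hprop; [intros; apply proof_irrelevance|exact H]. Qed.

Lemma extension_class_ext (X Y : cls N) :
  (forall x : obj N, memC x X <-> memC x Y) -> X = Y.
Proof.
intro H. apply valC_injective, class_ext. intro x. split; intro Hx.
- apply (H (mk x (proj1 (valC_new X) x Hx))), Hx.
- apply (H (mk x (proj1 (valC_new Y) x Hx))), Hx.
Qed.

(** * Truth in the extension is definable *)

(** Environments take values in [M] and the quantifiers are relativised, so truth in the extension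
    becomes a predicate to which Comprehension in [M] applies. *)
Fixpoint sat_in (s : nat -> V) (t : nat -> cls M) (a : form) : Prop :=
  match a with
  | fBot => False
  | fUr x => atom (s x)
  | fEq x y => s x = s y
  | fMem x y => s x ∈ s y
  | fEqC x y => t x = t y
  | fMemC x y => memC (s x) (t y)
  | fImp a b => sat_in s t a -> sat_in s t b
  | fAnd a b => sat_in s t a /\ sat_in s t b
  | fOr a b => sat_in s t a \/ sat_in s t b
  | fAll a => forall x, new_set x -> sat_in (scons x s) t a
  | fEx a => exists x, new_set x /\ sat_in (scons x s) t a
  | fAllC a => forall X, new_class X -> sat_in s (scons X t) a
  | fExC a => exists X, new_class X /\ sat_in s (scons X t) a
  end.

Lemma scons_eta {X : Type} (s : nat -> X) : scons (s 0) (fun n => s (S n)) = s.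
Proof. apply functional_extensionality. intros [|n]; reflexivity. Qed.

Lemma scons_comp {X Y : Type} (f : X -> Y) x s :
  (fun n => f (scons x s n)) = scons (f x) (fun n => f (s n)).
Proof. apply functional_extensionality. intros [|n]; reflexivity. Qed.

Lemma sat_in_definable a : definable (fun s t => sat_in s t a).
Proof.
pose proof atom_definable as HA. pose proof new_set_definable as HN.
pose proof new_class_definable as HC.
assert (HC0 : forall P, @definable M P -> definable (fun s t => new_class (t 0) /\ P s t)).
{ intros P HP. def_tac. }
assert (HC1 : forall P, @definable M P -> definable (fun s t => new_class (t 0) -> P s t)).
{ intros P HP. def_tac. }
induction a; cbn [sat_in].
1-6: def_tac.
1-3: def_tac.
- apply definable_all. apply definable_imp; [def_tac|].
  apply (definable_iff M (fun s t => sat_in s t a)); [|exact IHa].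
  intros s t. rewrite scons_eta. reflexivity.
- apply definable_ex. apply definable_and; [def_tac|].
  apply (definable_iff M (fun s t => sat_in s t a)); [|exact IHa].
  intros s t. rewrite scons_eta. reflexivity.
- apply definable_allC. apply HC1.
  apply (definable_iff M (fun s t => sat_in s t a)); [|exact IHa].
  intros s t. rewrite scons_eta. reflexivity.
- apply definable_exC. apply HC0.
  apply (definable_iff M (fun s t => sat_in s t a)); [|exact IHa].
  intros s t. rewrite scons_eta. reflexivity.
Qed.

Lemma sat_inE a : forall (s : nat -> obj N) (t : nat -> cls N),
  sat N s t a <-> sat_in (fun n => val (s n)) (fun n => valC (t n)) a.
Proof.
induction a; intros s t; cbn [sat sat_in].
- tauto.
- reflexivity.
- split; [congruence|]. apply val_injective.
- reflexivity.
- split; [congruence|]. apply valC_injective.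
- reflexivity.
- rewrite IHa1, IHa2. reflexivity.
- rewrite IHa1, IHa2. reflexivity.
- rewrite IHa1, IHa2. reflexivity.
- split; intros H x.
  + intro Hx. specialize (H (mk x Hx)). apply IHa in H. rewrite (scons_comp val) in H. exact H.
  + apply IHa. rewrite (scons_comp val). apply H, val_new.
- split; intros [x H].
  + exists (val x). split; [apply val_new|]. apply IHa in H. rewrite (scons_comp val) in H. exact H.
  + destruct H as [Hx H]. exists (mk x Hx). apply IHa. rewrite (scons_comp val). exact H.
- split; intros H x.
  + intro Hx. specialize (H (exist _ x Hx)). apply IHa in H. rewrite (scons_comp valC) in H. exact H.
  + apply IHa. rewrite (scons_comp valC). apply H, valC_new.
- split; intros [x H].
  + exists (valC x). split; [apply valC_new|]. apply IHa in H. rewrite (scons_comp valC) in H. exact H.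
  + destruct H as [Hx H]. exists (exist _ x Hx). apply IHa. rewrite (scons_comp valC). exact H.
Qed.

(** * Transpositions act as automorphisms of the extension *)

Lemma gens_fix E a b x : small E -> ~ a ∈ E -> ~ b ∈ E -> gens E x -> swap a b x x.
Proof.
intros HE Na Nb. apply swap_fix; [apply mem_definable|apply small_atoms, HE|exact Na|exact Nb].
Qed.

Section Automorphism.
Variables a b : V.
Hypothesis Hab : mates a b.
Let Ha : atom a := proj1 Hab.
Let Hb : atom b := proj1 (proj2 Hab).

Lemma new_swap x y : new_set x -> swap a b x y -> new_set y.
Proof.
intros [E [HE Hx]] Hxy. destruct (small_swap a b E Ha Hb (proj2 (proj2 Hab)) HE) as [F [HF EF]].
exists F. split; [exact HF|].
pose proof (swap_gen a b Ha Hb (fun c => c ∈ E) x y (mem_definable E) (small_atoms E HE) Hx Hxy) as K.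
revert K. pose proof (swap_base_definable a b) as DB. apply gen_mono; [def_tac|def_tac|].
intros d [c [Hc Hcd]]. apply EF. exists c. split; [exact Hc|apply lift_base, Hcd].
Qed.

Lemma extension_swap (x : obj N) : exists y : obj N, swap a b (val x) (val y).
Proof.
destruct (swap_total a b Ha Hb (val x) (new_code _ (val_new x))) as [y Hy].
exists (mk y (new_swap (val x) y (val_new x) Hy)). exact Hy.
Qed.

(** Conjugation of permutations, written relationally: the path from [x] through [y] and [y'] to
    [x'] is the conjugate. It tells how a support moves with its class. *)
Lemma swap_conjugate c d c' d' : atom c -> atom d ->
  swap a b c c' -> swap a b d d' ->
  forall x y y' x', swap a b x y -> swap c d y y' -> swap a b y' x' -> swap c' d' x x'.
Proof.
intros Hc Hd Hcc Hdd x y y' x' Hxy. assert (Cx : code x) by apply (swap_code a b Ha Hb x y Hxy).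
assert (Hc' : atom c') by apply (swap_atom a b Ha Hb c c' Hcc Hc).
assert (Hd' : atom d') by apply (swap_atom a b Ha Hb d d' Hdd Hd).
revert x Cx y y' x' Hxy.
pose proof (swap_definable a b) as D1. pose proof (swap_definable c d) as D2.
pose proof (swap_definable c' d') as D3.
assert (zeroT : forall e f y, atom e -> atom f -> swap e f zero y -> y = zero).
{ intros e f y He Hf H. apply (swap_functional e f He Hf zero); [exact H|].
  apply lift_base. left. auto. }
apply (gen_ind atom atom_definable (fun x => forall y y' x',
  swap a b x y -> swap c d y y' -> swap a b y' x' -> swap c' d' x x')); [def_tac|..].
- intros y y' x' H1 H2 H3. apply zeroT in H1; auto. subst y. apply zeroT in H2; auto. subst y'.
  apply zeroT in H3; auto. subst x'. apply lift_base. left. auto.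
- intros x Hx y y' x' H1 H2 H3. assert (Hy : atom y) by apply (swap_atom a b Ha Hb x y H1 Hx).
  apply lift_base. apply (swap_atom_base c d Hc Hd) in H2; [|exact Hy].
  pose proof (swap_functional a b Ha Hb) as F.
  destruct H2 as [[-> _]|[[-> ->]|[[-> ->]|[_ [N1 [N2 ->]]]]]].
  + destruct (zero_not_atom Hy).
  + right. left. split; [apply (F c); [apply swap_sym; exact H1|exact Hcc]|apply (F d); assumption].
  + right. right. left. split; [apply (F d); [apply swap_sym; exact H1|exact Hdd]|apply (F c); assumption].
  + right. right. right. split; [exact Hx|]. split; [|split].
    * intros ->. apply N1. apply (F c' y c); [exact H1|apply swap_sym; exact Hcc].
    * intros ->. apply N2. apply (F d' y d); [exact H1|apply swap_sym; exact Hdd].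
    * apply (F y); [exact H3|apply swap_sym; exact H1].
- intros x [z0 Hz0] IH y y' x' H1 H2 H3.
  assert (T1 : forall z, code z -> exists v v' u', swap a b z v /\ swap c d v v' /\ swap a b v' u').
  { intros z Hz. destruct (swap_total a b Ha Hb z Hz) as [v Hv]. exists v.
    destruct (swap_total c d Hc Hd v) as [v' Hv'].
    { apply (swap_code a b Ha Hb v z), swap_sym, Hv. }
    destruct (swap_total a b Ha Hb v') as [u' Hu'].
    { apply (swap_code c d Hc Hd v' v), swap_sym, Hv'. }
    eauto. }
  assert (fwd : forall u, u ∈ x -> exists v, v ∈ x' /\ swap c' d' u v).
  { intros u Hu. destruct (T1 u) as [v [v' [u' [Hv [Hv' Hu']]]]]; [apply IH, Hu|].
    exists u'. split.
    - apply (swap_mem a b Ha Hb y' x' v' u' H3 Hu'), (swap_mem c d Hc Hd y y' v v' H2 Hv'),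
        (swap_mem a b Ha Hb x y u v H1 Hv), Hu.
    - apply (IH u Hu) with v v'; assumption. }
  assert (Cx' : forall z, z ∈ x' -> code z).
  { destruct (fwd z0 Hz0) as [v0 [Hv0 K]].
    apply (gen_mem atom atom_definable (fun a H => H) x' v0); [|exact Hv0|].
    - apply (swap_code a b Ha Hb x' y'), swap_sym, H3.
    - apply (swap_code c' d' Hc' Hd' v0 z0), swap_sym, K. }
  apply lift_set; [eauto| |exact fwd|].
  + destruct (fwd z0 Hz0) as [v0 [Hv0 _]]. eauto.
  + intros u' Hu'. destruct (T1 u' (Cx' u' Hu')) as [v' [v [u [Hv' [Hv Hu]]]]].
    apply swap_sym in Hv', Hv, Hu.
    assert (Hux : u ∈ x).
    { apply (swap_mem a b Ha Hb x y u v H1 Hu), (swap_mem c d Hc Hd y y' v v' H2 Hv),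
        (swap_mem a b Ha Hb y' x' v' u' H3 Hv'), Hu'. }
    exists u. split; [exact Hux|]. apply (IH u Hux) with v v'; assumption.
Qed.

(** If [E] supports a class, the image of [E] supports the image of the class: an exchange outside
    the image of [E] is conjugate to an exchange outside [E]. *)
Lemma extension_swapC (X : cls N) : exists Y : cls N,
  forall x y, swap a b x y -> memC x (valC X) <-> memC y (valC Y).
Proof.
pose proof (swap_definable a b) as DS.
destruct (classes (fun y => exists x, memC x (valC X) /\ swap a b x y)) as [Y HY]; [def_tac|].
destruct (valC_new X) as [HX1 [E [HE HX2]]].
destruct (small_swap a b E Ha Hb (proj2 (proj2 Hab)) HE) as [F [HF EF]].
assert (HYn : new_class Y).
{ split.
  - intros y Hy. apply HY in Hy. destruct Hy as [x [Hx Hxy]]. apply (new_swap x y); auto.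
  - exists F. split; [exact HF|]. intros c d [Hc [Hd Hcd]] Nc Nd y y' Hyy' Hy.
    apply HY in Hy. destruct Hy as [x [Hx Hxy]].
    destruct (swap_total a b Ha Hb c) as [c' Hc']; [apply gen_base, Hc|].
    destruct (swap_total a b Ha Hb d) as [d' Hd']; [apply gen_base, Hd|].
    destruct (swap_total a b Ha Hb y') as [x' Hx'].
    { apply (swap_code c d Hc Hd y' y), swap_sym, Hyy'. }
    apply HY. exists x'. split; [|apply swap_sym; exact Hx'].
    apply (HX2 c' d') with x; [|..|exact Hx].
    + split; [apply (swap_atom a b Ha Hb c c' Hc' Hc)|].
      split; [apply (swap_atom a b Ha Hb d d' Hd' Hd)|].
      pose proof (fun i u v => swap_block a b Ha Hb i u v (proj2 (proj2 Hab))) as SB.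
      intro j. split; intro K.
      * apply (SB j d d' Hd'), Hcd. apply (SB j c' c (swap_sym _ _ _ _ Hc')), K.
      * apply (SB j c c' Hc'), Hcd. apply (SB j d' d (swap_sym _ _ _ _ Hd')), K.
    + intro K. apply Nc, EF. exists c'. split; [exact K|apply swap_sym; exact Hc'].
    + intro K. apply Nd, EF. exists d'. split; [exact K|apply swap_sym; exact Hd'].
    + apply (swap_conjugate c d c' d' Hc Hd Hc' Hd' x y y' x' Hxy Hyy' Hx'). }
exists (exist _ Y HYn). intros x y Hxy. change (memC x (valC X) <-> memC y Y). rewrite HY. split.
- intro Hx. eauto.
- intros [x' [Hx' Hx'y]].
  rewrite (swap_functional a b Ha Hb y x x'); [exact Hx'|apply swap_sym; exact Hxy|apply swap_sym; exact Hx'y].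
Qed.

Definition image (x y : obj N) : Prop := swap a b (val x) (val y).
Definition imageC (X Y : cls N) : Prop :=
  forall x y, swap a b x y -> memC x (valC X) <-> memC y (valC Y).

Lemma image_sym x y : image x y -> image y x.
Proof. apply swap_sym. Qed.

Lemma imageC_sym X Y : imageC X Y -> imageC Y X.
Proof. intros H x y Hxy. symmetry. apply H, swap_sym, Hxy. Qed.

Lemma imageC_functional X Y Y' : imageC X Y -> imageC X Y' -> Y = Y'.
Proof.
intros H H'. apply extension_class_ext. intro y. destruct (extension_swap y) as [x Hx].
apply swap_sym in Hx. change (memC (val y) (valC Y) <-> memC (val y) (valC Y')).
rewrite <- (H _ _ Hx), <- (H' _ _ Hx). reflexivity.
Qed.

Lemma image_functional x y y' : image x y -> image x y' -> y = y'.
Proof. intros H H'. apply val_injective. apply (swap_functional a b Ha Hb (val x)); assumption. Qed.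

(** Implications and universal quantifiers ask for the converse direction, which is an instance of
    the same statement because a transposition is its own inverse. *)
Lemma sat_image f : forall s s' t t',
  (forall n, image (s n) (s' n)) -> (forall n, imageC (t n) (t' n)) ->
  sat N s t f -> sat N s' t' f.
Proof.
assert (Hscons : forall (x y : obj N) s s', image x y -> (forall n, image (s n) (s' n)) ->
  forall n, image (scons x s n) (scons y s' n)).
{ intros x y s s' H K [|n]; [exact H|apply K]. }
assert (HsconsC : forall (x y : cls N) s s', imageC x y -> (forall n, imageC (s n) (s' n)) ->
  forall n, imageC (scons x s n) (scons y s' n)).
{ intros x y s s' H K [|n]; [exact H|apply K]. }
induction f; intros s s' t t' Hs Ht H; cbn [sat] in *.
- exact H.
- apply (swap_atom a b Ha Hb _ _ (Hs n)), H.
- apply (image_functional (s n)); [apply Hs|]. rewrite H. apply Hs.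
- apply (swap_mem a b Ha Hb _ _ _ _ (Hs n0) (Hs n)), H.
- apply (imageC_functional (t n)); [apply Ht|]. rewrite H. apply Ht.
- apply (Ht n0 _ _ (Hs n)), H.
- intro K. apply (IHf2 s s' t t' Hs Ht), H. apply (IHf1 s' s t' t); [| |exact K].
  + intro n. apply image_sym, Hs.
  + intro n. apply imageC_sym, Ht.
- destruct H as [H1 H2]. split; [apply (IHf1 s s' t t')|apply (IHf2 s s' t t')]; assumption.
- destruct H as [H|H]; [left; apply (IHf1 s s' t t')|right; apply (IHf2 s s' t t')]; assumption.
- intro y. destruct (extension_swap y) as [x Hx]. apply swap_sym in Hx.
  apply (IHf (scons x s) (scons y s') t t'); auto.
- destruct H as [x H]. destruct (extension_swap x) as [y Hy]. exists y.
  apply (IHf (scons x s) (scons y s') t t'); auto.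
- intro Y. destruct (extension_swapC Y) as [X HX]. apply imageC_sym in HX.
  apply (IHf s s' (scons X t) (scons Y t')); auto.
- destruct H as [X H]. destruct (extension_swapC X) as [Y HY]. exists Y.
  apply (IHf s s' (scons X t) (scons Y t')); auto.
Qed.
End Automorphism.

Lemma environment_support (s : nat -> obj N) (t : nat -> cls N) B :
  exists E, small E /\ (forall n, n < B -> gens E (val (s n))) /\
    (forall n, n < B -> supports E (valC (t n))).
Proof.
induction B as [|B [E [HE [H1 H2]]]].
- exists empty. split; [apply small_empty|]. split; intros n Hn; lia.
- destruct (val_new (s B)) as [F [HF KF]]. destruct (valC_new (t B)) as [_ [G [HG KG]]].
  destruct (small_union2 E F HE HF) as [E1 [HE1 [L1 L2]]].
  destruct (small_union2 E1 G HE1 HG) as [E2 [HE2 [L3 L4]]].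
  exists E2. split; [exact HE2|]. split; intros n Hn.
  + assert (n = B \/ n < B) as [->|Hn'] by lia.
    * apply (gens_mono F); auto.
    * apply (gens_mono E); auto.
  + assert (n = B \/ n < B) as [->|Hn'] by lia.
    * apply (supports_mono G); auto.
    * apply (supports_mono E); auto.
Qed.

Lemma extension_comprehension f : holds N (ax_comprehension f).
Proof.
intros s t. apply sat_comprehension.
destruct (sat_free_bound N f) as [B HB].
destruct (environment_support s t B) as [E [HE [Hs Ht]]].
destruct empty_class as [X0 HX0].
assert (HX0n : new_class X0).
{ split; [intros x H; destruct (HX0 x H)|].
  exists empty. split; [apply small_empty|]. intros a b _ _ _ x y _ H. destruct (HX0 x H). }
(* From [B] on, the parameters are reset to [zero] and the empty class, which every transposition
   fixes; hence [E] supports all parameters at once. *)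
set (s' := fun n => if Nat.ltb n B then s n else mk zero new_zero).
set (t' := fun n => if Nat.ltb n B then t n else exist _ X0 HX0n : cls N).
assert (Hs' : forall n, gens E (val (s' n))).
{ intro n. unfold s'. destruct (Nat.ltb_spec n B); [auto|apply gen_zero]. }
assert (Ht' : forall n, supports E (valC (t' n))).
{ intro n. unfold t'. destruct (Nat.ltb_spec n B); [auto|].
  intros a b _ _ _ x y _ K. destruct (HX0 x K). }
assert (E1 : forall x, sat N (scons x s) t f <-> sat N (scons x s') t' f).
{ intro x. apply HB.
  - intros [|n] Hn; [reflexivity|]. cbn. unfold s'. destruct (Nat.ltb_spec n B); [reflexivity|lia].
  - intros n Hn. unfold t'. destruct (Nat.ltb_spec n B); [reflexivity|lia]. }
destruct (classes (fun x => new_set x /\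
  sat_in (scons x (fun n => val (s' n))) (fun n => valC (t' n)) f)) as [X HX].
{ apply definable_and; [apply new_set_definable|].
  refine (definable_iff M _ _ _ (definable_subst M _
    (fun n s => match n with 0 => s 0 | S n => val (s' n) end)
    (fun n _ => valC (t' n)) (sat_in_definable f) _ _)).
  - intros u v. cbv beta.
    replace (fun n => match n with 0 => u 0 | S n => val (s' n) end) with (scons (u 0) (fun n => val (s' n)));
      [reflexivity|]. apply functional_extensionality. intros [|n]; reflexivity.
  - intros [|m]; [apply term_var|apply term_const].
  - intro m. apply term_const. }
assert (HXn : new_class X).
{ split; [intros x Hx; apply HX in Hx; apply Hx|].
  exists E. split; [exact HE|]. intros a b Hab Na Nb x y Hxy Hx. apply HX in Hx. destruct Hx as [Hx K].
  assert (Hy : new_set y) by apply (new_swap a b Hab x y Hx Hxy).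
  apply HX. split; [exact Hy|].
  assert (K' : sat N (scons (mk x Hx) s') t' f).
  { apply sat_inE. rewrite (scons_comp val). exact K. }
  apply (sat_image a b Hab f _ (scons (mk y Hy) s') t' t') in K'.
  - apply sat_inE in K'. rewrite (scons_comp val) in K'. exact K'.
  - intros [|m]; [exact Hxy|]. apply (gens_fix E); [exact HE|exact Na|exact Nb|exact (Hs' m)].
  - intros m u v Huv. split; apply (Ht' m a b Hab Na Nb); [exact Huv|apply swap_sym; exact Huv]. }
exists (exist _ X HXn). intro x. change (memC (val x) X <-> sat N (scons x s) t f).
rewrite HX, E1, sat_inE, (scons_comp val). split; [tauto|]. intro K. split; [apply val_new|exact K].
Qed.
End Extension.

(** * Set theory in the extension *)

Section SetTheory.
Context {M : structure} {HM : ground M} {HS : setting M}.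
Notation V := (obj M).
Notation "x ∈ y" := (@mem M x y) (at level 70).
Notation N := (@extension M HM HS).

Lemma val_code (x : obj N) : code (val x).
Proof. apply new_code, val_new. Qed.

Lemma new_elements (x : V) z y : new_set x -> z ∈ x -> code z -> y ∈ x -> new_set y.
Proof.
intros [E [HE H]] Hz Cz Hy. exists E. split; [exact HE|]. apply (gens_elements E x z); assumption.
Qed.

Lemma gens_val_mem E (x z : obj N) : small E -> gens E (val x) -> mem z x -> gens E (val z).
Proof. intros HE Hx Hz. apply (gens_elements E (val x) (val z)); try assumption. apply val_code. Qed.

(** A nonempty set of codes represents itself, but the empty one has to become [zero]. A common
    small [E] for all elements is what makes the result an object of the extension. *)
Lemma make_set (E y : V) : small E -> (forall z, z ∈ y -> gens E z) ->
  exists v : obj N, ~ ur v /\ (forall z : obj N, mem z v <-> val z ∈ y) /\ gens E (val v) /\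
    ((exists z, z ∈ y) -> val v = y) /\ (y = empty -> val v = zero).
Proof.
intros HE Hy. destruct (classic (y = empty)) as [->|Ne].
- exists (mk zero new_zero). split; [apply zero_not_atom|]. split; [|split; [apply gen_zero|]].
  + intro z. split; intro H; [destruct (not_code_zero _ H (val_code z))|destruct (mem_empty _ H)].
  + split; [|reflexivity]. intros [z Hz]. destruct (mem_empty _ Hz).
- pose proof (nonempty y Ne) as [z0 Hz0].
  assert (G : gens E y) by (apply gen_set; [eauto|exact Hy]).
  exists (mk y (ex_intro _ E (conj HE G))). split; [|split; [reflexivity|split; [exact G|]]].
  + intro A. apply (not_code_atom y z0 A Hz0). apply (gens_code E); auto.
  + split; [reflexivity|contradiction].
Qed.

Lemma set_cases (x : obj N) : ~ ur x -> val x = zero \/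
  ((exists z, z ∈ val x) /\ forall z, z ∈ val x -> new_set z).
Proof.
intro Hx. destruct (val_new x) as [E [HE H]].
apply gen_inv in H; [|apply mem_definable]. destruct H as [H|[H|[H K]]].
- auto.
- destruct Hx. apply (small_atoms E HE _ H).
- right. split; [exact H|]. intros z Hz. exists E. split; [exact HE|apply K, Hz].
Qed.

Lemma nonempty_elements (x z : obj N) : mem z x -> forall y, y ∈ val x -> new_set y.
Proof. intros Hz y. apply (new_elements (val x) (val z)); [apply val_new|exact Hz|apply val_code]. Qed.

Lemma extension_extensionality (x y : obj N) :
  ~ ur x -> ~ ur y -> (forall z : obj N, mem z x <-> mem z y) -> x = y.
Proof.
intros Hx Hy H. apply val_injective.
assert (aux : forall u v : obj N, (forall z : obj N, mem z u <-> mem z v) -> val u = zero ->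
  (exists z, z ∈ val v) -> (forall z, z ∈ val v -> new_set z) -> False).
{ intros u v K E [z Hz] L. assert (Hu : mem (mk z (L z Hz)) u) by (apply K; exact Hz).
  change (z ∈ val u) in Hu. rewrite E in Hu. apply (not_code_zero z Hu), new_code, L, Hz. }
destruct (set_cases x Hx) as [Ex|[Nx Kx]], (set_cases y Hy) as [Ey|[Ny Ky]].
- congruence.
- destruct (aux x y H Ex Ny Ky).
- destruct (aux y x (fun z => iff_sym (H z)) Ey Nx Kx).
- apply ext. intro z. split; intro Hz.
  + apply (H (mk z (Kx z Hz))), Hz.
  + apply (H (mk z (Ky z Hz))), Hz.
Qed.

Lemma extension_pairing (x y : obj N) : exists v : obj N, is_upair v x y /\ val v = upair (val x) (val y).
Proof.
destruct (val_new x) as [E [HE Hx]], (val_new y) as [F [HF Hy]].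
destruct (small_union2 E F HE HF) as [G [HG [L1 L2]]].
destruct (make_set G (upair (val x) (val y)) HG) as [v [_ [Hv [_ [Ev _]]]]].
{ intros z Hz. apply mem_upair in Hz. destruct Hz as [-> | ->]; [apply (gens_mono E)|apply (gens_mono F)]; assumption. }
exists v. split.
- intro z. rewrite (Hv z), mem_upair. split; (intros [H|H]; [left|right]); try apply val_injective; congruence.
- apply Ev. exists (val x). apply mem_upair. auto.
Qed.

Lemma is_upair_val (z x y : obj N) : is_upair z x y <-> val z = upair (val x) (val y).
Proof.
destruct (extension_pairing x y) as [v [Hv Ev]]. split.
- intro H. assert (Hx : mem x z) by (apply H; auto).
  apply ext. intro w. rewrite mem_upair. split.
  + intro Hw. pose proof (nonempty_elements z x Hx w Hw) as Nw.
    destruct (proj1 (H (mk w Nw)) Hw) as [E|E]; [left|right]; rewrite <- E; reflexivity.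
  + assert (Hy : mem y z) by (apply H; auto). intros [-> | ->]; assumption.
- intro E. rewrite <- Ev in E. apply val_injective in E. subst v. exact Hv.
Qed.

Lemma new_upair (x y : obj N) : new_set (upair (val x) (val y)).
Proof. destruct (extension_pairing x y) as [v [_ <-]]. apply val_new. Qed.

Lemma new_opair (x y : obj N) : new_set (opair (val x) (val y)).
Proof. apply (new_upair (mk _ (new_upair x x)) (mk _ (new_upair x y))). Qed.

Definition npair (x y : obj N) : obj N := mk _ (new_opair x y).

Lemma is_opair_val (p x y : obj N) : is_opair p x y <-> val p = opair (val x) (val y).
Proof.
split.
- intro H.
  assert (H1 : mem (mk _ (new_upair x x) : obj N) p) by (apply H; left; apply is_upair_val; reflexivity).
  assert (H2 : mem (mk _ (new_upair x y) : obj N) p) by (apply H; right; apply is_upair_val; reflexivity).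
  apply ext. intro w. rewrite mem_opair. split.
  + intro Hw. pose proof (nonempty_elements p _ H1 w Hw) as Nw.
    destruct (proj1 (H (mk w Nw)) Hw) as [E|E]; apply is_upair_val in E; auto.
  + intros [-> | ->]; assumption.
- intros E z. change (mem z p) with (val z ∈ val p). rewrite E, mem_opair, !is_upair_val. reflexivity.
Qed.

Lemma rel_val (f x y : obj N) : rel f x y <-> opair (val x) (val y) ∈ val f.
Proof.
split.
- intros [p [Hp H]]. apply is_opair_val in Hp. rewrite <- Hp. exact H.
- intro H. exists (npair x y). split; [apply is_opair_val; reflexivity|exact H].
Qed.

Lemma relC_val (F : cls N) (x y : obj N) : relC F x y <-> memC (opair (val x) (val y)) (valC F).
Proof.
split.
- intros [p [Hp H]]. apply is_opair_val in Hp. rewrite <- Hp. exact H.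
- intro H. exists (npair x y). split; [apply is_opair_val; reflexivity|exact H].
Qed.

Lemma relC_components (F : cls N) (x y : V) :
  is_relC F -> memC (opair x y) (valC F) -> new_set x /\ new_set y.
Proof.
intros HF H. destruct (HF (mk _ (proj1 (valC_new F) _ H)) H) as [a [b E]].
apply is_opair_val, opair_injective in E. destruct E as [-> ->]. split; apply val_new.
Qed.

Lemma swap_opair a b x y x' y' :
  swap a b x x' -> swap a b y y' -> swap a b (opair x y) (opair x' y').
Proof.
intros Hx Hy.
assert (U : forall u v u' v', swap a b u u' -> swap a b v v' -> swap a b (upair u v) (upair u' v')).
{ intros u v u' v' Hu Hv. apply lift_set.
  - exists u. apply mem_upair. auto.
  - exists u'. apply mem_upair. auto.
  - intros z Hz. apply mem_upair in Hz.
    destruct Hz as [-> | ->]; [exists u'|exists v']; rewrite mem_upair; auto.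
  - intros z Hz. apply mem_upair in Hz.
    destruct Hz as [-> | ->]; [exists u|exists v]; rewrite mem_upair; auto. }
apply U; apply U; assumption.
Qed.

(* A urelement [a] outside [E] is exchanged with a fresh urelement
   of its block; this fixes [x], hence also the unique [y] related to it, which
   therefore does not involve [a]. *)
Lemma functional_support (E x : V) (F : V -> V -> Prop) (y : V) :
  small E -> gens E x ->
  (forall u v, F u v -> new_set v) ->
  (forall a b u v u' v', mates a b -> ~ a ∈ E -> ~ b ∈ E ->
     swap a b u u' -> swap a b v v' -> F u v -> F u' v') ->
  (forall z, F x z -> y = z) -> F x y -> gens E y.
Proof.
intros HE Hx HN HF Hfun Hy.
assert (Ny : new_set y) by apply (HN x y Hy).
apply gen_of_avoids; [apply mem_definable|apply new_code, Ny|].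
intros a Ha Na. destruct Ny as [E' [HE' Gy]].
destruct (small_union2 E E' HE HE') as [G [HG [L1 L2]]].
(* [b] is taken outside [E], so that the exchange respects [F] and fixes [x], and outside a support
   [E'] of [y], so that [y] avoids [b]. *)
pose proof Ha as [i Hi]. destruct (fresh_atom i G (proj1 Hi)) as [b [Hb Nb]].
assert (Ab : atom b) by (exists i; exact Hb).
assert (Hab : mates a b).
{ split; [exact Ha|]. split; [exact Ab|]. intro j. split; intro K.
  - rewrite (block_unique _ _ _ K Hi). exact Hb.
  - rewrite (block_unique _ _ _ K Hb). exact Hi. }
assert (Nb' : ~ b ∈ E) by (intro K; apply Nb, L1, K).
destruct (swap_total a b Ha Ab y) as [y' Hyy']; [apply (gens_code E'); assumption|].
assert (Fx : F x y').
{ apply (HF a b x y); try assumption. apply (gens_fix E); assumption. }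
rewrite <- (Hfun y' Fx) in Hyy'.
assert (Gb : avoids b y).
{ revert Gy. apply gen_mono; [apply mem_definable|apply avoid_definable|].
  intros c Hc. split; [apply (small_atoms E' HE' c Hc)|]. intros ->. apply Nb, L2, Hc. }
(* The exchange maps [y], which avoids [b], to itself; so [y] also avoids the image of [b], which is
   [a]. *)
pose proof (swap_gen a b Ha Ab _ y y (avoid_definable b) (fun c K => proj1 K) Gb Hyy') as K.
revert K. pose proof (swap_base_definable a b) as DB. pose proof atom_definable as DA.
apply gen_mono; [def_tac|apply avoid_definable|].
intros d [c [[Hc Ncb] Hcd]]. split.
- destruct (swap_base_cases a b Ha Ab c d Hcd) as [[-> _]|[_ K]]; [destruct (zero_not_atom Hc)|exact K].
- intros ->. destruct Hcd as [[-> _]|[[-> ->]|[[-> _]|[_ [K [_ E0]]]]]].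
  + destruct (zero_not_atom Hc).
  + congruence.
  + congruence.
  + congruence.
Qed.

Lemma extension_replacement (F : cls N) (w : obj N) :
  is_relC F -> (forall x y z, relC F x y -> relC F x z -> y = z) ->
  exists v : obj N, ~ ur v /\ forall y, mem y v <-> exists x, mem x w /\ relC F x y.
Proof.
intros HF Hfun. destruct (val_new w) as [E1 [HE1 Gw]]. destruct (valC_new F) as [_ [E2 [HE2 SF]]].
destruct (small_union2 E1 E2 HE1 HE2) as [E [HE [L1 L2]]].
set (R := fun x y => memC (opair x y) (valC F)).
assert (DR : definable (fun s _ => R (s 1) (s 0))).
{ apply (definable_iff M (fun s _ => relC (valC F) (s 1) (s 0))); [|def_tac].
  intros s t. apply relCE. }
assert (Rfun : forall x y z, R x y -> R x z -> y = z).
{ intros x y z Hy Hz. destruct (relC_components F x y HF Hy) as [Nx Ny].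
  destruct (relC_components F x z HF Hz) as [_ Nz].
  pose proof (Hfun (mk x Nx) (mk y Ny) (mk z Nz)) as K. rewrite !relC_val in K.
  exact (f_equal val (K Hy Hz)). }
destruct (replacement R (val w) DR) as [y Hy]; [eauto|].
destruct (make_set E y HE) as [v [Uv [Hv _]]].
{ intros z Hz. apply Hy in Hz. destruct Hz as [x [Hx Hxz]].
  destruct (relC_components F x z HF Hxz) as [Nx _].
  apply (functional_support E x R); [exact HE| | | |intros z' Hz'; apply (Rfun x); assumption|exact Hxz].
  - apply (gens_mono E1); [exact L1|]. apply (gens_elements E1 (val w) x); try assumption. apply new_code, Nx.
  - intros u v' K. apply (relC_components F u v' HF K).
  - intros a b u v' u' v'' Hab Na Nb Hu Hv' K. apply (SF a b Hab) with (opair u v'); [auto|auto| |exact K].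
    apply swap_opair; assumption. }
exists v. split; [exact Uv|]. intro z. rewrite (Hv z), Hy. split.
- intros [x [Hx K]]. destruct (relC_components F x _ HF K) as [Nx _].
  exists (mk x Nx). split; [exact Hx|]. apply relC_val, K.
- intros [x [Hx K]]. exists (val x). split; [exact Hx|]. apply relC_val, K.
Qed.

Lemma extension_union (x : obj N) :
  exists u : obj N, ~ ur u /\ forall z, mem z u <-> exists y, mem y x /\ mem z y.
Proof.
destruct (val_new x) as [E [HE Gx]].
pose proof gens_definable as DG.
(* Requiring [gens E] of both [v] and [z] discards the elements that [zero] and the urelements have
   only in [M]. *)
destruct (separation (fun z => gens E z /\ exists v, gens E v /\ v ∈ val x /\ z ∈ v) (bigcup (val x)))
  as [y Hy]; [def_tac|].
destruct (make_set E y HE) as [u [Uu [Hu _]]]; [intros z Hz; apply Hy, Hz|].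
exists u. split; [exact Uu|]. intro z. rewrite (Hu z), Hy, mem_bigcup. split.
- intros [[Gz [v [Gv [Hv Hz]]]] _].
  exists (mk v (ex_intro _ E (conj HE Gv))). split; assumption.
- intros [v [Hv Hz]]. pose proof (gens_val_mem E x v HE Gx Hv) as Gv. split; [|exists (val v); auto].
  split; [apply (gens_val_mem E v z HE Gv Hz)|]. exists (val v). auto.
Qed.

Lemma extension_powerset (x : obj N) :
  exists u : obj N, ~ ur u /\ forall z, mem z u <-> ~ ur z /\ is_subset z x.
Proof.
destruct (val_new x) as [E [HE Gx]]. pose proof gens_definable as DG.
(* The bounding set is the power set in [M] with [zero] added, because [zero] codes the empty
   subset. *)
destruct (separation (fun z => z = zero \/ ((exists w, w ∈ z) /\ forall w, w ∈ z -> gens E w /\ w ∈ val x))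
  (bigcup (upair (power (val x)) (upair zero zero)))) as [y Hy]; [def_tac|].
destruct (make_set E y HE) as [u [Uu [Hu _]]].
{ intros z Hz. apply Hy in Hz. destruct Hz as [[->|[H K]] _]; [apply gen_zero|].
  apply gen_set; [exact H|]. intros w Hw. apply K, Hw. }
exists u. split; [exact Uu|]. intro z. rewrite (Hu z), Hy. split.
- intros [[Ez|[[w0 Hw0] K]] _].
  + split; [change (~ atom (val z)); rewrite Ez; apply zero_not_atom|].
    intros w Hw. change (val w ∈ val z) in Hw. rewrite Ez in Hw.
    destruct (not_code_zero _ Hw (val_code w)).
  + split.
    * intro A. apply (not_code_atom (val z) w0 A Hw0). apply (gens_code E); [exact HE|apply K, Hw0].
    * intros w Hw. apply K, Hw.
- intros [Uz Hz]. destruct (set_cases z Uz) as [Ez|[Nz Kz]].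
  + split; [auto|]. rewrite Ez. apply mem_bigcup. exists (upair zero zero). rewrite !mem_upair. auto.
  + assert (K : forall w, w ∈ val z -> gens E w /\ w ∈ val x).
    { intros w Hw. pose proof (Hz (mk w (Kz w Hw)) Hw) as Hwx. split; [|exact Hwx].
      apply (gens_val_mem E x (mk w (Kz w Hw)) HE Gx Hwx). }
    split; [auto|]. apply mem_bigcup. exists (power (val x)). split; [apply mem_upair; auto|].
    apply mem_power. intros w Hw. apply K, Hw.
Qed.

Lemma extension_separation (X : cls N) (x : obj N) :
  exists y : obj N, ~ ur y /\ forall z, mem z y <-> memC z X /\ mem z x.
Proof.
destruct (val_new x) as [E [HE Gx]]. pose proof gens_definable as DG.
destruct (separation (fun z => gens E z /\ memC z (valC X)) (val x)) as [y Hy]; [def_tac|].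
destruct (make_set E y HE) as [u [Uu [Hu _]]]; [intros z Hz; apply Hy, Hz|].
exists u. split; [exact Uu|]. intro z. rewrite (Hu z), Hy. split.
- intros [[_ H] H']. split; assumption.
- intros [H H']. split; [split; [apply (gens_val_mem E x z HE Gx H')|exact H]|exact H'].
Qed.

Lemma extension_foundation (x : obj N) :
  (exists y, mem y x) -> exists y, mem y x /\ forall z, mem z x -> ~ mem z y.
Proof.
intros [y0 Hy0]. destruct (foundation (val x)) as [y [Hy K]]; [exists (val y0); exact Hy0|].
exists (mk y (nonempty_elements x y0 Hy0 y Hy)). split; [exact Hy|]. intros z Hz. apply K, Hz.
Qed.

Definition inclusion (x : V) : obj N := mk (embed x) (new_embed x).

Lemma embed_elements (z : obj N) (y : V) : val z ∈ embed y -> exists x, x ∈ y /\ z = inclusion x.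
Proof.
intro H. destruct (classic (y = empty)) as [->|Ny].
- rewrite embed_empty in H. destruct (not_code_zero _ H (val_code z)).
- apply (mem_embed y _ Ny) in H. destruct H as [x [Hx E]]. exists x. split; [exact Hx|].
  apply val_injective, E.
Qed.

Lemma mem_inclusion x y : mem (inclusion x) (inclusion y) <-> x ∈ y.
Proof. apply mem_embed_embed. Qed.

(** A pure code is generated from no urelements at all, whereas a urelement generated from a class
    of urelements belongs to that class. *)
Lemma inclusion_set x : ~ ur (inclusion x).
Proof.
intro A. change (atom (embed x)) in A.
assert (G : gen (fun _ => False) (embed x)) by (apply gen_embed; def_tac).
apply gen_atom in G; [exact G|def_tac|tauto|exact A].
Qed.

Lemma extension_infinity : exists x : obj N,
  (exists y, mem y x /\ ~ ur y /\ forall z, ~ mem z y) /\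
  forall y, mem y x -> exists z, mem z x /\ is_succ z y.
Proof.
destruct infinity_ax as [I [[e [He1 He2]] HI]]. exists (inclusion I). split.
- exists (inclusion e). split; [apply mem_inclusion, He1|]. split; [apply inclusion_set|].
  intros z Hz. destruct (embed_elements z e Hz) as [x [Hx _]]. apply (He2 x Hx).
- intros y Hy. destruct (embed_elements y I Hy) as [n [Hn ->]].
  destruct (HI n Hn) as [n' [Hn' Hs]]. exists (inclusion n'). split; [apply mem_inclusion, Hn'|].
  intro z. split.
  + intro Hz. destruct (embed_elements z n' Hz) as [m [Hm ->]]. apply Hs in Hm.
    destruct Hm as [Hm| ->]; [left; apply mem_inclusion, Hm|right; reflexivity].
  + intros [Hz| ->]; [|apply mem_inclusion, Hs; auto].
    destruct (embed_elements z n Hz) as [m [Hm ->]]. apply mem_inclusion, Hs. auto.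
Qed.

Lemma extension_choice (x : obj N) : exists r : obj N, ~ ur r /\ well_orders r x.
Proof.
destruct (val_new x) as [E [HE Gx]]. destruct (well_order_set (val x)) as [r [W1 [W2 [W3 W4]]]].
pose proof gens_definable as DG.
(* The well-order given by [M] may contain arbitrary further elements; keeping only pairs generated
   from [E] makes it an object of the extension. *)
destruct (separation (fun p => exists a b, p = opair a b /\ gens E a /\ gens E b) r) as [y Hy]; [def_tac|].
destruct (make_set E y HE) as [r' [Ur [Hr _]]].
{ intros z Hz. apply Hy in Hz. destruct Hz as [[a [b [-> [Ha Hb]]]] _].
  assert (U : forall u v, gens E u -> gens E v -> gens E (upair u v)).
  { intros u v Hu Hv. apply gen_set; [exists u; apply mem_upair; auto|].
    intros w Hw. apply mem_upair in Hw. destruct Hw as [-> | ->]; assumption. }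
  apply U; apply U; assumption. }
assert (Er : forall a b : obj N, mem a x -> mem b x -> rel r' a b <-> rel r (val a) (val b)).
{ intros a b Ha Hb. rewrite rel_val, relE. change (mem (npair a b) r' <-> opair (val a) (val b) ∈ r).
  rewrite (Hr (npair a b)), Hy. split; [tauto|]. intro H. split; [|exact H].
  exists (val a), (val b). split; [reflexivity|].
  split; [apply (gens_val_mem E x a HE Gx Ha)|apply (gens_val_mem E x b HE Gx Hb)]. }
exists r'. split; [exact Ur|]. split; [|split; [|split]].
- intros a Ha H. apply Er in H; try assumption. apply (W1 (val a) Ha H).
- intros a b c Ha Hb Hc Hab Hbc. apply Er in Hab, Hbc; try assumption. apply Er; try assumption.
  apply (W2 _ (val b)); assumption.
- intros a b Ha Hb. rewrite !Er by assumption.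
  destruct (W3 (val a) (val b) Ha Hb) as [H|[H|H]]; auto. right. left. apply val_injective, H.
- intros s Hs [a0 Ha0]. pose proof (nonempty_elements s a0 Ha0) as Ns.
  destruct (W4 (val s)) as [a [Ha Hmin]].
  + intros z Hz. apply (Hs (mk z (Ns z Hz)) Hz).
  + exists (val a0). exact Ha0.
  + exists (mk a (Ns a Ha)). split; [exact Ha|]. intros b Hb.
    destruct (Hmin (val b) Hb) as [H|H]; [left; apply val_injective, H|right].
    apply Er; [apply Hs, Ha|apply Hs, Hb|exact H].
Qed.

Lemma extension_models : models N (extend KMU_R ax_choice).
Proof.
intros a [H| ->]; [destruct H as [a H| | |a]; [destruct H|..]|]; intros s t.
- intros x y Hx Hy. exact (not_code_atom _ _ Hx Hy (val_code y)).
- intros x y Hx Hy H. apply extension_extensionality; assumption.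
- exact extension_foundation.
- intros x y. destruct (extension_pairing x y) as [v [Hv _]]. exists v. exact Hv.
- intros x _. exact (extension_union x).
- intros x _. exact (extension_powerset x).
- exact extension_infinity.
- intros X x _. exact (extension_separation X x).
- intros X Y H. exact (extension_class_ext X Y H).
- intros F [HF Hfun] w _. exact (extension_replacement F w HF Hfun).
- apply extension_comprehension.
- intros x _. exact (extension_choice x).
Qed.
End SetTheory.

(** * Dependent choice in the ground model *)

Section Recursion.
Context {M : structure} {HM : ground M}.
Notation V := (obj M).
Notation "x ∈ y" := (@mem M x y) (at level 70).
Notation "x ⊆ y" := (@is_subset M x y) (at level 70).

Variable D : V.
Hypothesis Dtrans : forall a b c, a ∈ D -> b ∈ D -> c ∈ D -> c ∈ b -> b ∈ a -> c ∈ a.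
Variable C : V -> Prop.
Hypothesis HC : definable (fun s _ => C (s 0)).

(** Elements of [D] may have elements outside [D], hence the intersection: in the application [zero]
    can occur in [D], and its element [empty] does not. *)
Definition seg (a e : V) : Prop := forall b, b ∈ e <-> b ∈ D /\ b ∈ a.

Definition initial (e : V) : Prop :=
  e ⊆ D /\ forall b c, b ∈ e -> c ∈ D -> c ∈ b -> c ∈ e.

Definition sequence (e f : V) : Prop :=
  (forall p, p ∈ f -> exists b y, b ∈ e /\ C y /\ p = opair b y) /\
  (forall b, b ∈ e -> exists y, rel f b y) /\
  (forall b y y', rel f b y -> rel f b y' -> y = y').

Definition restr (f a g : V) : Prop :=
  forall p, p ∈ g <-> p ∈ f /\ exists b y, b ∈ D /\ b ∈ a /\ p = opair b y.

Definition good (q : V -> V -> Prop) (e f : V) : Prop :=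
  sequence e f /\ forall a, a ∈ e -> exists g y, restr f a g /\ rel f a y /\ q g y.

Lemma seg_exists a : exists e, seg a e.
Proof.
destruct (separation (fun b => b ∈ a) D) as [e He]; [def_tac|].
exists e. intro b. rewrite (He b). tauto.
Qed.

Lemma seg_initial a e : a ∈ D -> seg a e -> initial e.
Proof.
intros Ha He. split.
- intros b Hb. apply He, Hb.
- intros b c Hb Hc Hcb. apply He in Hb. apply He. split; [exact Hc|].
  apply (Dtrans a b c); tauto.
Qed.

Lemma seg_unique a e e' : seg a e -> seg a e' -> e = e'.
Proof. intros H H'. apply ext. intro b. rewrite (H b), (H' b). tauto. Qed.

Lemma sequence_dom e f b y : sequence e f -> rel f b y -> b ∈ e /\ C y.
Proof.
intros [H _] K. apply relE in K. destruct (H _ K) as [b' [y' [Hb [Hy E]]]].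
apply opair_injective in E. destruct E as [-> ->]. auto.
Qed.

Lemma restr_rel f a g b y : restr f a g -> rel g b y <-> rel f b y /\ b ∈ D /\ b ∈ a.
Proof.
intro H. rewrite !relE, (H (opair b y)). split.
- intros [K [b' [y' [H1 [H2 E]]]]]. apply opair_injective in E. destruct E as [-> ->]. auto.
- intros [K [H1 H2]]. split; [exact K|]. exists b, y. auto.
Qed.

Lemma good_mono (q q' : V -> V -> Prop) e f :
  (forall g y, q g y -> q' g y) -> good q e f -> good q' e f.
Proof.
intros H [Hs K]. split; [exact Hs|]. intros a Ha. destruct (K a Ha) as [g [y [H1 [H2 H3]]]].
exists g, y. auto.
Qed.

Lemma good_restr q e f a b g :
  initial e -> good q e f -> a ∈ e -> seg a b -> restr f a g -> good q b g.
Proof.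
intros [He He'] [[S1 [S2 S3]] K] Ha Hb Hg.
assert (Hbe : forall c, c ∈ b -> c ∈ e).
{ intros c Hc. apply Hb in Hc. apply (He' a c); tauto. }
split; [split; [|split]|].
- intros p Hp. apply Hg in Hp. destruct Hp as [Hp [c [y [H1 [H2 ->]]]]].
  destruct (S1 _ Hp) as [c' [y' [_ [Hy E]]]]. apply opair_injective in E. destruct E as [-> ->].
  exists c', y'. split; [apply Hb; auto|auto].
- intros c Hc. destruct (S2 c (Hbe c Hc)) as [y Hy]. exists y.
  apply (restr_rel f a g c y Hg). split; [exact Hy|]. apply Hb, Hc.
- intros c y y' H H'. apply (restr_rel f a g _ _ Hg) in H, H'. apply (S3 c); tauto.
- intros c Hc. destruct (K c (Hbe c Hc)) as [h [y [H1 [H2 H3]]]]. pose proof (proj1 (Hb c) Hc) as [HcD Hca].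
  exists h, y. split; [|split; [apply (restr_rel f a g c y Hg); auto|exact H3]].
  intro p. rewrite (H1 p), (Hg p). split; [|tauto].
  intros [Hp [d [z [Hd [Hdc ->]]]]]. split; [split; [exact Hp|]|]; exists d, z; [|auto].
  split; [exact Hd|]. split; [|reflexivity]. apply (Dtrans a c d); auto.
Qed.

Section Candidates.
Variable q : V -> V -> Prop.
Hypothesis Hq : definable (fun s _ => q (s 1) (s 0)).

Lemma good_definable : definable (fun s _ => good q (s 1) (s 0)).
Proof. unfold good, sequence, restr. def_tac. Qed.

Hypothesis qset : forall g, exists Y, forall y, y ∈ Y <-> q g y.

Lemma candidates_bound e :
  initial e -> (forall a b, a ∈ e -> seg a b -> exists S, forall f, good q b f -> f ∈ S) ->
  exists U, forall a b g y, a ∈ e -> seg a b -> good q b g -> q g y -> y ∈ U.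
Proof.
intros He H. pose proof good_definable as DG.
destruct (replacement (fun a S => exists b, seg a b /\ forall f, f ∈ S <-> good q b f) e) as [u Hu].
{ unfold seg. def_tac. }
{ intros a S S' _ [b [Hb HS]] [b' [Hb' HS']]. rewrite (seg_unique a b' b Hb' Hb) in HS'.
  apply ext. intro f. rewrite (HS f), (HS' f). tauto. }
destruct (replacement (fun g Y => forall y, y ∈ Y <-> q g y) (bigcup u)) as [v Hv]; [def_tac|..].
{ intros g Y Y' _ H1 H2. apply ext. intro y. rewrite (H1 y), (H2 y). tauto. }
exists (bigcup v). intros a b g y Ha Hb Hg Hy.
destruct (H a b Ha Hb) as [S HS]. destruct (separation (good q b) S) as [S' HS']; [def_tac|].
destruct (qset g) as [Y HY].
apply mem_bigcup. exists Y. split; [|apply HY, Hy]. apply Hv. exists g. split; [|exact HY].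
apply mem_bigcup. exists S'. split.
- apply Hu. exists a. split; [exact Ha|]. exists b. split; [exact Hb|].
  intro f. rewrite (HS' f). split; [tauto|]. auto.
- apply HS'. auto.
Qed.

(** By [good_restr], each value of a good sequence is a candidate after a good sequence on a shorter
    segment, so the whole sequence is a subset of e × U. *)
Lemma good_bound e :
  initial e -> (forall a b, a ∈ e -> seg a b -> exists S, forall f, good q b f -> f ∈ S) ->
  exists S, forall f, good q e f -> f ∈ S.
Proof.
intros He H. destruct (candidates_bound e He H) as [U HU].
(* Pairs over the union of [e] and [U] lie in its double power set, and [f] is a set of such
   pairs. *)
exists (power (power (power (bigcup (upair e U))))). intros f Hf.
apply mem_power. intros p Hp. pose proof Hf as [Hs K].
destruct (proj1 Hs p Hp) as [b [y [Hb [_ ->]]]].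
assert (Hy : y ∈ U).
{ destruct (K b Hb) as [g [y' [Hg [Hy' Hq']]]]. destruct (seg_exists b) as [d Hd].
  rewrite (proj2 (proj2 Hs) b y y'); [|apply relE, Hp|exact Hy'].
  apply (HU b d g y' Hb Hd); [|exact Hq']. apply (good_restr q e f b); assumption. }
assert (L : b ∈ bigcup (upair e U)) by (apply mem_bigcup; exists e; rewrite mem_upair; auto).
assert (R : y ∈ bigcup (upair e U)) by (apply mem_bigcup; exists U; rewrite mem_upair; auto).
apply mem_power. intros z Hz. apply mem_power. intros w Hw.
apply mem_opair in Hz. destruct Hz as [-> | ->]; apply mem_upair in Hw; destruct Hw as [-> | ->]; assumption.
Qed.

Lemma candidates_set :
  exists U, forall a b g y, a ∈ D -> seg a b -> good q b g -> q g y -> y ∈ U.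
Proof.
pose proof good_definable as DG.
apply candidates_bound.
- split; [intros b Hb; exact Hb|auto].
- cut (forall a, a ∈ D -> forall b, seg a b -> exists S, forall f, good q b f -> f ∈ S); [eauto|].
  apply (mem_ind (fun a => a ∈ D -> forall b, seg a b -> exists S, forall f, good q b f -> f ∈ S)).
  + unfold seg. def_tac.
  + intros a IH Ha b Hb. apply good_bound; [apply (seg_initial a b Ha Hb)|].
    intros c d Hc Hd. apply Hb in Hc. apply (IH c); tauto.
Qed.

Hypothesis qC : forall g y, q g y -> C y.
Hypothesis qex : forall a b g, a ∈ D -> seg a b -> good q b g -> exists y, q g y.
Hypothesis qfun : forall a b g y y', a ∈ D -> seg a b -> good q b g -> q g y -> q g y' -> y = y'.

Lemma good_unique e f f' : initial e -> good q e f -> good q e f' -> f = f'.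
Proof.
intros He Hf Hf'. pose proof Hf as [[S1 [S2 S3]] K]. pose proof Hf' as [[S1' [S2' S3']] K'].
assert (E : forall b, b ∈ e -> forall y y', rel f b y -> rel f' b y' -> y = y').
{ apply (mem_ind (fun b => b ∈ e -> forall y y', rel f b y -> rel f' b y' -> y = y')); [def_tac|].
  intros b IH Hb y y' Hy Hy'.
  destruct (K b Hb) as [g [z [Hg [Hz Q]]]], (K' b Hb) as [g' [z' [Hg' [Hz' Q']]]].
  assert (Eg : g = g').
  { apply ext. intro p. rewrite (Hg p), (Hg' p).
    split; intros [Hp [c [x [Hc [Hcb ->]]]]]; (split; [|exists c, x; auto]);
      assert (Hce : c ∈ e) by (apply (proj2 He b c); assumption); apply relE; apply relE in Hp.
    - destruct (S2' c Hce) as [x' Hx']. rewrite (IH c Hcb Hce x x' Hp Hx'). exact Hx'.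
    - destruct (S2 c Hce) as [x' Hx']. rewrite <- (IH c Hcb Hce x' x Hx' Hp). exact Hx'. }
  subst g'. rewrite (S3 b y z Hy Hz), (S3' b y' z' Hy' Hz').
  destruct (seg_exists b) as [d Hd]. apply (qfun b d g); try assumption.
  - apply (proj1 He), Hb.
  - apply (good_restr q e f b); assumption. }
apply ext. intro p. split; intro Hp.
- destruct (S1 p Hp) as [b [y [Hb [_ ->]]]]. destruct (S2' b Hb) as [y' Hy'].
  rewrite (E b Hb y y'); [apply relE; exact Hy'|apply relE; exact Hp|exact Hy'].
- destruct (S1' p Hp) as [b [y [Hb [_ ->]]]]. destruct (S2 b Hb) as [y' Hy'].
  rewrite <- (E b Hb y' y); [apply relE; exact Hy'|exact Hy'|apply relE; exact Hp].
Qed.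

(** The value at [a] is the successor of the unique good sequence [g] on the segment of [a].
    Uniqueness makes these sequences cohere, so the glued set restricted below [a] is [g] itself and
    the condition on [q] carries over. *)
Lemma good_step e :
  initial e -> (forall a b, a ∈ e -> seg a b -> exists f, good q b f) -> exists f, good q e f.
Proof.
intros He H. pose proof good_definable as DG.
assert (seq_fun : forall a b g y b' g' y', a ∈ D -> seg a b -> good q b g -> q g y ->
  seg a b' -> good q b' g' -> q g' y' -> g = g' /\ y = y').
{ intros a b g y b' g' y' Ha Hb Hg Hy Hb' Hg' Hy'.
  rewrite (seg_unique a b' b Hb' Hb) in Hg'.
  assert (Eg : g = g') by (apply (good_unique b); [apply (seg_initial a)| |]; assumption).
  subst g'. split; [reflexivity|]. apply (qfun a b g); assumption. }
destruct (replacement (fun a p => exists b g y, seg a b /\ good q b g /\ q g y /\ p = opair a y) e)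
  as [f Hf].
{ unfold seg. def_tac. }
{ intros a p p' Ha [b [g [y [Hb [Hg [Hy ->]]]]]] [b' [g' [y' [Hb' [Hg' [Hy' ->]]]]]].
  f_equal. apply (seq_fun a b g y b' g' y'); try assumption. apply (proj1 He), Ha. }
assert (Rf : forall a y, rel f a y <-> a ∈ e /\ exists b g, seg a b /\ good q b g /\ q g y).
{ intros a y. rewrite relE, (Hf (opair a y)). split.
  - intros [a' [Ha [b [g [y' [Hb [Hg [Hy E]]]]]]]]. apply opair_injective in E. destruct E as [-> ->].
    split; [exact Ha|]. exists b, g. auto.
  - intros [Ha [b [g [Hb [Hg Hy]]]]]. exists a. split; [exact Ha|]. exists b, g, y. auto. }
exists f. split; [split; [|split]|].
- intros p Hp. apply Hf in Hp. destruct Hp as [a [Ha [b [g [y [_ [_ [Hy ->]]]]]]]].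
  exists a, y. split; [exact Ha|]. split; [apply (qC g y Hy)|reflexivity].
- intros a Ha. destruct (seg_exists a) as [b Hb]. destruct (H a b Ha Hb) as [g Hg].
  destruct (qex a b g (proj1 He a Ha) Hb Hg) as [y Hy]. exists y. apply Rf. split; [exact Ha|]. exists b, g. auto.
- intros a y y' Hy Hy'. apply Rf in Hy, Hy'.
  destruct Hy as [Ha [b [g [Hb [Hg Q]]]]], Hy' as [_ [b' [g' [Hb' [Hg' Q']]]]].
  apply (seq_fun a b g y b' g' y'); try assumption. apply (proj1 He), Ha.
- intros a Ha. destruct (seg_exists a) as [b Hb]. destruct (H a b Ha Hb) as [g Hg].
  pose proof (proj1 He a Ha) as HaD.
  destruct (qex a b g HaD Hb Hg) as [y Hy]. exists g, y.
  split; [|split; [apply Rf; split; [exact Ha|]; exists b, g; auto|exact Hy]].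
  pose proof Hg as [[S1 [S2 S3]] K]. pose proof (seg_initial a b HaD Hb) as Ib.
  assert (sub : forall c, c ∈ b -> exists d h z, seg c d /\ good q d h /\ q h z /\ rel g c z).
  { intros c Hc. destruct (K c Hc) as [h [z [Hh [Hz Q]]]]. destruct (seg_exists c) as [d Hd].
    exists d, h, z. split; [exact Hd|]. split; [apply (good_restr q b g c); assumption|auto]. }
  intro p. split.
  + intro Hp. destruct (S1 p Hp) as [c [z [Hc [_ ->]]]]. pose proof (proj1 (Hb c) Hc) as [HcD Hca].
    split; [|exists c, z; auto]. apply relE, Rf. split; [apply (proj2 He a c); assumption|].
    destruct (sub c Hc) as [d [h [z' [Hd [Hh [Q Hz']]]]]]. exists d, h.
    split; [exact Hd|]. split; [exact Hh|]. rewrite (S3 c z z'); [exact Q|apply relE; exact Hp|exact Hz'].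
  + intros [Hp [c [z [HcD [Hca ->]]]]]. apply relE, Rf in Hp. destruct Hp as [_ [d [h [Hd [Hh Q]]]]].
    assert (Hc : c ∈ b) by (apply Hb; auto).
    destruct (sub c Hc) as [d' [h' [z' [Hd' [Hh' [Q' Hz']]]]]].
    destruct (seq_fun c d h z d' h' z' HcD Hd Hh Q Hd' Hh' Q') as [_ ->]. apply relE, Hz'.
Qed.

Lemma good_exists : exists f, good q D f.
Proof.
pose proof good_definable as DG.
apply good_step.
- split; [intros b Hb; exact Hb|auto].
- cut (forall a, a ∈ D -> forall b, seg a b -> exists f, good q b f); [eauto|].
  apply (mem_ind (fun a => a ∈ D -> forall b, seg a b -> exists f, good q b f)).
  + unfold seg. def_tac.
  + intros a IH Ha b Hb. apply good_step; [apply (seg_initial a b Ha Hb)|].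
    intros c d Hc Hd. apply Hb in Hc. apply (IH c); tauto.
Qed.
End Candidates.

(* The choices are restricted to successors of least rank: then the sequences of
   candidates form a set, and a well-order of that set selects one of them. *)
Lemma dependent_choice (Q : V -> V -> Prop) :
  definable (fun s _ => Q (s 1) (s 0)) ->
  (forall a e g, a ∈ D -> seg a e -> sequence e g -> exists y, C y /\ Q g y) ->
  exists f, good Q D f.
Proof.
intros HQ Hex. pose proof (level_definable (M := M)) as DL.
set (q := fun g => minrank (fun y => C y /\ Q g y)).
assert (Dq0 : forall g, definable (fun s _ => C (s 0) /\ Q g (s 0))) by (intro g; def_tac).
assert (Dq : definable (fun s _ => q (s 1) (s 0))).
{ unfold q, minrank, is_subset. def_tac. }
assert (Dqg : forall g, definable (fun s _ => q g (s 0))) by (intro g; def_tac).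
(* [U] must bound the successors along all sequences good for the many-valued [q]: the selection [c]
   is defined from a well-order of [U], so the bound cannot refer to [c]. *)
destruct (candidates_set q Dq) as [U HU].
{ intro g. apply minrank_set, Dq0. }
destruct (well_order_set U) as [r Hr].
set (c := fun g => least r (q g)).
assert (Dc : definable (fun s _ => c (s 1) (s 0))).
{ unfold c, least. def_tac. }
assert (cq : forall g y, c g y -> q g y) by (intros g y H; apply H).
assert (qC : forall g y, q g y -> C y /\ Q g y) by (intros g y H; apply H).
assert (HUc : forall a b g y, a ∈ D -> seg a b -> good c b g -> q g y -> y ∈ U).
{ intros a b g y Ha Hb Hg. apply (HU a b g y Ha Hb). apply (good_mono c q); assumption. }
destruct (good_exists c Dc) as [f Hf].
- intros g y H. apply (qC g y), cq, H.
- intros a b g Ha Hb Hg. apply (least_exists r U); [apply Dqg|exact Hr| |].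
  + intros y Hy. apply (HUc a b g); assumption.
  + apply minrank_exists; [apply Dq0|]. apply (Hex a b); [assumption|assumption|apply Hg].
- intros a b g y y' Ha Hb Hg Hy Hy'. apply (least_unique r U (q g)); try assumption.
  intros z Hz. apply (HUc a b g); assumption.
- exists f. apply (good_mono c Q); [|exact Hf]. intros g y H. apply (qC g y), cq, H.
Qed.
End Recursion.

(** * Cardinals, dependent choice and Collection in the extension *)

Section Cardinal.
Context {M : structure} {HM : ground M} {HS : setting M}.
Notation V := (obj M).
Notation "x ∈ y" := (@mem M x y) (at level 70).
Notation N := (@extension M HM HS).

Lemma inclusion_injective x y : inclusion x = inclusion y -> x = y.
Proof. intro H. apply embed_injective. exact (f_equal val H). Qed.

Lemma inclusion_embedding : transitive_embedding M N inclusion.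
Proof.
split.
- intro x. split; intro H; [destruct (inclusion_set x H)|destruct (no_ur x H)].
- exact mem_inclusion.
- intros z y H. destruct (embed_elements z y H) as [x [_ E]]. exists x. exact E.
Qed.

(** An ordinal is defined as transitive and linear; its elements are transitive because the other
    two outcomes of comparing [c] with [a] close a membership cycle of length two or three. *)
Lemma ordinal_transitive (k a b c : V) :
  is_ordinal k -> a ∈ k -> b ∈ a -> c ∈ b -> c ∈ a.
Proof.
intros [_ [T L]] Ha Hb Hc.
assert (Hbk : b ∈ k) by (apply (T a Ha), Hb). assert (Hck : c ∈ k) by (apply (T b Hbk), Hc).
destruct (L c a Hck Ha) as [H|[H|H]]; [exact H| |].
- subst c. destruct (mem_asym a b Hc Hb).
- destruct (foundation (bigcup (upair (upair a b) (upair c c)))) as [m [Hm K]].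
  + exists a. apply mem_bigcup. exists (upair a b). rewrite !mem_upair. auto.
  + assert (I : forall x, x ∈ bigcup (upair (upair a b) (upair c c)) <-> x = a \/ x = b \/ x = c).
    { intro x. rewrite mem_bigcup. split.
      - intros [y [Hy Hx]]. apply mem_upair in Hy. destruct Hy as [-> | ->]; apply mem_upair in Hx; tauto.
      - intros [->|[->| ->]]; [exists (upair a b)|exists (upair a b)|exists (upair c c)];
          rewrite !mem_upair; auto. }
    apply I in Hm. destruct Hm as [->|[->| ->]].
    * destruct (K b); [apply I; auto|exact Hb].
    * destruct (K c); [apply I; auto|exact Hc].
    * destruct (K a); [apply I; auto|exact H].
Qed.

Lemma inclusion_ordinal k : is_ordinal k -> is_ordinal (inclusion k).
Proof.
intros [_ [T L]]. split; [apply inclusion_set|]. split.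
- intros y Hy. destruct (embed_elements y k Hy) as [a [Ha ->]]. split; [apply inclusion_set|].
  intros z Hz. destruct (embed_elements z a Hz) as [b [Hb ->]]. apply mem_inclusion, (T a Ha), Hb.
- intros y z Hy Hz. destruct (embed_elements y k Hy) as [a [Ha ->]], (embed_elements z k Hz) as [b [Hb ->]].
  rewrite !mem_inclusion. destruct (L a b Ha Hb) as [H|[H|H]]; auto. right. left. congruence.
Qed.

Lemma inclusion_finite k : is_finite_ord (inclusion k) -> is_finite_ord k.
Proof.
intros H y Hy. destruct (H (inclusion y)) as [K|[z [Hz K]]].
- destruct Hy as [->|Hy]; [left; reflexivity|right; apply mem_inclusion, Hy].
- left. intros z Hz. apply (K (inclusion z)), mem_inclusion, Hz.
- right. destruct (embed_elements z y Hz) as [a [Ha ->]]. exists a. split; [exact Ha|].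
  intro w. rewrite <- (mem_inclusion w y), <- (mem_inclusion w a), (K (inclusion w)).
  split; (intros [L|L]; [left; exact L|right]); [apply inclusion_injective, L|congruence].
Qed.

(** Only a new bijection could collapse a cardinal. But [f] is represented by a set of [M] whose
    pairs have pure components, so it is pulled back along [embed]. *)
Lemma inclusion_bij (a k : V) (f : obj N) :
  is_bij f (inclusion a) (inclusion k) -> exists g, is_bij g a k.
Proof.
intros [[_ [_ [F1 F2]]] [F3 F4]]. pose proof pure_definable as DP.
destruct (replacement (fun x p => exists y u v, y ∈ k /\ u = embed x /\ v = embed y /\
    rel (val f) u v /\ p = opair x y) a) as [g Hg].
{ def_tac. }
{ intros x p p' _ [y [u [v [_ [-> [-> [H ->]]]]]]] [y' [u' [v' [_ [-> [-> [H' ->]]]]]]].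
  f_equal. apply inclusion_injective, (F1 (inclusion x)); apply rel_val, relE; assumption. }
assert (E : forall x y, rel g x y <-> x ∈ a /\ y ∈ k /\ rel f (inclusion x) (inclusion y)).
{ intros x y. rewrite relE, (Hg (opair x y)). split.
  - intros [x' [Hx [y' [u [v [Hy [-> [-> [H Ep]]]]]]]]]. apply opair_injective in Ep. destruct Ep as [-> ->].
    split; [exact Hx|]. split; [exact Hy|]. apply rel_val, relE, H.
  - intros [Hx [Hy H]]. exists x. split; [exact Hx|]. exists y, (embed x), (embed y).
    split; [exact Hy|]. repeat split. apply relE. apply rel_val in H. exact H. }
exists g. split; [split; [apply no_ur|split; [|split]]|split].
- intros p Hp. apply Hg in Hp. destruct Hp as [x [_ [y [u [v [_ [_ [_ [_ ->]]]]]]]]].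
  exists x, y. apply is_opairE. reflexivity.
- intros x y z H H'. apply E in H, H'. apply inclusion_injective, (F1 (inclusion x)); tauto.
- intro x. split.
  + intro Hx. destruct (proj1 (F2 (inclusion x)) (proj2 (mem_inclusion x a) Hx)) as [v Hv].
    assert (Hk : mem v (inclusion k)) by (apply F4; eauto).
    destruct (embed_elements v k Hk) as [y [Hy ->]]. exists y. apply E. auto.
  + intros [y H]. apply E in H. tauto.
- intros x y z H H'. apply E in H, H'. apply inclusion_injective, (F3 _ _ (inclusion z)); tauto.
- intro y. split.
  + intro Hy. destruct (proj1 (F4 (inclusion y)) (proj2 (mem_inclusion y k) Hy)) as [u Hu].
    assert (Ha : mem u (inclusion a)) by (apply F2; eauto).
    destruct (embed_elements u a Ha) as [x [Hx ->]]. exists x. apply E. auto.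
  + intros [x H]. apply E in H. tauto.
Qed.

Lemma inclusion_cardinal k :
  holds_at M (fInfCardinal 0) k -> holds_at N (fInfCardinal 0) (inclusion k).
Proof.
intros H s t. destruct (cls_inhabited M) as [X].
destruct (proj1 (sat_inf_cardinal M _ _ 0) (H (fun _ => k) (fun _ => X))) as [H1 [H2 H3]].
apply sat_inf_cardinal. split; [apply inclusion_ordinal, H1|]. split.
- intro K. apply H2, inclusion_finite, K.
- intros y Hy [f Hf]. destruct (embed_elements y k Hy) as [a [Ha ->]].
  apply (H3 a Ha). apply (inclusion_bij a k f), Hf.
Qed.

Lemma extension_not_collection : ~ holds N ax_collection.
Proof.
intro H. destruct (cls_inhabited N) as [X0].
pose proof (proj1 (sat_collection N (fun _ => inclusion empty) (fun _ => X0)) (H _ _)) as Coll.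
clear H. pose proof block_definable as DB.
destruct (classes (fun p => exists i a, p = opair i a /\ block i a)) as [R HR]; [def_tac|].
assert (Hi : forall i a, block i a -> new_set i /\ new_set a).
{ intros i a Hia. split; [|apply new_atom; exists i; exact Hia].
  pose proof (proj1 Hia) as K. apply (new_elements index i); try exact K.
  - apply new_embed.
  - unfold index in K. apply mem_embed in K.
    + destruct K as [x [_ ->]]. apply new_code, new_embed.
    + intro E. apply (mem_empty bulk). rewrite <- E. apply mem_power. auto. }
assert (HRn : new_class R).
{ split.
  - intros p Hp. apply HR in Hp. destruct Hp as [i [a [-> Hia]]]. destruct (Hi i a Hia) as [Ni Na].
    apply (new_opair (mk i Ni) (mk a Na)).
  (* The empty set supports [R]: an exchange within a block fixes the pure index and keeps the
     urelement in its block. *)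
  - exists empty. split; [apply small_empty|]. intros a b Hab _ _ p p' Hpp' Hp.
    pose proof Hab as [Ha [Hb Hblock]].
    apply HR in Hp. destruct Hp as [i [c [-> Hic]]].
    assert (Ac : atom c) by (exists i; exact Hic).
    destruct (swap_total a b Ha Hb c) as [c' Hc']; [apply gen_base, Ac|].
    assert (Hii : swap a b i i).
    { apply (gens_fix empty); [apply small_empty|apply mem_empty|apply mem_empty|].
      pose proof (proj1 Hic) as K. unfold index in K. apply mem_embed in K.
      - destruct K as [x [_ ->]]. apply gen_embed, mem_definable.
      - intro E. apply (mem_empty bulk). rewrite <- E. apply mem_power. auto. }
    apply HR. exists i, c'. split; [|apply (swap_block a b Ha Hb i c c'); assumption].
    apply (swap_functional a b Ha Hb (opair i c)); [exact Hpp'|].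
    apply swap_opair; assumption. }
set (RN := exist _ R HRn : cls N).
assert (ERN : forall x y : obj N, relC RN x y <-> block (val x) (val y)).
{ intros x y. rewrite relC_val. change (memC (opair (val x) (val y)) R <-> block (val x) (val y)).
  rewrite HR. split.
  - intros [i [a [E K]]]. apply opair_injective in E. destruct E as [-> ->]. exact K.
  - intro K. exists (val x), (val y). auto. }
destruct (Coll RN) with (w := inclusion (power bulk)) as [v [_ Hv]].
- intros p Hp. change (memC (val p) R) in Hp. apply HR in Hp. destruct Hp as [i [a [E Hia]]].
  destruct (Hi i a Hia) as [Ni Na]. exists (mk i Ni), (mk a Na). apply is_opair_val, E.
- apply inclusion_set.
- intros x Hx. destruct (fresh_atom (val x) empty Hx) as [a [Ha _]].
  exists (mk a (proj2 (Hi _ _ Ha))). apply ERN, Ha.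
(* A urelement belonging to [v] lies in any set [E] of urelements that generates [v], but a small
   [E] misses the block of some index [i]. *)
- destruct (val_new v) as [E [HE Gv]]. destruct (small_misses_block E HE) as [i [Hi' K]].
  destruct (fresh_atom i empty Hi') as [a0 [Ha0 _]].
  destruct (Hv (mk i (proj1 (Hi _ _ Ha0))) Hi') as [y [Hy Hiy]]. apply ERN in Hiy.
  apply (K (val y)); [|exact Hiy].
  apply (gen_atom (fun a => a ∈ E) (mem_definable E) (small_atoms E HE)).
  + apply (gens_val_mem E v y HE Gv Hy).
  + exists i. exact Hiy.
Qed.

(* [h] represents the set of codes [g] in the extension. *)
Definition coded (g h : V) : Prop := (g <> empty /\ h = g) \/ (g = empty /\ h = zero).

Lemma gens_opair E x y : gens E x -> gens E y -> gens E (opair x y).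
Proof.
assert (U : forall u v, gens E u -> gens E v -> gens E (upair u v)).
{ intros u v Hu Hv. apply gen_set; [exists u; apply mem_upair; auto|].
  intros w Hw. apply mem_upair in Hw. destruct Hw as [-> | ->]; assumption. }
intros Hx Hy. apply U; apply U; assumption.
Qed.

Lemma make_coded E g : small E -> (forall z, z ∈ g -> gens E z) ->
  exists v : obj N, ~ ur v /\ (forall z : obj N, mem z v <-> val z ∈ g) /\ coded g (val v).
Proof.
intros HE Hg. destruct (make_set E g HE Hg) as [v [H1 [H2 [_ [H3 H4]]]]].
exists v. split; [exact H1|]. split; [exact H2|].
destruct (classic (g = empty)) as [Eg|Ng]; [right; auto|left]. split; [exact Ng|].
apply H3, nonempty, Ng.
Qed.

Lemma coded_unique g h h' : coded g h -> coded g h' -> h = h'.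
Proof. intros [[A ->]|[A ->]] [[B ->]|[B ->]]; congruence. Qed.

(** The domain is a part of [bulk], so [small_union] chooses and unites supports of the values; the
    arguments of the sequence are pure. *)
Lemma sequence_support (e f : V) :
  (forall b, b ∈ e -> b ∈ bulk /\ exists x, b = embed x) -> sequence new_set e f ->
  exists E, small E /\ forall p, p ∈ f -> gens E p.
Proof.
intros He Hf. pose proof (gens_definable (M := M)) as DG.
destruct (small_union e (fun b E => exists y, rel f b y /\ gens E y)) as [E [HE K]].
- def_tac.
- intros b Hb. apply He, Hb.
- intros b Hb. destruct (proj1 (proj2 Hf) b Hb) as [y Hy].
  destruct (sequence_dom new_set e f b y Hf Hy) as [_ [E [HE Gy]]].
  exists E. split; [exact HE|]. exists y. auto.
- exists E. split; [exact HE|]. intros p Hp. destruct (proj1 Hf p Hp) as [b [y [Hb [_ ->]]]].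
  apply gens_opair.
  + destruct (He b Hb) as [_ [x ->]]. apply gen_embed, mem_definable.
  + destruct (K b Hb) as [E' [L [y' [Hy' Gy']]]].
    rewrite (proj2 (proj2 Hf) b y y'); [|apply relE; exact Hp|exact Hy'].
    apply (gens_mono E'); assumption.
Qed.

Lemma extension_DC (k : V) :
  is_ordinal k -> (forall x, x ∈ k -> embed x ∈ bulk) -> holds_at N (ax_DC 0) (inclusion k).
Proof.
intros Hk Hbulk s t. apply sat_DC. intros R HR Hserial. change (scons (inclusion k) s 0) with (inclusion k).
pose proof pure_definable as DP. pose proof new_set_definable as DN.
(* [D] is not written [embed k], which for empty [k] would be [zero] and have an element. *)
destruct (replacement (fun x y => y = embed x) k) as [D HD]; [def_tac|congruence|].
assert (Dtrans : forall a b c, a ∈ D -> b ∈ D -> c ∈ D -> c ∈ b -> b ∈ a -> c ∈ a).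
{ intros a b c Ha Hb Hc Hcb Hba. apply HD in Ha, Hb, Hc.
  destruct Ha as [x [Hx ->]], Hb as [y [Hy ->]], Hc as [z [Hz ->]].
  apply (mem_embed_embed z y) in Hcb. apply (mem_embed_embed y x) in Hba. apply (mem_embed_embed z x).
  apply (ordinal_transitive k x y z); assumption. }
assert (HDb : forall b, b ∈ D -> b ∈ bulk /\ exists x, b = embed x).
{ intros b Hb. apply HD in Hb. destruct Hb as [x [Hx ->]]. split; [apply Hbulk, Hx|eauto]. }
(* The recursion runs in [M], where a restriction is a plain set and may be empty; [coded] passes to
   the object of the extension before [R] is consulted. *)
destruct (dependent_choice D Dtrans new_set DN
  (fun g y => exists h, coded g h /\ relC (valC R) h y)) as [f [Hf Hgood]].
{ unfold coded. def_tac. }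
(* The sequence built so far has a small support, so it is represented in the extension and
   seriality of [R] applies to it. *)
{ intros a e g Ha He Hg. destruct (sequence_support e g) as [E [HE Gg]]; [|exact Hg|].
  - intros b Hb. apply HDb. apply He, Hb.
  - destruct (make_coded E g HE Gg) as [v [_ [_ Hv]]]. destruct (Hserial v) as [y Hy].
    exists (val y). split; [apply val_new|]. exists (val v). split; [exact Hv|].
    apply relCE. apply relC_val in Hy. exact Hy. }
destruct (sequence_support D f HDb Hf) as [E [HE Gf]].
destruct (make_coded E f HE Gf) as [F [HF1 [HF2 _]]].
assert (ErF : forall x y : obj N, rel F x y <-> rel f (val x) (val y)).
{ intros x y. rewrite rel_val, relE. apply (HF2 (npair x y)). }
assert (HDk : forall x : obj N, val x ∈ D <-> mem x (inclusion k)).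
{ intro x. rewrite (HD (val x)). split.
  - intros [a [Ha Ea]]. change (val x ∈ embed k). rewrite Ea. apply mem_embed_embed, Ha.
  - intro H. destruct (embed_elements x k H) as [a [Ha ->]]. exists a. auto. }
assert (comp : forall p, p ∈ f -> exists b y : obj N, p = opair (val b) (val y)).
{ intros p Hp. destruct (proj1 Hf p Hp) as [b [y [Hb [Ny ->]]]].
  destruct (HDb b Hb) as [_ [x ->]]. exists (inclusion x), (mk y Ny). reflexivity. }
exists F. split; [split; [exact HF1|split; [|split]]|].
- intros p Hp. destruct (comp (val p) (proj1 (HF2 p) Hp)) as [b [y Ep]].
  exists b, y. apply is_opair_val, Ep.
- intros x y z Hy Hz. apply ErF in Hy, Hz. apply val_injective.
  apply (proj2 (proj2 Hf) (val x)); assumption.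
- intro x. rewrite <- HDk. split.
  + intro Hx. destruct (proj1 (proj2 Hf) (val x) Hx) as [y Hy].
    destruct (sequence_dom new_set D f _ y Hf Hy) as [_ Ny]. exists (mk y Ny). apply ErF, Hy.
  + intros [y Hy]. apply ErF in Hy. apply (sequence_dom new_set D f _ (val y) Hf Hy).
- intros a Ha. apply HDk in Ha. destruct (Hgood (val a) Ha) as [g [y [Hg [Hy [h [Hh HRy]]]]]].
  assert (Gg : forall z, z ∈ g -> gens E z) by (intros z Hz; apply Gf, Hg, Hz).
  destruct (make_coded E g HE Gg) as [G [HG1 [HG2 HG3]]].
  destruct (sequence_dom new_set D f _ y Hf Hy) as [_ Ny].
  exists G, (mk y Ny). split; [split; [exact HG1|]|split].
  + intro p. rewrite (HG2 p), (Hg (val p)), (HF2 p). split.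
    * intros [Hp [b [z [Hb [Hba Ep]]]]]. split; [exact Hp|].
      destruct (comp _ Hp) as [b' [z' Ep']]. exists b', z'.
      split; [|apply is_opair_val, Ep'].
      rewrite Ep' in Ep. apply opair_injective in Ep. destruct Ep as [Eb _].
      change (val b' ∈ val a). rewrite Eb. exact Hba.
    * intros [Hp [b [z [Hb Ep]]]]. split; [exact Hp|]. apply is_opair_val in Ep.
      exists (val b), (val z). split; [|split; [exact Hb|exact Ep]].
      rewrite Ep in Hp. apply relE in Hp. apply (sequence_dom new_set D f _ _ Hf Hp).
  + apply ErF. exact Hy.
  + apply relC_val. rewrite (coded_unique g _ h HG3 Hh). apply relCE in HRy. exact HRy.
Qed.
End Cardinal.

(** It is the copy of [k] under [embed] that goes into [bulk], since sequences in the extension are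
    indexed by it; [empty] and [zero] are added as two distinct elements. *)
Lemma setting_exists {M : structure} {HM : ground M} (k : obj M) :
  exists HS : setting M, forall x, mem x k -> mem (embed x) (@bulk M HM HS).
Proof.
destruct (pair_closed_superset (bigcup (upair (upair empty zero) (embed k)))) as [K [HK1 HK2]].
assert (H : exists a b, mem a K /\ mem b K /\ a <> b).
{ exists empty, zero. split; [|split].
  - apply HK1, mem_bigcup. exists (upair empty zero). rewrite !mem_upair. auto.
  - apply HK1, mem_bigcup. exists (upair empty zero). rewrite !mem_upair. auto.
  - intro E. apply (mem_empty empty). rewrite E at 2. apply mem_zero. reflexivity. }
exists (Build_setting M HM K HK2 H). intros x Hx. apply HK1, mem_bigcup.
exists (embed k). split; [apply mem_upair; auto|]. apply mem_embed_embed, Hx.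
Qed.

Theorem theorem4p12 :
  consistent KM ->
  (exists M : structure, models M (extend KM ax_choice)) /\
  (forall (M : structure) (kappa : obj M),
      models M (extend KM ax_choice) ->
      holds_at M (fInfCardinal 0) kappa ->
      exists (N : structure) (j : obj M -> obj N),
        transitive_embedding M N j /\
        models N (extend KMU_R ax_choice) /\
        holds_at N (fInfCardinal 0) (j kappa) /\
        holds_at N (ax_DC 0) (j kappa) /\
        ~ holds N ax_collection).
Proof.
intros _. split.
- exists Trees.universe. exact Trees.universe_models.
- intros M k HM Hk. pose (HG := HM : ground M).
  destruct (setting_exists k) as [HS Hbulk].
  destruct (cls_inhabited M) as [X].
  destruct (proj1 (sat_inf_cardinal M _ _ 0) (Hk (fun _ => k) (fun _ => X))) as [Hord _].
  exists extension, inclusion. split; [apply inclusion_embedding|].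
  split; [apply extension_models|]. split; [apply inclusion_cardinal, Hk|].
  split; [apply extension_DC; assumption|apply extension_not_collection].
Qed.
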